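(* Let $m\ge 2$ be an integer and let $k$ be a field whose characteristic is zero or does not divide the order of the Coxeter group $D_{2m+1}$. Then the Loewy length of the descent algebra $\Sigma_k(D_{2m+1})$ is $m+2$; that is, the smallest $l\in\mathbb N$ with $(\operatorname{rad}\Sigma_k(D_{2m+1}))^l=0$ is $l=m+2$.
   Context: Coxeter group of type $D$. For $n\in\mathbb N$ let $[n]=\{1,\dots,n\}$ and $[\pm n]=\{1,\dots,n\}\cup\{-1,\dots,-n\}$. A signed permutation is a permutation $w$ of $[\pm n]$ with $w(-i)=-w(i)$ for all $i\in[n]$; it acts on $\mathbb R^n$ by $w(v_1,\dots,v_n)=(v_{w^{-1}(1)},\dots,v_{w^{-1}(n)})$, where $v_{-i}=-v_i$. The group $D_n$ is the group of signed permutations that negate an even number of elements of $[n]$. Its reflection arrangement $\mathcal A$ consists of the hyperplanes $\{v\in\mathbb R^n: v_i=v_j\}$ with $i,j\in[\pm n]$, $i\ne j,-j$ (where $v_{-i}=-v_i$). Descent algebra. Let $W$ be a finite reflection group with reflection arrangement $\mathcal A$ in $V$. Let $c$ be a connected component of $V\setminus\bigcup_{H\in\mathcal A}H$ (the fundamental chamber), and let $S\subseteq W$ be the set of reflections in the walls of $c$ (the hyperplanes $H\in\mathcal A$ such that $H\cap\overline c$ spans $H$). Then $S$ generates $W$ and $(W,S)$ is a Coxeter system. The length of $w\in W$ is the smallest $i$ such that $w=s_1\cdots s_i$ with $s_1,\dots,s_i\in S$. For $J\subseteq S$ let $W_J=\langle J\rangle$, let $X_J$ be the set of minimal length representatives of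 the cosets $wW_J$ of $W_J$ in $W$ (each coset contains a unique element of minimal length), and let $x_J=\sum_{w\in X_J}w\in kW$. By Solomon's theorem the elements $x_J$ $(J\subseteq S)$ form a $k$-basis of a subalgebra of the group algebra $kW$; this subalgebra is the descent algebra $\Sigma_k(W)$. Loewy length. For a finite dimensional $k$-algebra $A$, $\operatorname{rad}A$ is its Jacobson radical and the Loewy length of $A$ is the smallest $l\in\mathbb N$ such that $(\operatorname{rad}A)^l=0$. *)

(* Defs.v *)
From HB Require Import structures.
From mathcomp Require Import all_boot all_order all_algebra all_fingroup.
From mathcomp Require Import falgebra.
From mathcomp Require Import boolp classical_sets reals topology normedtype.

Set Implicit Arguments.
Unset Strict Implicit.
Unset Printing Implicit Defensive.

Import Order.TTheory GRing.Theory Num.Theory.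
Import numFieldNormedType.Exports.

Local Open Scope ring_scope.

Definition group_algebra (k : fieldType) (gT : finGroupType) : Type :=
  {ffun gT -> k^o}.

Section GroupAlgebra.
Variables (k : fieldType) (gT : finGroupType).
Local Notation kG := (group_algebra k gT).
Implicit Types f g h : kG.

HB.instance Definition _ := Vector.copy kG {ffun gT -> k^o}.

Definition gelt (x : gT) : kG := [ffun y => (y == x)%:R].

Definition gconv f g : kG := [ffun x => \sum_y f y * g (y^-1 * x)%g].

Fact gconvA : associative gconv.
Proof.
move=> f g h; apply/ffunP=> x; rewrite !ffunE.
under eq_bigr => y _ do rewrite ffunE mulr_sumr.
under [RHS]eq_bigr => y _ do rewrite ffunE mulr_suml.
rewrite [RHS]exchange_big /=; apply: eq_bigr => y _.
rewrite [RHS](reindex_inj (mulgI y)) /=; apply: eq_bigr => z _.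
by rewrite mulKg invMg !mulgA mulrA.
Qed.

Fact gconv1g : left_id (gelt 1) gconv.
Proof.
move=> f; apply/ffunP=> x; rewrite ffunE (bigD1 1%g) //= ffunE eqxx mul1r.
rewrite invg1 mul1g big1 ?addr0 // => y /negPf ny1.
by rewrite ffunE ny1 mul0r.
Qed.

Fact gconvg1 : right_id (gelt 1) gconv.
Proof.
move=> f; apply/ffunP=> x; rewrite ffunE (bigD1 x) //= ffunE mulVg eqxx mulr1.
rewrite big1 ?addr0 // => y nyx; rewrite ffunE -eq_mulVg1.
by rewrite (negPf nyx) mulr0.
Qed.

Fact gconvDl : left_distributive gconv +%R.
Proof.
move=> f g h; apply/ffunP=> x; rewrite !ffunE -big_split.
by apply: eq_bigr => y _; rewrite ffunE mulrDl.
Qed.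

Fact gconvDr : right_distributive gconv +%R.
Proof.
move=> f g h; apply/ffunP=> x; rewrite !ffunE -big_split.
by apply: eq_bigr => y _; rewrite ffunE mulrDr.
Qed.

Fact gelt1_neq0 : gelt 1 != 0.
Proof.
by apply/eqP => /ffunP/(_ 1%g)/eqP; rewrite !ffunE eqxx oner_eq0.
Qed.

HB.instance Definition _ := GRing.Zmodule_isNzRing.Build kG
  gconvA gconv1g gconvg1 gconvDl gconvDr gelt1_neq0.

Fact gconvZl (a : k) f g : a *: (f * g) = (a *: f) * g.
Proof.
apply/ffunP=> x; rewrite !ffunE scaler_sumr.
by apply: eq_bigr => y _; rewrite ffunE -scalerAl.
Qed.

HB.instance Definition _ := GRing.Lmodule_isLalgebra.Build k kG gconvZl.

Fact gconvZr (a : k) f g : a *: (f * g) = f * (a *: g).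
Proof.
apply/ffunP=> x; rewrite !ffunE scaler_sumr.
by apply: eq_bigr => y _; rewrite ffunE -scalerAr.
Qed.

HB.instance Definition _ := GRing.Lalgebra_isAlgebra.Build k kG gconvZr.
HB.instance Definition _ := Algebra_isFalgebra.Build k kG.

Lemma geltM (x y : gT) : gelt (x * y)%g = gelt x * gelt y.
Proof.
apply/ffunP=> z; rewrite [RHS]ffunE (bigD1 x) //= !ffunE eqxx mul1r.
rewrite big1 ?addr0 => [|u /negPf nux]; last by rewrite !ffunE nux mul0r.
by rewrite -[in RHS](inj_eq (mulgI x)) mulKVg.
Qed.

End GroupAlgebra.

Section DescentAlgebra.
Variables (k : fieldType) (gT : finGroupType) (S : {set gT}).
Implicit Types (w : gT) (J : {set gT}).

(* [(S ^+ i)%g] is the set of products s_1 ... s_i with all s_j in S; the     *)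
(* default value 0 is only used for w outside the subgroup <<S>>.             *)
Definition cox_length w : nat :=
  if pselect (exists i, w \in (S ^+ i)%g) is left ex then ex_minn ex else 0%N.

Definition min_coset_reps J : {set gT} :=
  [set w | [forall u in (w *: <<J>>)%g, (cox_length w <= cox_length u)%N]].

Definition descent_elt J : group_algebra k gT :=
  \sum_(w in min_coset_reps J) gelt k w.

Definition descent_algebra : {vspace group_algebra k gT} :=
  <<[seq descent_elt J | J <- enum (powerset S)]>>%VS.

End DescentAlgebra.

(* A is meant to be a subalgebra of E containing 1: its left ideals are then  *)
(* k-subspaces, so they are taken in {vspace E}. The Jacobson radical is the  *)
(* intersection of the maximal left ideals; it depends on A alone, not on E.  *)

Section Radical.
Variables (k : fieldType) (E : falgType k).
Implicit Types A I J M : {vspace E}.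

Definition left_ideal A I : Prop := (I <= A)%VS /\ (A * I <= I)%VS.

Definition maximal_left_ideal A M : Prop :=
  [/\ left_ideal A M, M <> A &
      forall I, left_ideal A I -> (M <= I)%VS -> I = M \/ I = A].

Definition in_radical A (x : E) : Prop :=
  x \in A /\ forall M, maximal_left_ideal A M -> x \in M.

Lemma radical_subspace A :
  exists R : {vspace E}, forall x, x \in R <-> in_radical A x.
Proof.
pose good (R : {vspace E}) := forall x, x \in R -> in_radical A x.
have good0 : good 0%VS.
  by move=> x; rewrite memv0 => /eqP->; split=> [|M _]; exact: mem0v.
have goodD U V : good U -> good V -> good (U + V)%VS.
  move=> gU gV x /memv_addP[u /gU[uA uM] [v /gV[vA vM] ->]].
  by split=> [|M mM]; apply: memvD => //; [apply: uM | apply: vM].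
have good1 x : in_radical A x -> good <[x]>%VS.
  move=> [xA xM] y /vlineP[a ->].
  by split=> [|M mM]; apply: memvZ => //; apply: xM.
have ex : exists d, `[< exists2 U, good U & \dim U = d >].
  by exists 0%N; apply/asboolP; exists 0%VS; rewrite ?dimv0.
have ub d : `[< exists2 U, good U & \dim U = d >] -> (d <= \dim {:E})%N.
  by move=> /asboolP[U _ <-]; rewrite dimvS ?subvf.
case: (ex_maxnP ex ub) => d /asboolP[R gR dR] maxd.
exists R => x; split=> [/gR //|xR].
have := maxd (\dim (R + <[x]>)%VS).
rewrite -dR => /(_ _) le_dim.
have RxR : (R == R + <[x]>)%VS.
  rewrite eqEdim addvSl /= le_dim //; apply/asboolP.
  by exists (R + <[x]>)%VS => //; apply: goodD => //; exact: good1.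
by rewrite (eqP RxR) memvE addvSr.
Qed.

Definition radical A : {vspace E} := projT1 (cid (radical_subspace A)).

Lemma radicalP A x : x \in radical A <-> in_radical A x.
Proof. exact: (projT2 (cid (radical_subspace A))). Qed.

(* For l > 0, [(U ^+ l)%VS] is spanned by the products of l elements of U;    *)
(* [(U ^+ 0)%VS] is the line k1, nonzero like A, so l = 0 never qualifies.    *)
Definition is_loewy_length A (l : nat) : Prop :=
  (radical A ^+ l)%VS = 0%VS /\
  forall j : nat, (radical A ^+ j)%VS = 0%VS -> (l <= j)%N.

End Radical.

(* The pair (i, b) : 'I_n * bool encodes the element i of      *)
(* [+-n] if b = false, and its opposite -i if b = true.                       *)

Definition sopp (n : nat) (x : 'I_n * bool) : 'I_n * bool := (x.1, ~~ x.2).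

Definition signed (n : nat) (w : {perm 'I_n * bool}) : bool :=
  [forall x, w (sopp x) == sopp (w x)].

Definition negated (n : nat) (w : {perm 'I_n * bool}) : {set 'I_n} :=
  [set i | (w (i, false)).2].

Record typeD (n : nat) := TypeD {
  typeD_perm :> {perm 'I_n * bool};
  _ : signed typeD_perm && ~~ odd #|negated typeD_perm|
}.

HB.instance Definition _ (n : nat) := [isSub for @typeD_perm n].
HB.instance Definition _ (n : nat) := [Finite of typeD n by <:].

Section TypeDGroup.
Variable n : nat.
Implicit Types w u : typeD n.

Lemma soppK : involutive (@sopp n).
Proof. by case=> i b; rewrite /sopp /= negbK. Qed.

Lemma signedP (w : {perm 'I_n * bool}) :
  reflect (forall x, w (sopp x) = sopp (w x)) (signed w).
Proof. by apply: (iffP forallP) => h x; apply/eqP. Qed.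

Lemma signed_snd (w : {perm 'I_n * bool}) : signed w ->
  forall x, (w x).2 = x.2 (+) (w (x.1, false)).2.
Proof.
move=> /signedP sw [i [|]] //=.
by have := sw (i, false); rewrite {1}/sopp /= => ->.
Qed.

Lemma signed_fst_inj (w : {perm 'I_n * bool}) : signed w ->
  injective (fun i => (w (i, false)).1).
Proof.
move=> /signedP sw i j eq1.
have [eq2|] := eqVneq (w (i, false)).2 (w (j, false)).2.
  suff /perm_inj[] : w (i, false) = w (j, false) by [].
  by rewrite [LHS]surjective_pairing eq1 eq2 -surjective_pairing.
move=> ne2; suff /perm_inj[] : w (i, false) = w (sopp (j, false)) by [].
rewrite sw /sopp [LHS]surjective_pairing eq1; congr (_, _).
by case: (w (i, _)).2 (w (j, _)).2 ne2 => [] [].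
Qed.

Lemma odd_negated (w : {perm 'I_n * bool}) :
  odd #|negated w| = \big[addb/false]_i (w (i, false)).2.
Proof.
rewrite -sum1dep_card big_mkcond /=.
rewrite (big_morph odd oddD (erefl : odd 0 = false)).
by apply: eq_bigr => i _; case: (w _).2.
Qed.

Fact typeD_mul_subproof (u w : {perm 'I_n * bool}) :
  signed u && ~~ odd #|negated u| -> signed w && ~~ odd #|negated w| ->
  signed (u * w)%g && ~~ odd #|negated (u * w)%g|.
Proof.
move=> /andP[su ou] /andP[sw ow]; apply/andP; split.
  by apply/signedP => x; rewrite !permM (signedP _ su) (signedP _ sw).
rewrite odd_negated; under eq_bigr => i _ do rewrite permM (signed_snd sw).
rewrite big_split /= -odd_negated (negPf ou) /=.
rewrite -(reindex_inj (signed_fst_inj su)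
     (P := xpredT) (F := fun i => (w (i, false)).2)) /=.
by rewrite -odd_negated.
Qed.

Fact typeD_one_subproof :
  let p := (1 : {perm 'I_n * bool})%g in signed p && ~~ odd #|negated p|.
Proof.
apply/andP; split; first by apply/signedP=> x; rewrite !perm1.
by rewrite odd_negated big1 // => i _; rewrite perm1.
Qed.

Fact typeD_inv_subproof (w : {perm 'I_n * bool}) :
  signed w && ~~ odd #|negated w| -> signed w^-1%g && ~~ odd #|negated w^-1%g|.
Proof.
move=> Dw; rewrite invg_expg; elim: (#[w]%g.-1) => [|i IH].
  by rewrite expg0; exact: typeD_one_subproof.
by rewrite expgS; exact: typeD_mul_subproof.
Qed.

(* The product of signed permutations is composition of functions, whereas    *)
(* the product of {perm T} applies its left factor first.                     *)
Definition typeD_mul w u : typeD n :=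
  TypeD (typeD_mul_subproof (valP u) (valP w)).
Definition typeD_one : typeD n := TypeD typeD_one_subproof.
Definition typeD_inv w : typeD n := TypeD (typeD_inv_subproof (valP w)).

Fact typeD_mulA : associative typeD_mul.
Proof. by move=> u v w; apply: val_inj; rewrite /= mulgA. Qed.

Fact typeD_mul1 : left_id typeD_one typeD_mul.
Proof. by move=> w; apply: val_inj; rewrite /= mulg1. Qed.

Fact typeD_mulV : left_inverse typeD_one typeD_inv typeD_mul.
Proof. by move=> w; apply: val_inj; rewrite /= mulgV. Qed.

HB.instance Definition _ := Finite_isGroup.Build (typeD n)
  typeD_mulA typeD_mul1 typeD_mulV.

Lemma typeDM w u (x : 'I_n * bool) : (w * u)%g x = w (u x).
Proof. exact: permM. Qed.

End TypeDGroup.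

Section Arrangement.
Local Open Scope classical_set_scope.
Variables (R : realType) (n : nat).
Implicit Types (v : 'rV[R]_n) (H c : set 'rV[R]_n) (w : typeD n).

Definition scoord v (x : 'I_n * bool) : R :=
  if x.2 then - v ord0 x.1 else v ord0 x.1.

Definition typeD_act w v : 'rV[R]_n := \row_i scoord v ((w^-1)%g (i, false)).

Definition typeD_hyperplane (i j : 'I_n * bool) : set 'rV[R]_n :=
  [set v | scoord v i = scoord v j].

Definition typeD_arrangement : set (set 'rV[R]_n) :=
  [set H | exists i j, [/\ i <> j, i <> sopp j & H = typeD_hyperplane i j]].

Definition arrangement_complement : set 'rV[R]_n :=
  ~` \bigcup_(H in typeD_arrangement) H.

Definition chamber c : Prop :=
  exists2 v, arrangement_complement v &
    c = connected_component arrangement_complement v.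

Definition wall c H : Prop :=
  typeD_arrangement H /\
  exists X : seq 'rV[R]_n,
    [set` X] `<=` H `&` closure c /\ [set` <<X>>%VS] = H.

Definition orthogonal_reflection H (f : 'rV[R]_n -> 'rV[R]_n) : Prop :=
  (forall v, H v -> f v = v) /\
  (forall v, (forall u, H u -> u *m v^T = 0) -> f v = - v).

Definition simple_reflections c : {set typeD n} :=
  finset (fun w => `[< exists2 H, wall c H &
                         orthogonal_reflection H (typeD_act w) >]).

End Arrangement.

(* Main.v *)
Require Import Defs.
From mathcomp Require Import all_boot all_order all_algebra all_fingroup.
From mathcomp Require Import falgebra.
From mathcomp Require Import boolp classical_sets reals topology normedtype.
From mathcomp Require Import zify ring lra.

(* A face F acts on the chambers by the Tits projection C |-> F C, and the     *)
(* W-invariant combinations of faces are mapped anti-isomorphically onto the   *)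
(* descent algebra by their action on the fundamental chamber (Bidigare): x_J  *)
(* is the image of the orbit sum of a face. The characters of this algebra are *)
(* the sums of the coefficients of the faces lying in a given flat; hence the  *)
(* radical consists of the invariant elements whose coefficients sum to 0 over *)
(* the faces of each given support.                                            *)
(*                                                                             *)
(* Upper bound. The support of a face groups the coordinates into a zero block *)
(* of size z and blocks of sizes b; its level is the sum of ceil(z/2) and of   *)
(* the floor((b-1)/2), which is at most m+1. Multiplying a face F on the right *)
(* by a radical element only yields faces of lower level: if F <= F' have the  *)
(* same level, then the blocks of F that are split in F' have even size and    *)
(* are cut in two, so that negating such a block lies in D_n, stabilises both  *)
(* supports and exchanges the faces above F with the support of F'; their      *)
(* coefficients are therefore equal, and they sum to 0.                        *)
(*                                                                             *)
(* Lower bound. As n = 2m+1 is odd, the alternating sum of the sign vectors    *)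
(* eps in {1,-1}^n lies in the radical. In its (m+1)-st power, the coefficients*)
(* of the faces on which m pairs of coordinates are equal, positive and less   *)
(* than the last coordinate sum up to the Thue-Morse sum over q < 2^m of       *)
(* (-1)^(s(q)) q^m, up to sign, which is (-1)^m m! 2^(m(m-1)/2), hence not 0   *)
(* in k.                                                                       *)

Set Implicit Arguments.
Unset Strict Implicit.
Unset Printing Implicit Defensive.

Import Order.TTheory GRing.Theory Num.Theory.
Import numFieldNormedType.Exports.
Import fintype mathcomp.boot.finset.

Local Open Scope ring_scope.

(** * Faces as sign patterns *)

(** The computation takes place in the algebra of faces. Every chamber is a [cone u] with simple
    reflections [base_set u] ([chamber_cone], [simple_reflections_cone]), and [theta u] maps the
    invariant combinations of faces linearly and bijectively onto the descent algebra, reversing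
    products ([theta_mul], [theta_inj], [descentP]). By [radicalE] the radical corresponds to the
    [null] elements: the kernels of the characters [phi] are maximal left ideals, and conversely a
    null element generates a nil left ideal.

    Nilpotency is measured by [level]. By [null_coef], a face times a null invariant element has no
    component of the same or a larger level, so each radical factor lowers the filtration [lev] by
    one ([lev_conv]). The unit has level [uphalf n], that is m + 1, hence m + 2 factors give 0
    ([radical_pow0]).

    Conversely, the powers of [sign_elt] are the explicit elements [word_elt]. The sum of the
    coefficients of the (m+1)-st power over [pair_face] is evaluated by [word_sum] and [tm_sum]; it
    is m! times a power of 2 up to sign, which is invertible in k because n! divides the order of
    the group. *)

Section Vectors.
Variable n : nat.
Local Notation S := ('I_n * bool)%type.
Local Notation W := (typeD n).

Definition popp (p : S * S) := (sopp p.1, sopp p.2).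
Definition root_act (w : W) (p : S * S) := (w p.1, w p.2).
Definition face_act (w : W) (F : {set S * S}) := [set p | root_act w^-1%g p \in F].

Definition signed_coord (D : zmodType) (v : 'I_n -> D) (x : S) : D :=
  if x.2 then - v x.1 else v x.1.
Definition rootval (D : zmodType) (v : 'I_n -> D) (p : S * S) : D :=
  signed_coord v p.1 + signed_coord v p.2.
Definition vec_act (D : zmodType) (w : W) (v : 'I_n -> D) : 'I_n -> D :=
  fun i => signed_coord v (w^-1%g (i, false)).

(* A face of the arrangement is encoded by the set of the roots e_x + e_y     *)
(* (x, y in [+-n], x <> y, -y) that are positive on it.                       *)
Definition pattern (D : realDomainType) (v : 'I_n -> D) : {set S * S} :=
  [set p | (p.1.1 != p.2.1) && (0 < rootval v p)].

(** The Tits product: a root takes its sign from [F], and from [G] where [F] vanishes. *)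
Definition tits (F G : {set S * S}) : {set S * S} :=
  [set p | (p \in F) || (p \in G) && (popp p \notin F)].

(** This encodes the support (linear span) of a face. The degenerate pairs built on a single index
    lie in no pattern, hence in the zeros of every face. *)
Definition zeros (F : {set S * S}) : {set S * S} :=
  [set p | (p \notin F) && (popp p \notin F)].

Definition face (F : {set S * S}) := exists v : 'I_n -> int, F = pattern v.

Lemma typeD_sopp (w : W) x : w (sopp x) = sopp (w x).
Proof. by case: w => w /= /andP[/signedP sw _]; rewrite sw. Qed.

Lemma soppK' (x : S) : sopp (sopp x) = x.
Proof. exact: soppK. Qed.

Lemma eq_fst (x y : S) : (x.1 == y.1) = (x == y) || (x == sopp y).
Proof.
case: x y => [i b] [j b']; rewrite !xpair_eqE /=.
by case: (i == j) => //=; case: b b' => [] [].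
Qed.

Lemma poppK : involutive popp.
Proof. by case=> x y; rewrite /popp /= !soppK'. Qed.

Lemma typeD1 (x : S) : (1%g : W) x = x. Proof. exact: perm1. Qed.

Lemma typeDK (w : W) x : w^-1%g (w x) = x.
Proof. by rewrite -typeDM mulVg typeD1. Qed.

Lemma typeDKV (w : W) x : w (w^-1%g x) = x.
Proof. by rewrite -typeDM mulgV typeD1. Qed.

Lemma typeD_inj (w : W) : injective w. Proof. exact: perm_inj. Qed.

Lemma typeDP (w u : W) : (forall x, w x = u x) -> w = u.
Proof. by move=> h; apply/val_inj/permP. Qed.

Lemma typeD_fst (w : W) x y : ((w x).1 == (w y).1) = (x.1 == y.1).
Proof. by rewrite !eq_fst -typeD_sopp !(inj_eq (@typeD_inj w)). Qed.

Lemma root_act_fst (w : W) p :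
  ((root_act w p).1.1 == (root_act w p).2.1) = (p.1.1 == p.2.1).
Proof. exact: typeD_fst. Qed.

Lemma root_actK w p : root_act w^-1%g (root_act w p) = p.
Proof. by case: p => x y; rewrite /root_act /= !typeDK. Qed.

Lemma root_actKV w p : root_act w (root_act w^-1%g p) = p.
Proof. by case: p => x y; rewrite /root_act /= !typeDKV. Qed.

Lemma root_actM w u p : root_act (w * u)%g p = root_act w (root_act u p).
Proof. by rewrite /root_act /= !typeDM. Qed.

Lemma root_act1 p : root_act 1%g p = p.
Proof. by case: p => x y; rewrite /root_act /= !typeD1. Qed.

Lemma root_act_popp w p : root_act w (popp p) = popp (root_act w p).
Proof. by rewrite /root_act /popp /= !typeD_sopp. Qed.

Lemma in_face_act w F p : (root_act w p \in face_act w F) = (p \in F).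
Proof. by rewrite inE root_actK. Qed.

Lemma face_actM w u F : face_act (w * u)%g F = face_act w (face_act u F).
Proof. by apply/setP=> p; rewrite !inE invMg root_actM. Qed.

Lemma face_act1 F : face_act 1%g F = F.
Proof. by apply/setP=> p; rewrite inE invg1 root_act1. Qed.

Lemma face_actK w : cancel (face_act w) (face_act w^-1%g).
Proof. by move=> F; rewrite -face_actM mulVg face_act1. Qed.

Lemma face_actKV w : cancel (face_act w^-1%g) (face_act w).
Proof. by move=> F; rewrite -face_actM mulgV face_act1. Qed.

Lemma face_act_inj w : injective (face_act w).
Proof. exact: can_inj (face_actK w). Qed.

Lemma face_act_tits w F G : face_act w (tits F G) = tits (face_act w F) (face_act w G).
Proof. by apply/setP=> p; rewrite !inE -root_act_popp. Qed.

Lemma face_act_zeros w F : zeros (face_act w F) = face_act w (zeros F).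
Proof. by apply/setP=> p; rewrite !inE root_act_popp. Qed.

Lemma titsA F G H : tits F (tits G H) = tits (tits F G) H.
Proof.
apply/setP=> p; rewrite !inE poppK.
by case: (p \in F); case: (popp p \in F); case: (p \in G); case: (popp p \in G);
  rewrite ?andbT ?andbF ?orbT ?orbF.
Qed.

Lemma zeros_tits F G : zeros (tits F G) = zeros F :&: zeros G.
Proof.
apply/setP=> p; rewrite !inE poppK.
by case: (p \in F); case: (popp p \in F); case: (p \in G); case: (popp p \in G).
Qed.

Lemma sub_tits (F G : {set S * S}) : F \subset tits F G.
Proof. by apply/subsetP=> p pF; rewrite inE pF. Qed.

Lemma tits0F F : tits set0 F = F.
Proof. by apply/setP=> p; rewrite !inE andbT. Qed.

Section Real.
Variable D : realDomainType.
Implicit Types v : 'I_n -> D.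

Lemma signed_coord_sopp v x : signed_coord v (sopp x) = - signed_coord v x.
Proof. by case: x => i [] /=; rewrite /signed_coord /= ?opprK. Qed.

Lemma signed_coord_vec_act w v x : signed_coord (vec_act w v) x = signed_coord v (w^-1%g x).
Proof.
case: x => i [] //=; rewrite /signed_coord /= -/(signed_coord v (w^-1%g (i, true))) /vec_act.
by rewrite -signed_coord_sopp -typeD_sopp.
Qed.

Lemma rootval_vec_act w v p : rootval (vec_act w v) p = rootval v (root_act w^-1%g p).
Proof. by rewrite /rootval !signed_coord_vec_act. Qed.

Lemma rootval_popp v p : rootval v (popp p) = - rootval v p.
Proof. by rewrite /rootval !signed_coord_sopp opprD. Qed.

Lemma pattern_vec_act w v : pattern (vec_act w v) = face_act w (pattern v).
Proof.
apply/setP=> p; rewrite !inE rootval_vec_act; congr (~~ _ && _).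
by rewrite -(typeD_fst w^-1%g).
Qed.

Lemma in_zeros v p :
  (p \in zeros (pattern v)) = (p.1.1 == p.2.1) || (rootval v p == 0).
Proof.
rewrite !inE /= rootval_popp oppr_gt0 negb_and negbK.
case: eqP => //= _.
by rewrite -!leNgt -eq_le eq_sym.
Qed.

Lemma signed_coordD v v' x :
  signed_coord (fun i => v i + v' i) x = signed_coord v x + signed_coord v' x.
Proof. by case: x => i []; rewrite /signed_coord /= ?opprD. Qed.

Lemma signed_coordZ a v x : signed_coord (fun i => a * v i) x = a * signed_coord v x.
Proof. by case: x => i []; rewrite /signed_coord /= ?mulrN. Qed.

Lemma rootvalD v v' p :
  rootval (fun i => v i + v' i) p = rootval v p + rootval v' p.
Proof. by rewrite /rootval !signed_coordD addrACA. Qed.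

Lemma rootvalZ a v p : rootval (fun i => a * v i) p = a * rootval v p.
Proof. by rewrite /rootval !signed_coordZ mulrDr. Qed.

Lemma rootval_ext v v' : v =1 v' -> rootval v =1 rootval v'.
Proof. by move=> e p; rewrite /rootval /signed_coord !e. Qed.

Lemma pattern_ext v v' : v =1 v' -> pattern v = pattern v'.
Proof. by move=> e; apply/setP=> p; rewrite !inE (rootval_ext e). Qed.

End Real.

Lemma pattern_asym (v : 'I_n -> int) p : p \in pattern v -> popp p \notin pattern v.
Proof.
rewrite !inE rootval_popp oppr_gt0 => /andP[-> /= h].
by rewrite -leNgt ltW.
Qed.

(** Up to scaling, [N * v + v'] is [v] moved slightly towards [v']: the bound keeps the sign of
    every root that is nonzero on [v], and [v'] decides the others. *)
Lemma tits_pattern_dom (v v' : 'I_n -> int) (N : int) :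
  (forall p, rootval v p != 0 -> `|rootval v' p| < N * `|rootval v p|) ->
  tits (pattern v) (pattern v') = pattern (fun i => N * v i + v' i).
Proof.
move=> hN; apply/setP=> p; have := hN p; rewrite !inE /=.
rewrite rootval_popp oppr_gt0 rootvalD rootvalZ.
case: (p.1.1 =P p.2.1) => //= _; move: (rootval v p) (rootval v' p) => x y lt_yN.
case: (ltgtP x 0) lt_yN => [x_lt0|x_gt0|->]; rewrite ?orbF ?andbF ?andbT ?mulr0 ?add0r ?orbT //=.
- move=> /(_ isT); rewrite (ltr0_norm x_lt0) mulrN => h.
  by apply/esym/negbTE; rewrite -leNgt; move: (N * x) h => z; lia.
- move=> /(_ isT); rewrite (gtr0_norm x_gt0) => h.
  by apply/esym; move: (N * x) h => z; lia.
Qed.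

Lemma tits_pattern (v v' : 'I_n -> int) (N : int) :
  (forall p, `|rootval v' p| < N) ->
  tits (pattern v) (pattern v') = pattern (fun i => N * v i + v' i).
Proof.
move=> hN; apply: tits_pattern_dom => p vp; apply: lt_le_trans (hN p) _.
rewrite ler_peMr //; first by apply: le_trans (ltW (hN p)).
by move: (rootval v p) vp => /= x; lia.
Qed.

Lemma rootval_bound (v : 'I_n -> int) : exists2 N : int, 0 < N & forall p, `|rootval v p| < N.
Proof.
exists (1 + \sum_p `|rootval v p|).
  by rewrite ltr_pwDl // sumr_ge0.
by move=> p; rewrite (bigD1 p) //= ltr_pwDl // lerDl sumr_ge0.
Qed.

Lemma face_tits F G : face F -> face G -> face (tits F G).
Proof.
move=> [v ->] [v' ->]; have [N _ hN] := rootval_bound v'.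
by rewrite (tits_pattern _ hN); eexists.
Qed.

Lemma face_face_act w F : face F -> face (face_act w F).
Proof. by move=> [v ->]; rewrite -pattern_vec_act; eexists. Qed.

Lemma pattern0 : pattern (fun=> 0 : int) = set0.
Proof.
by apply/setP=> p; rewrite !inE /rootval /signed_coord oppr0 !if_same addr0 ltxx andbF.
Qed.

Lemma face0 : face set0.
Proof. by exists (fun=> 0); rewrite pattern0. Qed.

Lemma tits_sub (F G : {set S * S}) : face G -> F \subset G -> tits F G = G.
Proof.
move=> [v ->] /subsetP FG; apply/setP=> p; rewrite inE.
apply/orP/idP => [[/FG //|/andP[] //]|pG]; right; rewrite pG /=.
by apply: contraL pG => /FG/pattern_asym; rewrite poppK.
Qed.

End Vectors.

(** * Levels *)

Section Level.
Variable n : nat.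
Local Notation S := ('I_n * bool)%type.

Definition block_weight (t b : nat) : nat := if t == 0%N then uphalf b else b.-1./2.

Definition block (v : 'I_n -> int) (t : nat) : {set 'I_n} := [set i | absz (v i) == t].

(* When a support is refined, the contribution uphalf z of the zero block and   *)
(* (b-1)/2 of the other blocks decreases for every block that is split, unless  *)
(* this block has even size and is cut in two.                                  *)
Definition level (v : 'I_n -> int) : nat :=
  (\sum_(t < (\max_i absz (v i)).+1) block_weight t #|block v t|)%N.

(* A single vanishing coordinate is not visible on the face, as the arrangement *)
(* does not contain the coordinate hyperplanes.                                 *)
Definition good (v : 'I_n -> int) : bool := #|block v 0%N| != 1%N.

Lemma block_weight0 t : block_weight t 0%N = 0%N.
Proof. by rewrite /block_weight; case: eqP. Qed.

Lemma block_max v M t : (forall i, absz (v i) < M)%N -> (M <= t)%N -> block v t = set0.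
Proof.
move=> hM le_Mt; apply/setP=> i; rewrite !inE; apply/negbTE.
by rewrite neq_ltn (leq_trans (hM i) le_Mt).
Qed.

Lemma levelE v M : (forall i, absz (v i) < M)%N ->
  level v = (\sum_(t < M) block_weight t #|block v t|)%N.
Proof.
move=> hM; rewrite /level.
rewrite -!(big_mkord xpredT (fun t => block_weight t #|block v t|)).
set m := (\max_i _).+1.
have hm i : (absz (v i) < m)%N by rewrite ltnS (leq_bigmax i).
suff aux a b : (forall i, absz (v i) < a)%N -> (a <= b)%N ->
    (\sum_(0 <= t < b) block_weight t #|block v t| =
     \sum_(0 <= t < a) block_weight t #|block v t|)%N.
  by case: (leqP m M) => h; [rewrite (aux _ _ hm h) | rewrite (aux _ _ hM (ltnW h))].
move=> ha le_ab; rewrite (big_cat_nat _ le_ab) //= addnC big_nat_cond big1 ?add0n //.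
move=> t /andP[/andP[le_at _] _].
by rewrite (block_max ha le_at) cards0 block_weight0.
Qed.

(** If only the coordinate [i0] vanishes, every root involving it takes its sign from the other
    coordinate. Doubling [v] makes room for replacing this 0 by 1 without changing any sign. *)
Lemma good_rep (F : {set S * S}) : face F -> exists2 v, good v & F = pattern v.
Proof.
move=> [v ->]; case gv: (good v); first by exists v.
move/negbFE/cards1P: gv => [i0 bi0].
have v0 i : (v i == 0) = (i == i0).
  by move/setP/(_ i): bi0; rewrite !inE absz_eq0.
exists (fun i => 2 * v i + (i == i0)%:R).
  suff e : block (fun i => 2 * v i + (i == i0)%:R) 0%N = set0 by rewrite /good e cards0.
  apply/setP=> i; rewrite !inE absz_eq0 -v0; apply/negbTE.
  by case: (v i =P 0) => [->|]; lia.
have d i : (v i = 0 /\ (i == i0)%:R = 1 :> int /\ i = i0) \/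
           (v i <> 0 /\ (i == i0)%:R = 0 :> int).
  by case: (i =P i0) (v0 i) => [->|_] /eqP h; [left | right].
apply/setP=> p; rewrite !inE; case: eqP => //= ne_p.
rewrite /rootval /signed_coord; case: p ne_p => [[i b] [j b']] /= ne_p.
move: (d i) (d j). move => [[-> [-> ei]]|[vi ->]] [[-> [-> ej]]|[vj ->]];
  by [case: ne_p; rewrite ei ej | case: b; case: b'; lia].
Qed.

Lemma card_block_sum (B : {set 'I_n}) (f : 'I_n -> nat) M :
  (forall i, f i < M)%N ->
  #|B| = (\sum_(s < M) #|[set i in B | f i == s]|)%N.
Proof.
move=> hM; rewrite -sum1_card (partition_big (fun i => Ordinal (hM i)) xpredT) //=.
apply: eq_bigr => s _; rewrite -sum1_card; apply: eq_bigl => i.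
by rewrite inE -val_eqE.
Qed.

(** A nonempty part of size b with nonzero value satisfies 2 floor((b-1)/2) + 1 <= b, and the zero
    part of size z contributes 2 ceil(z/2) = z + odd z. Once the weight is known not to drop, this
    limits the number of parts. *)
Lemma block_weight_bound (B : {set 'I_n}) (f : 'I_n -> nat) M (c : nat -> nat) :
  (forall i, f i < M.+1)%N -> (forall s, c s = #|[set i in B | f i == s]|) ->
  (2 * (\sum_(s < M.+1) block_weight s (c s)) +
     #|[set s : 'I_M.+1 | (s != 0%N :> nat) && (0 < c s)]|
   <= #|B| + odd (c 0))%N.
Proof.
move=> hM hc; rewrite (card_block_sum B hM); under [X in (_ <= X + _)%N]eq_bigr do rewrite -hc.
rewrite -sum1dep_card [X in (_ + X <= _)%N]big_mkcond /= big_distrr /= -big_split /=.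
rewrite big_ord_recl [X in (_ <= X + _)%N]big_ord_recl /=.
rewrite /block_weight /= addn0 [X in (_ <= X)%N]addnAC; apply: leq_add; last first.
  by apply: leq_sum => s _; rewrite /bump /= add1n; case: ltnP; lia.
lia.
Qed.

Lemma absz_signed_coord (v : 'I_n -> int) x : absz (signed_coord v x) = absz (v x.1).
Proof. by case: x => i []; rewrite /signed_coord //= abszN. Qed.

Lemma self_opp (a : int) : a = - a -> a = 0.
Proof. lia. Qed.

Lemma absz_opp (a b : int) (t : nat) : absz a = t -> a + b = 0 ->
  (a = t /\ - b = t) \/ (b = t /\ - a = t).
Proof. lia. Qed.

Lemma absz_eq (a b : int) : absz a = absz b -> a = b \/ a = - b.
Proof. lia. Qed.

Lemma sub_zeros (v v' : 'I_n -> int) :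
  pattern v \subset pattern v' -> zeros (pattern v') \subset zeros (pattern v).
Proof.
move=> /subsetP h; apply/subsetP=> p; rewrite [p \in zeros _]inE => /andP[h1 h2].
by rewrite inE; apply/andP; split; [apply: contra h1|apply: contra h2]; apply: h.
Qed.

(** An equality between coordinates with distinct indices is the vanishing of a root. The remaining
    case x = -y means that the coordinate vanishes, which is not a root; as [v'] is good, another
    coordinate vanishes too, and comparing with it under both signs gives the claim. *)
Lemma eq_signed_coord (v v' : 'I_n -> int) :
  zeros (pattern v') \subset zeros (pattern v) -> good v' ->
  forall x y, signed_coord v' x = signed_coord v' y -> signed_coord v x = signed_coord v y.
Proof.
move=> /subsetP sZ gv'.
have main x y : x.1 != y.1 -> signed_coord v' x = signed_coord v' y ->
    signed_coord v x = signed_coord v y.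
  move=> nxy exy; have := sZ (x, sopp y).
  rewrite !in_zeros /= (negPf nxy) /= /rootval /= !signed_coord_sopp.
  by rewrite exy subrr eqxx => /(_ isT); rewrite subr_eq0 => /eqP.
move=> x y exy; have [|] := boolP (x.1 == y.1); last by move/main; apply.
rewrite eq_fst => /orP[/eqP -> //|/eqP ex].
have x0 : signed_coord v' x = 0.
  by apply: self_opp; rewrite {1}exy ex signed_coord_sopp opprK.
have xB : x.1 \in block v' 0%N by rewrite inE -absz_signed_coord x0.
have [j jB jx] : exists2 j, j \in block v' 0%N & j != x.1.
  have : (1 < #|block v' 0%N|)%N.
    by rewrite ltn_neqAle eq_sym -/(good v') gv' card_gt0; apply/set0Pn; exists x.1.
  move=> /card_gt1P[j [j' [jB j'B njj']]].
  have [ej|] := eqVneq j x.1; last by exists j.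
  by exists j' => //; rewrite -ej eq_sym.
have jz b : signed_coord v' (j, b) = 0.
  by apply/eqP; rewrite -absz_eq0 absz_signed_coord; move: jB; rewrite inE.
have e1 : signed_coord v x = signed_coord v (j, false).
  by apply: main; rewrite ?x0 ?jz // eq_sym.
have e2 : signed_coord v x = signed_coord v (sopp (j, false)).
  by apply: main; rewrite ?x0 ?jz // eq_sym.
have : signed_coord v x = - signed_coord v x by rewrite {1}e2 signed_coord_sopp e1.
by rewrite -signed_coord_sopp -[y]soppK' -ex.
Qed.

(** A block that loses no weight is cut so little that, on its roots vanishing at [v], the values of
    [v'] are determined up to one common factor by the support of [v']. As [v''] has the same
    support, it is proportional to [v'] there, and a negative factor is only possible on a block of
    even size. *)
Lemma block_ratio (v v' v'' : 'I_n -> int) (t M : nat) :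
  good v' -> good v'' -> pattern v \subset pattern v' -> pattern v \subset pattern v'' ->
  zeros (pattern v'') = zeros (pattern v') -> (forall i, absz (v' i) < M.+1)%N ->
  (block_weight t #|block v t| <=
     \sum_(s < M.+1) block_weight s #|[set i in block v t | absz (v' i) == s]|)%N ->
  exists A C : int, [/\ A != 0, C != 0, odd #|block v t| -> 0 < A * C &
    forall p, absz (v p.1.1) = t -> absz (v p.2.1) = t -> rootval v p = 0 ->
      A * rootval v'' p = C * rootval v' p].
Proof.
move=> gv' gv'' s' s'' eZ hM hw.
pose c s := #|[set i in block v t | absz (v' i) == s]|.
have := @block_weight_bound (block v t) (fun i => absz (v' i)) M c hM (fun=> erefl).
set Sg := (\sum_(s < M.+1) _)%N in hw *; set R := [set s : 'I_M.+1 | _] => hb.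
have eqv x y : signed_coord v' x = signed_coord v' y -> signed_coord v x = signed_coord v y.
  exact: eq_signed_coord (sub_zeros s') gv' x y.
have eq2 x y : signed_coord v' x = signed_coord v' y -> signed_coord v'' x = signed_coord v'' y.
  by apply: eq_signed_coord => //; rewrite eZ.
have eq1 x y : signed_coord v'' x = signed_coord v'' y -> signed_coord v' x = signed_coord v' y.
  by apply: eq_signed_coord => //; rewrite eZ.
have zero2 x : signed_coord v' x = 0 -> signed_coord v'' x = 0.
  move=> h; have /eq2 : signed_coord v' x = signed_coord v' (sopp x).
    by rewrite signed_coord_sopp h oppr0.
  by rewrite signed_coord_sopp => /self_opp.
have zero1 x : signed_coord v'' x = 0 -> signed_coord v' x = 0.
  move=> h; have /eq1 : signed_coord v'' x = signed_coord v'' (sopp x).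
    by rewrite signed_coord_sopp h oppr0.
  by rewrite signed_coord_sopp => /self_opp.
have zerov x : signed_coord v' x = 0 -> signed_coord v x = 0.
  move=> h; have /eqv : signed_coord v' x = signed_coord v' (sopp x).
    by rewrite signed_coord_sopp h oppr0.
  by rewrite signed_coord_sopp => /self_opp.
pose o (x : S) : 'I_M.+1 := inord (absz (v' x.1)).
have oE x : o x = absz (v' x.1) :> nat by rewrite inordK.
have oR x : absz (v x.1) = t -> signed_coord v' x != 0 -> o x \in R.
  move=> xt x0; rewrite inE oE -(absz_signed_coord v') absz_eq0 x0 card_gt0.
  by apply/set0Pn; exists x.1; rewrite !inE xt absz_signed_coord !eqxx.
have oabs x y : o x = o y ->
    signed_coord v' x = signed_coord v' y \/ signed_coord v' x = - signed_coord v' y.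
  move=> /(congr1 val) /=; rewrite -/(nat_of_ord (o x)) -/(nat_of_ord (o y)) !oE.
  by rewrite -!(absz_signed_coord v') => /absz_eq.
case: (posnP t) => [t0|t_gt0].
- have [/existsP[i /andP[iB iv']]|/existsPn no] :=
    boolP [exists i, (i \in block v t) && (v' i != 0)]; last first.
    exists 1, 1; split=> // p p1 p2 _; rewrite !mul1r.
    have z (x : S) : absz (v x.1) = t -> signed_coord v' x = 0.
      move=> xt; have := no x.1; rewrite !inE xt eqxx /= negbK -absz_eq0.
      by rewrite -absz_signed_coord absz_eq0 => /eqP.
    by rewrite /rootval !(z, zero2) //; apply: z.
  pose x : S := (i, false).
  have xt : absz (v x.1) = t by move: iB; rewrite inE => /eqP.
  have x0 : signed_coord v' x != 0 by [].
  have R1 : (0 < #|R|)%N by rewrite card_gt0; apply/set0Pn; exists (o x); exact: oR.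
  move: hw; rewrite /block_weight t0 eqxx -t0 -/(block_weight t) => hw.
  (* With b the size of the block and z that of its vanishing part, the two bounds give b + odd b +
     #|R| <= b + odd z: so b is even and the nonzero coordinates share one absolute value. *)
  have [ev R2] : ~~ odd #|block v t| /\ (#|R| <= 1)%N by lia.
  exists (signed_coord v' x), (signed_coord v'' x); split=> //.
  - by apply: contra x0 => /eqP/zero1 ->.
  - by rewrite (negPf ev).
  have key (y : S) : absz (v y.1) = t ->
      signed_coord v' x * signed_coord v'' y = signed_coord v'' x * signed_coord v' y.
    move=> yt; have [y0|y0] := eqVneq (signed_coord v' y) 0.
      by rewrite y0 zero2 // !mulr0.
    have /card_le1_eqP/(_ (o x) (o y)) eo := R2.
    have [e|e] := oabs _ _ (eo (oR _ xt x0) (oR _ yt y0)).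
      by rewrite e (eq2 _ _ e) mulrC.
    have e' : signed_coord v' y = signed_coord v' (sopp x) by rewrite e signed_coord_sopp.
    by rewrite e (eq2 _ _ e') signed_coord_sopp !mulrN mulrC.
  by move=> p p1 p2 _; rewrite /rootval !mulrDr !key.
have c0 : c 0%N = 0%N.
  apply/eqP; rewrite cards_eq0 -subset0; apply/subsetP=> i; rewrite !inE => /andP[/eqP it].
  rewrite absz_eq0 => /eqP i0; have := zerov (i, false) i0.
  by rewrite /signed_coord /= => vi; move: t_gt0; rewrite -it vi.
(* The sum of two such coordinates is a root positive on [v], hence on [v'], which excludes opposite
   values. *)
have lift_abs x y : signed_coord v x = t -> signed_coord v y = t -> o x = o y ->
    signed_coord v' x = signed_coord v' y.
  move=> xt yt /oabs[//|e].
  have nxy : x.1 != y.1.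
    rewrite eq_fst negb_or; apply/andP; split; apply/eqP=> exy.
      have x0 : signed_coord v' x = 0 by move: e; rewrite exy; lia.
      by have := zerov _ x0; rewrite xt; lia.
    by move: xt; rewrite exy signed_coord_sopp yt; lia.
  have /(subsetP s') : (x, y) \in pattern v.
    by rewrite inE nxy /rootval /= xt yt; lia.
  by rewrite inE /rootval /= e addNr ltxx andbF.
have abst (x : S) : signed_coord v x = t -> absz (v x.1) = t.
  by rewrite -absz_signed_coord => ->.
have nz x : signed_coord v x = t -> signed_coord v' x != 0.
  by move=> xt; apply/eqP=> /zerov; rewrite xt; lia.
have lift p : absz (v p.1.1) = t -> rootval v p = 0 ->
    (signed_coord v p.1 = t /\ signed_coord v (sopp p.2) = t) \/
    (signed_coord v p.2 = t /\ signed_coord v (sopp p.1) = t).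
  by rewrite -absz_signed_coord /rootval !signed_coord_sopp; exact: absz_opp.
(* Signs are normalised so that the value on [v] is [t]: by [lift], a root of the block that
   vanishes on [v] is a difference of two members of [L]. *)
pose L := [pred x : S | signed_coord v x == t].
have [/existsP[x /andP[xL /existsP[y /andP[yL nxy]]]]|/existsPn no] :=
  boolP [exists x, (x \in L) && [exists y, (y \in L) &&
     (signed_coord v' x != signed_coord v' y)]]; last first.
  have all_eq x y : signed_coord v x = t -> signed_coord v y = t ->
      signed_coord v' x = signed_coord v' y.
    move=> xt yt; have := no x; rewrite inE xt eqxx /= => /existsPn/(_ y).
    by rewrite inE yt eqxx /= negbK => /eqP.
  exists 1, 1; split=> // p p1 _ p0; rewrite !mul1r.
  have [[h1 h2]|[h1 h2]] := lift p p1 p0;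
    have e := all_eq _ _ h1 h2; have e2 := eq2 _ _ e;
    by move: e e2; rewrite /rootval !signed_coord_sopp => -> ->; rewrite ?addNr ?addrN.
move/eqP: xL => xt; move/eqP: yL => yt.
have noxy : o x != o y by apply: contra nxy => /eqP/(lift_abs _ _ xt yt) ->.
have xR := oR _ (abst _ xt) (nz _ xt); have yR := oR _ (abst _ yt) (nz _ yt).
have R2 : (1 < #|R|)%N by apply/card_gt1P; exists (o x), (o y).
move: hw hb; rewrite c0 /block_weight (gtn_eqF t_gt0) -/(block_weight t) => hw hb.
(* The bound 2 floor((b-1)/2) + #|R| <= b with at least two parts forces b to be even and excludes a
   third part. *)
have [ev R3] : ~~ odd #|block v t| /\ (#|R| <= 2)%N by rewrite -/Sg in hb; lia.
have cases z : signed_coord v z = t ->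
    signed_coord v' z = signed_coord v' x \/ signed_coord v' z = signed_coord v' y.
  move=> zt; have zR := oR _ (abst _ zt) (nz _ zt).
  have [|nzx] := eqVneq (o z) (o x); first by move/(lift_abs _ _ zt xt); left.
  have [|nzy] := eqVneq (o z) (o y); first by move/(lift_abs _ _ zt yt); right.
  have : (#|[set o z; o x; o y]| <= #|R|)%N.
    apply: subset_leq_card; apply/subsetP=> w /setUP[/set2P[]|/set1P] -> //.
  by rewrite -setUA cardsU1 cards2 !inE negb_or nzx nzy noxy /= => /leq_trans/(_ R3).
exists (signed_coord v' x - signed_coord v' y), (signed_coord v'' x - signed_coord v'' y).
split; rewrite ?subr_eq0 //.
- by apply: contra nxy => /eqP/eq1 ->.
- by rewrite (negPf ev).
have key z w : signed_coord v z = t -> signed_coord v w = t ->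
  (signed_coord v' x - signed_coord v' y) * (signed_coord v'' z - signed_coord v'' w) =
  (signed_coord v'' x - signed_coord v'' y) * (signed_coord v' z - signed_coord v' w).
  move=> /cases[ez|ez] /cases[ew|ew]; rewrite ez ew (eq2 _ _ ez) (eq2 _ _ ew);
    by rewrite ?subrr ?mulr0 // mulrC // -opprB mulNr -mulrN opprB mulrC.
move=> p p1 _ p0; have [[h1 h2]|[h1 h2]] := lift p p1 p0;
  have := key _ _ h1 h2; rewrite !signed_coord_sopp !opprK /rootval //.
by rewrite ![signed_coord _ p.2 + _]addrC.
Qed.

Lemma ratio_sign (A C x y : int) : A != 0 -> A * x = C * y ->
  (0 < x) = (0 < (A * C) * y).
Proof.
move=> A0 e; rewrite -mulrA -e mulrA pmulr_rgt0 //.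
by rewrite -expr2 exprn_even_gt0.
Qed.

(** Each block of [v'] lies in a single block of [v], by [eq_signed_coord]; so the level of [v'] can
    be counted block by block of [v]. *)
Lemma level_split (v v' : 'I_n -> int) M :
  good v' -> zeros (pattern v') \subset zeros (pattern v) ->
  (forall i, absz (v i) < M)%N -> (forall i, absz (v' i) < M)%N ->
  level v' = (\sum_(t < M) \sum_(s < M)
     block_weight s #|[set i in block v t | absz (v' i) == s]|)%N.
Proof.
move=> gv' sZ hM hM'; rewrite (levelE hM') exchange_big /=; apply: eq_bigr => s _.
have [B0|[i iB]] := set_0Vmem (block v' s).
  rewrite B0 cards0 block_weight0 big1 // => t _.
  suff -> : [set i in block v t | absz (v' i) == s] = set0 by rewrite cards0 block_weight0.
  apply/eqP; rewrite -subset0 -B0; apply/subsetP=> i; rewrite !inE.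
  by case/andP.
have same j : absz (v' j) = s -> absz (v j) = absz (v i).
  move: iB; rewrite inE => /eqP is_ js; have /absz_eq[e|e] : absz (v' j) = absz (v' i).
  - by rewrite js.
  - have /= := @eq_signed_coord _ _ sZ gv' (j, false) (i, false) e.
    by rewrite /signed_coord /= => ->.
  have /= := @eq_signed_coord _ _ sZ gv' (j, false) (i, true) e.
  by rewrite /signed_coord /= => ->; rewrite abszN.
rewrite (bigD1 (Ordinal (hM i))) //= big1 ?addn0 => [|t nt].
  congr (block_weight _ #|pred_of_set _|); apply/setP=> j; rewrite !inE.
  by case: (absz (v' j) =P s) => [/same ->|]; rewrite ?eqxx // andbF.
suff -> : [set j in block v t | absz (v' j) == s] = set0 by rewrite cards0 block_weight0.
apply/setP=> j; rewrite !inE; apply/negbTE/negP => /andP[/eqP jt /eqP js].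
by case/eqP: nt; apply: val_inj; rewrite /= -jt (same _ js).
Qed.

(** By [block_weight_bound]: either some part has a nonzero value, which pays for the rounding, or
    the whole block goes to 0 and keeps its weight. The latter needs t = 0 unless the block is
    empty. *)
Lemma block_weight_refine (v v' : 'I_n -> int) (t M : nat) :
  good v' -> zeros (pattern v') \subset zeros (pattern v) ->
  (forall i, absz (v' i) < M.+1)%N ->
  (\sum_(s < M.+1) block_weight s #|[set i in block v t | absz (v' i) == s]|
    <= block_weight t #|block v t|)%N.
Proof.
move=> gv' sZ hM'; pose c s := #|[set i in block v t | absz (v' i) == s]|.
have := @block_weight_bound (block v t) (fun i => absz (v' i)) M c hM' (fun=> erefl).
set Sg := (\sum_(s < M.+1) _)%N; set R := [set s : 'I_M.+1 | _] => hb.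
have Rpos i : i \in block v t -> v' i != 0 -> (0 < #|R|)%N.
  move=> iB i0; rewrite card_gt0; apply/set0Pn; exists (Ordinal (hM' i)).
  rewrite inE /= absz_eq0 i0 card_gt0; apply/set0Pn; exists i.
  by rewrite inE iB eqxx.
case: (posnP t) => [t0|t_gt0].
  rewrite /block_weight t0 eqxx -t0.
  have [/existsP[i /andP[iB i0]]|/existsPn no] :=
    boolP [exists i, (i \in block v t) && (v' i != 0)].
    by have := Rpos i iB i0; move: hb; rewrite /Sg; lia.
  suff -> : #|block v t| = c 0%N.
    have : (c 0 <= #|block v t|)%N by apply/subset_leq_card/subsetP=> i; rewrite inE => /andP[].
    suff <- : #|block v t| = c 0%N by move: hb; rewrite /Sg; lia.
    congr #|pred_of_set _|; apply/setP=> i; rewrite [RHS]inE; have := no i.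
    by case: (i \in block v t) => //=; rewrite negbK absz_eq0.
  congr #|pred_of_set _|; apply/setP=> i; rewrite [RHS]inE; have := no i.
  by case: (i \in block v t) => //=; rewrite negbK absz_eq0.
have c0 : c 0%N = 0%N.
  apply/eqP; rewrite cards_eq0 -subset0; apply/subsetP=> i; rewrite !inE => /andP[/eqP it].
  rewrite absz_eq0 => /eqP i0.
  have := @eq_signed_coord _ _ sZ gv' (i, false) (i, true).
  rewrite /signed_coord /= i0 => /(_ (esym (oppr0 _))) /self_opp vi.
  by move: t_gt0; rewrite -it vi.
rewrite /block_weight (gtn_eqF t_gt0).
have [B0|[i iB]] := set_0Vmem (block v t).
  by move: hb; rewrite c0 B0 cards0 /Sg; lia.
have i0 : v' i != 0.
  apply/negP => /eqP i0; suff : (0 < c 0)%N by rewrite c0.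
  by rewrite card_gt0; apply/set0Pn; exists i; rewrite inE iB i0.
by have := Rpos i iB i0; move: hb; rewrite c0 /Sg; lia.
Qed.

Lemma sum_le_eq (I : finType) (a b : I -> nat) :
  (forall i, b i <= a i)%N -> (\sum_i a i <= \sum_i b i)%N -> forall i, (a i <= b i)%N.
Proof.
move=> le_ba; move=> h i; move: h; rewrite (bigD1 i) //= [X in (_ <= X)%N](bigD1 i) //=.
have : (\sum_(j | j != i) b j <= \sum_(j | j != i) a j)%N by apply: leq_sum.
lia.
Qed.

(** Since refinement never increases a weight, the hypothesis on levels forces equality in every
    block, so [block_ratio] applies to each. [U] collects the blocks on which [v'] and [v'']
    disagree: there the factor is negative, so the block is even and all signs are opposite. *)
Lemma even_flip (v v' v'' : 'I_n -> int) :
  good v' -> good v'' -> pattern v \subset pattern v' -> pattern v \subset pattern v'' ->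
  zeros (pattern v'') = zeros (pattern v') -> (level v <= level v')%N ->
  exists U : {set 'I_n}, [/\ ~~ odd #|U|,
    forall i j, absz (v i) = absz (v j) -> (i \in U) = (j \in U) &
    forall p, p \in zeros (pattern v) -> (p \in pattern v'') =
      if p.1.1 \in U then popp p \in pattern v' else p \in pattern v'].
Proof.
move=> gv' gv'' s' s'' eZ hl; have sZ := sub_zeros s'.
pose M := (\max_i maxn (absz (v i)) (absz (v' i)))%N.
have hMM i : (maxn (absz (v i)) (absz (v' i)) < M.+1)%N by rewrite ltnS (leq_bigmax i).
have hM i : (absz (v i) < M.+1)%N by apply: leq_ltn_trans (hMM i); rewrite leq_maxl.
have hM' i : (absz (v' i) < M.+1)%N by apply: leq_ltn_trans (hMM i); rewrite leq_maxr.
move: hl; rewrite (levelE hM) (level_split gv' sZ hM hM') => hl.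
have hw := sum_le_eq (fun t : 'I_M.+1 => block_weight_refine t gv' sZ hM') hl.
pose bad i p := [&& p \in zeros (pattern v), p.1.1 != p.2.1, absz (v p.1.1) == absz (v i)
   & (p \in pattern v'') != (p \in pattern v')].
pose U := [set i | [exists p, bad i p]].
have key i : i \in U -> ~~ odd #|block v (absz (v i))| /\
    forall p, p \in zeros (pattern v) -> absz (v p.1.1) = absz (v i) ->
      (p \in pattern v'') = (popp p \in pattern v').
  rewrite inE => /existsP[q /and4P[qZ nq /eqP qi dq]].
  have [A [C [A0 C0 oAC hAC]]] := block_ratio gv' gv'' s' s'' eZ hM' (hw (Ordinal (hM i))).
  have rel p : p \in zeros (pattern v) -> p.1.1 != p.2.1 -> absz (v p.1.1) = absz (v i) ->
      A * rootval v'' p = C * rootval v' p.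
    rewrite in_zeros => /orP[-> //|/eqP p0] _ pi; apply: hAC => //=.
    move: p0; rewrite /rootval -pi -!(absz_signed_coord v).
    by move/eqP; rewrite addr_eq0 => /eqP ->; rewrite abszN.
  have ACneg : A * C < 0.
    rewrite lt_neqAle mulf_neq0 //= leNgt; apply: contra dq => ACpos.
    by rewrite !inE nq /= (ratio_sign A0 (rel q qZ nq qi)) pmulr_rgt0.
  split; first by apply/negP => /oAC /(lt_trans ACneg); rewrite ltxx.
  move=> p pZ pi; rewrite !inE /= rootval_popp oppr_gt0; case: (boolP (p.1.1 == p.2.1)) => //= np.
  by rewrite (ratio_sign A0 (rel p pZ np pi)) nmulr_rgt0.
have Ublock i j : absz (v i) = absz (v j) -> (i \in U) = (j \in U).
  by move=> e; rewrite !inE /bad e.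
exists U; split=> //; last first.
  move=> p pZ; case: ifPn => pU; first by apply: (key _ pU).2.
  have := pU; rewrite inE => /existsPn/(_ p); rewrite /bad pZ eqxx /=.
  by case: (boolP (p.1.1 == p.2.1)) => [e _|_]; [rewrite !inE e | rewrite negbK => /eqP].
rewrite -dvdn2 (card_block_sum U hM); apply: dvdn_sum => t _.
have [->|[i]] := set_0Vmem [set i in U | absz (v i) == t]; first by rewrite cards0.
rewrite inE => /andP[iU /eqP it].
suff -> : [set i in U | absz (v i) == t] = block v (absz (v i)) by rewrite dvdn2; case: (key i iU).
apply/setP=> j; rewrite !inE it; case: eqP => [jt|_]; rewrite ?andbF // andbT.
by have := Ublock j i; rewrite !inE => ->; rewrite ?jt ?it //; move: iU; rewrite inE.
Qed.

End Level.

(** * Coefficients of products with null elements *)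

Section Flip.
Variable n : nat.
Local Notation S := ('I_n * bool)%type.
Local Notation W := (typeD n).

Definition flip_fun (U : {set 'I_n}) (x : S) : S := (x.1, x.2 (+) (x.1 \in U)).

Lemma flip_funK U : involutive (flip_fun U).
Proof. by case=> i b; rewrite /flip_fun /= addbK. Qed.

(** The sign change on [U] lies in the group only if [U] has even size; otherwise the default is the
    identity. *)
Definition flip (U : {set 'I_n}) : W := insubd (1%g : W) (perm (can_inj (flip_funK U))).

Lemma flipE (U : {set 'I_n}) x : ~~ odd #|U| -> flip U x = flip_fun U x.
Proof.
move=> oU; rewrite /flip val_insubd; case: ifP => [_|/negP[]]; first by rewrite permE.
apply/andP; split.
  by apply/signedP=> y; rewrite !permE /flip_fun /sopp /= addNb.
suff -> : negated (perm (can_inj (flip_funK U))) = U by [].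
by apply/setP=> i; rewrite inE permE.
Qed.

Lemma flipV (U : {set 'I_n}) : ~~ odd #|U| -> (flip U)^-1%g = flip U.
Proof.
move=> oU; apply/eqP; rewrite eq_invg_mul; apply/eqP/typeDP => x.
by rewrite typeDM typeD1 !flipE // flip_funK.
Qed.

Lemma zeros_popp (F : {set S * S}) p : (popp p \in zeros F) = (p \in zeros F).
Proof. by rewrite !inE poppK andbC. Qed.

(** Both indices of a root vanishing on [v] lie in the same block, hence both in [U] or both
    outside. So the flip negates or fixes each such root, and preserves every support contained in
    that of [v] as a set of vanishing roots. *)
Lemma even_flip_act (v v' v'' : 'I_n -> int) :
  good v' -> good v'' -> pattern v \subset pattern v' -> pattern v \subset pattern v'' ->
  zeros (pattern v'') = zeros (pattern v') -> (level v <= level v')%N ->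
  exists h : W, [/\ face_act h (zeros (pattern v)) = zeros (pattern v),
    face_act h (zeros (pattern v')) = zeros (pattern v') &
    tits (pattern v) (face_act h (pattern v')) = pattern v''].
Proof.
move=> gv' gv'' s' s'' eZ hl.
have [U [oU Ublock hU]] := even_flip gv' gv'' s' s'' eZ hl.
pose h := flip U; have hV : h^-1%g = h by exact: flipV.
have hp p : p \in zeros (pattern v) -> p.1.1 != p.2.1 ->
    root_act h p = if p.1.1 \in U then popp p else p.
  rewrite in_zeros => /orP[-> //|/eqP p0 np].
  have e : (p.1.1 \in U) = (p.2.1 \in U).
    apply: Ublock; rewrite -!(absz_signed_coord v).
    by move/eqP: p0; rewrite /rootval addr_eq0 => /eqP ->; rewrite abszN.
  move: e; rewrite /root_act /popp !flipE // /flip_fun /sopp.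
  case: p {p0 np} => [[i b] [j b']] /= <-.
  by case: (i \in U); rewrite ?addbT ?addbF.
have stab (Z : {set S * S}) : (forall p, p.1.1 == p.2.1 -> p \in Z) ->
    (forall p, (popp p \in Z) = (p \in Z)) -> Z \subset zeros (pattern v) -> face_act h Z = Z.
  move=> hZ1 hZ2 sZ.
  have sub p : p \in Z -> root_act h p \in Z.
    move=> pZ; have [e|np] := boolP (p.1.1 == p.2.1).
      by apply: hZ1; rewrite (typeD_fst h).
    by rewrite hp ?(subsetP sZ) //; case: ifP; rewrite ?hZ2.
  apply/setP=> p; rewrite inE hV; apply/idP/idP => [/sub|/sub //].
  by rewrite -{1}hV root_actK.
have z1 (u : 'I_n -> int) p : p.1.1 == p.2.1 -> p \in zeros (pattern u).
  by rewrite in_zeros => ->.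
exists h; split.
- by apply: stab => //; [exact: z1 | exact: zeros_popp].
- by apply: stab; [exact: z1 | exact: zeros_popp | exact: sub_zeros].
apply/setP=> p; rewrite inE.
have [pv|pv] /= := boolP (p \in pattern v); first by rewrite (subsetP s'').
have [pv'|pv'] := boolP (popp p \in pattern v).
  rewrite andbF; apply/esym/negbTE.
  by have := pattern_asym (subsetP s'' _ pv'); rewrite poppK.
have pZ : p \in zeros (pattern v) by rewrite inE pv pv'.
rewrite andbT hU // inE hV; have [e|np] := boolP (p.1.1 == p.2.1); last first.
  by rewrite hp //; case: ifP.
by rewrite !inE /= e (typeD_fst h) e /= if_same.
Qed.

End Flip.

(** * Averaging a null element over the stabiliser of two supports *)

Section FaceAlgebra.
Variables (n : nat) (k : fieldType).
Local Notation S := ('I_n * bool)%type.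
Local Notation W := (typeD n).
Local Notation kF := {ffun {set S * S} -> k}.
Implicit Types a b : kF.

Definition W_invariant a := forall (w : W) F, a (face_act w F) = a F.
Definition on_faces a := forall F, a F != 0 -> face F.
Definition null a := forall Z, \sum_(F | zeros F == Z) a F = 0.
Definition face_conv a b : kF :=
  [ffun G => \sum_F \sum_(H | tits F H == G) a F * b H].

Hypothesis unitW : forall d, (d %| #|{: W}|)%N -> d%:R != 0 :> k.

Lemma null_sub a (P : pred {set S * S}) :
  null a -> \sum_(F | P (zeros F)) a F = 0.
Proof.
move=> na; rewrite (partition_big (@zeros n) P) //= big1 // => Z PZ.
by rewrite -[RHS](na Z); apply: eq_bigl => F; case: eqP => [->|]; rewrite ?PZ ?andbF.
Qed.

(* The stabiliser H of the two supports acts transitively on the faces above F *)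
(* with the same support as F': averaging over H turns the coefficient into a   *)
(* multiple of a sum over whole supports.                                       *)
Lemma null_coef a (v v' : 'I_n -> int) :
  W_invariant a -> on_faces a -> null a -> good v' ->
  pattern v \subset pattern v' -> (level v <= level v')%N ->
  \sum_(G | tits (pattern v) G == pattern v') a G = 0.
Proof.
move=> ia fa na gv' s' hl; set F := pattern v; set F' := pattern v'.
pose H := [set h : W | (face_act h (zeros F) == zeros F) && (face_act h (zeros F') == zeros F')].
have gH : group_set H.
  apply/group_setP; split; first by rewrite inE !face_act1 !eqxx.
  move=> x y; rewrite !inE !face_actM => /andP[/eqP x1 /eqP x2] /andP[/eqP -> /eqP ->].
  by rewrite x1 x2 !eqxx.
pose HG := Group gH.
have HV h : h \in H -> h^-1%g \in H by move=> hH; rewrite -(groupV HG) in hH.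
(* As [h] preserves the support of [F], the faces [F] and [face_act h F] vanish on the same roots,
   so the second is absorbed by the first. *)
have absorb h X : h \in H -> tits F (face_act h (tits F X)) = tits F (face_act h X).
  rewrite inE => /andP[/eqP hZ _]; rewrite face_act_tits titsA; congr (tits _ _).
  apply/setP=> p; rewrite inE; have [//|pF] := boolP (p \in F).
  have [|pF'] := boolP (popp p \in F); rewrite ?andbF //=.
  have : p \in face_act h (zeros F) by rewrite hZ inE pF.
  by rewrite -face_act_zeros inE => /andP[/negbTE ->].
have absorbV h X : h \in H -> tits F (face_act h^-1%g (tits F (face_act h X))) = tits F X.
  by move=> hH; rewrite absorb ?HV // face_actK.
pose C X := \sum_(G | tits F G == X) a G.
have FF' : tits F F' = F' by apply: tits_sub => //; exists v'.
have Cinv h : h \in H -> C (tits F (face_act h F')) = C F'.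
  move=> hH; rewrite /C (reindex_inj (@face_act_inj n h)) /=.
  apply: eq_big => [G|G _]; last exact: ia.
  apply/eqP/eqP => [e|<-]; last by rewrite absorb.
  by rewrite -(absorbV _ G hH) e absorbV.
pose c0 := #|[set h in H | tits F (face_act h F') == F']|.
have sZ : zeros F' \subset zeros F by exact: sub_zeros.
(* If [tits F G] has the support of [F'], some [h0] in [H] carries [F'] to it ([even_flip_act]), and
   all such [h] form a coset of the stabiliser. So the count depends on [G] only through its
   support. *)
have cnt G : a G != 0 -> #|[set h in H | tits F G == tits F (face_act h F')]| =
    if zeros F :&: zeros G == zeros F' then c0 else 0%N.
  move=> /fa fG; case: eqP => [eZ|nZ]; last first.
    apply/eqP; rewrite cards_eq0; apply/eqP/setP=> h; rewrite !inE.
    apply/negbTE/negP => /andP[/andP[_ /eqP hZ] /eqP e]; apply: nZ.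
    by rewrite -zeros_tits e zeros_tits face_act_zeros hZ; apply/setIidPr.
  have fFG : face (tits F G) by apply: face_tits => //; exists v.
  have [v'' gv'' ev''] := good_rep fFG.
  have [h0 [h1 h2 h3]] : exists h0 : W, [/\ face_act h0 (zeros F) = zeros F,
      face_act h0 (zeros F') = zeros F' & tits F (face_act h0 F') = tits F G].
    rewrite ev''; apply: even_flip_act => //.
      by rewrite -/F -ev'' sub_tits.
    by rewrite -ev'' zeros_tits eZ.
  have h0H : h0 \in HG by rewrite inE h1 h2 !eqxx.
  rewrite /c0 -[RHS](card_lcoset _ h0); congr #|pred_of_set _|; apply/setP=> h.
  have eH : (h \in HG) = ((h0^-1 * h)%g \in HG) by rewrite groupMl ?groupV.
  rewrite mem_lcoset inE [RHS]inE; congr (_ && _); first exact: eH.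
  rewrite face_actM; apply/eqP/eqP => [e|e].
    by rewrite -(absorb _ _ (HV _ h0H)) -e -h3 absorbV // FF'.
  by rewrite -h3 -[in LHS]e absorb // face_actKV.
(* Exchanging the sums groups the coefficients of [a] by support, where they cancel; by [Cinv] the
   same sum is #|H| times the wanted coefficient. *)
have : \sum_(h in H) C (tits F (face_act h F')) = 0.
  rewrite /C (exchange_big_dep xpredT) //=.
  transitivity (\sum_G (if zeros F :&: zeros G == zeros F' then a G *+ c0 else 0)).
    apply: eq_bigr => G _; rewrite sumr_const -cardsE.
    have [->|aG] := eqVneq (a G) 0; first by rewrite !mul0rn if_same.
    by rewrite -[X in a G *+ X]/(#|_|) cnt //; case: ifP.
  rewrite -big_mkcond /= sumrMnl.
  by rewrite (@null_sub a (fun Z => zeros F :&: Z == zeros F')) // mul0rn.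
rewrite (eq_bigr (fun=> C F')) => [|h hH]; last exact: Cinv.
rewrite sumr_const -mulr_natr => /eqP; rewrite mulf_eq0 => /orP[/eqP //|].
by rewrite (negPf (unitW _)) // -cardsT (cardSg (subsetT HG)).
Qed.

End FaceAlgebra.

(** * The standard chamber *)

Section StandardChamber.
Variable n : nat.
Hypothesis n_gt1 : (1 < n)%N.
Local Notation S := ('I_n * bool)%type.
Local Notation W := (typeD n).

(** A point inside a chamber: the coordinates have distinct absolute values, and the entry 0 is
    harmless because no coordinate hyperplane belongs to the arrangement. *)
Definition rho (D : numDomainType) : 'I_n -> D := fun i => (i : nat)%:R.

(** The simple roots for [rho], with indices from 0: e_0 + e_1, and e_i - e_(i-1) for i > 0. *)
Definition std_root (i : 'I_n) : S * S :=
  if i == 0%N :> nat then ((i, false), (ordS i, false)) else ((ord_pred i, true), (i, false)).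

Lemma ordS0 (i : 'I_n) : i = 0%N :> nat -> ordS i = 1%N :> nat.
Proof. by move=> i0; rewrite /= i0 modn_small. Qed.

Lemma ord_predE (i : 'I_n) : i != 0%N :> nat -> ord_pred i = i.-1 :> nat.
Proof.
rewrite -lt0n => i0; rewrite /= -(prednK i0) addSn /= modnDr modn_small //.
by rewrite (leq_ltn_trans (leq_pred i)).
Qed.

Lemma rho_root (D : realDomainType) i : rootval (rho D) (std_root i) = 1.
Proof.
rewrite /std_root; case: eqP => [i0|/eqP i0]; rewrite /rootval /signed_coord /=.
  by rewrite /rho ordS0 // i0 add0r.
rewrite /rho ord_predE //; move: i0; rewrite -lt0n => i0.
by rewrite -{2}(prednK i0) -natr1 addrA addNr add0r.
Qed.

Lemma std_root_neq i : (std_root i).1.1 != (std_root i).2.1.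
Proof.
rewrite /std_root; case: (i =P 0%N :> nat) => [i0|/eqP i0]; rewrite -val_eqE.
  by rewrite [val (ordS i)]ordS0 // [val _]i0.
by rewrite [val (ord_pred i)]ord_predE //; move: i0; rewrite -lt0n /=; lia.
Qed.

Lemma rho_pattern (i j : 'I_n) b b' : (i < j)%N ->
  ((i, b), (j, b')) \in pattern (rho int) = ~~ b'.
Proof.
move=> lt_ij; rewrite inE /= -val_eqE (ltn_eqF lt_ij) /= /rootval /signed_coord /=.
rewrite /rho; case: b; case: b' => /=; lia.
Qed.

Lemma pattern_swap (D : realDomainType) (v : 'I_n -> D) (p : S * S) :
  (p \in pattern v) = ((p.2, p.1) \in pattern v).
Proof. by rewrite !inE /= eq_sym /rootval /= addrC. Qed.

(** The hypotheses say v_0 < v_1 < ... and v_0 + v_1 > 0; hence v_1 > 0 and |v_0| < v_1, which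
    settles every other root. *)
Lemma std_pos (D : realDomainType) (v : 'I_n -> D) :
  (forall i, 0 < rootval v (std_root i)) ->
  forall p, p \in pattern (rho int) -> 0 < rootval v p.
Proof.
move=> hv.
have mono m (i j : 'I_n) : j = m :> nat -> (i < j)%N -> v i < v j.
  elim: m i j => [i j -> //|m IH i j jm lt_ij].
  have j0 : j != 0%N :> nat by rewrite jm.
  have := hv j; rewrite /std_root (negPf j0) /rootval /signed_coord /= addrC subr_gt0 => h.
  have pj : ord_pred j = m :> nat by rewrite ord_predE // jm.
  have [e|ne] := eqVneq i (ord_pred j); first by rewrite e.
  apply: lt_trans h; apply: IH => //.
  have ne' : (i : nat) != (ord_pred j : nat) by apply: contra ne => /eqP/val_inj ->.
  by rewrite pj in ne' *; lia.
pose z := Ordinal (ltnW n_gt1).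
have h0 := hv z; rewrite /std_root eqxx /rootval /signed_coord /= in h0.
have z1 : ordS z = 1%N :> nat by rewrite ordS0.
have lz (i : 'I_n) : i != 0%N :> nat -> v (ordS z) <= v i.
  move=> i0; have [->//|ne] := eqVneq i (ordS z); apply/ltW/(@mono i) => //.
  by rewrite z1; move: i0 ne; rewrite -val_eqE -[val (ordS z)]/(nat_of_ord _) z1 /=; lia.
have v1 : 0 < v (ordS z).
  have : v z < v (ordS z) by apply: (@mono 1%N) => //; rewrite z1.
  lra.
have main (i j : 'I_n) b b' : (i < j)%N -> ((i, b), (j, b')) \in pattern (rho int) ->
    0 < rootval v ((i, b), (j, b')).
  move=> lt_ij; rewrite rho_pattern // => /negbTE ->; rewrite /rootval /signed_coord /=.
  have mij : v i < v j by exact: (@mono j).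
  case: b => /=; first by rewrite addrC subr_gt0.
  have [i0|i0] := eqVneq (i : nat) 0%N.
    have -> : i = z by apply: val_inj.
    by have := lz j; rewrite -lt0n => /(_ (leq_ltn_trans (leq0n _) lt_ij)); lra.
  by have := lz i i0; lra.
move=> [[i b] [j b']] hp; have : i != j by move: hp; rewrite inE => /andP[].
rewrite -val_eqE neq_ltn => /orP[lt_ij|lt_ji]; first exact: main.
by rewrite /rootval /= addrC; apply: main => //; rewrite pattern_swap.
Qed.

(** The vector [N * v + rho] is strictly positive on the simple roots. At [p] the perturbation is N
    - 1, so integrality leaves a nonnegative value of [v]. *)
Lemma std_ge0 (v : 'I_n -> int) :
  (forall i, 0 <= rootval v (std_root i)) ->
  forall p, p \in pattern (rho int) -> 0 <= rootval v p.
Proof.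
move=> hv p hp; pose N := rootval (rho int) p + 1.
have hp' : 0 < rootval (rho int) p by move: hp; rewrite inE => /andP[].
have := @std_pos _ (fun i => N * v i + rho int i) _ p hp.
rewrite rootvalD rootvalZ => /(_ _) h; suff : 0 < N * rootval v p + rootval (rho int) p.
  by rewrite /N; move: (rootval v p) (rootval (rho int) p) hp'; move=> /= x y; nia.
apply: h => i; rewrite rootvalD rootvalZ rho_root ltr_wpDl // mulr_ge0 //.
by rewrite addr_ge0 // ltW.
Qed.

Lemma pattern_total (p : S * S) : p.1.1 != p.2.1 ->
  (p \in pattern (rho int)) || (popp p \in pattern (rho int)).
Proof.
case: p => [[i b] [j b']] /=; rewrite -val_eqE neq_ltn => /orP[] h.
  by rewrite /popp /sopp /= !rho_pattern //; case: b'.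
rewrite pattern_swap [X in _ || X]pattern_swap /= /popp /sopp /= !rho_pattern //.
by case: b.
Qed.

(** The vector w rho is an integral point of the standard chamber, so its i-th coordinate is at
    least i for i > 0. It has the same norm as [rho], hence equals [rho]; so [w] fixes every
    coordinate except possibly the sign of the zero one. *)
Lemma face_act_std (w : W) :
  face_act w (pattern (rho int)) = pattern (rho int) -> w = 1%g.
Proof.
rewrite -pattern_vec_act => hw; set v := vec_act w (rho int) in hw.
have pos i : 0 < rootval v (std_root i).
  have : std_root i \in pattern v.
    by rewrite hw inE std_root_neq /= rho_root.
  by rewrite inE => /andP[].
pose z := Ordinal (ltnW n_gt1).
have h0 := pos z; rewrite /std_root eqxx /rootval /signed_coord /= in h0.
have z1 : ordS z = 1%N :> nat by rewrite ordS0.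
have step (i : 'I_n) : i != 0%N :> nat -> v (ord_pred i) < v i.
  move=> i0; have := pos i.
  by rewrite /std_root (negPf i0) /rootval /signed_coord /= addrC subr_gt0.
have ge_v m (i : 'I_n) : i = m.+1 :> nat -> m.+1%:Z <= v i.
  elim: m i => [|m IH] i im.
    have pz : ord_pred i = z by apply: val_inj; rewrite -[LHS]/(nat_of_ord _) ord_predE im.
    have iz : i = ordS z by apply: val_inj; rewrite -[RHS]/(nat_of_ord (ordS z)) z1.
    have := step i; rewrite im pz => /(_ isT); rewrite -iz in h0; move: h0.
    by move: (v z) (v i) => a b; lia.
  have pm : ord_pred i = m.+1 :> nat by rewrite ord_predE im.
  have := IH _ pm; have := step i; rewrite im => /(_ isT).
  by move: (v (ord_pred i)) (v i) => a b; lia.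
have ge_v' (i : 'I_n) : rho int i ^+ 2 <= v i ^+ 2.
  rewrite /rho; case em: (nat_of_ord i) => [|m]; first by rewrite expr0n /= sqr_ge0.
  by rewrite natz ler_sqr ?nnegrE ?(le_trans _ (ge_v m i em)) //; apply: ge_v.
have sumv : \sum_(x : S) signed_coord v x ^+ 2 = \sum_(x : S) signed_coord (rho int) x ^+ 2.
  rewrite [RHS](reindex_inj (@typeD_inj n w^-1%g)) /=.
  by apply: eq_bigr => x _; rewrite signed_coord_vec_act.
have eq_sq i : v i ^+ 2 = rho int i ^+ 2.
  apply/eqP; rewrite eq_le ge_v' andbT leNgt; apply/negP => lt_i.
  have : \sum_(x : S) signed_coord (rho int) x ^+ 2 < \sum_(x : S) signed_coord v x ^+ 2.
    rewrite (bigD1 (i, false)) //= [ltRHS](bigD1 (i, false)) //=.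
    apply: ltr_leD; first by rewrite /signed_coord.
    by apply: ler_sum => x _; rewrite /signed_coord; case: x.2; rewrite ?sqrrN; apply: ge_v'.
  by rewrite sumv ltxx.
have ev (i : 'I_n) : v i = rho int i.
  have := eq_sq i; rewrite /rho; case em: (nat_of_ord i) => [|m].
    by rewrite expr0n /= => /eqP; rewrite sqrf_eq0 => /eqP.
  by have := ge_v m i em; move: (v i) => a; nia.
have sc x : signed_coord (rho int) (w^-1%g x) = signed_coord (rho int) x.
  by rewrite -signed_coord_vec_act -/v /signed_coord ev.
have fix_pos (x : S) : x.1 != 0%N :> nat -> w^-1%g x = x.
  move=> x0; have := sc x; case: (w^-1%g x) => [i b]; case: x x0 => [j b'] /=.
  rewrite /signed_coord /rho /= => j0 h.
  have [eb ei] : b = b' /\ i = j :> nat by case: b b' h => [] []; lia.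
  by rewrite eb; congr (_, _); apply: val_inj.
have fix1 (x : S) : (w^-1%g x).1 = x.1.
  have [x0|] := eqVneq (x.1 : nat) 0%N; last by move/fix_pos ->.
  have := sc x; case: (w^-1%g x) => [i b]; case: x x0 => [j b'] /= j0.
  rewrite /signed_coord /rho /= j0 => h; apply: val_inj; rewrite /= j0.
  by move: h; case: b b' => [] []; lia.
suff h : forall x, w^-1%g x = x.
  have e : w^-1%g = 1%g by apply: typeDP => x; rewrite h typeD1.
  by rewrite -[w]invgK e invg1.
case=> j b; have [j0|] := eqVneq (j : nat) 0%N; last exact: fix_pos (j, b).
suff h : w^-1%g (j, false) = (j, false).
  by case: b => //; rewrite -[(j, true)]/(sopp (j, false)) typeD_sopp h.
have := fix1 (j, false); case e: (w^-1%g (j, false)) => [i c] /= ij; rewrite ij.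
(* Otherwise exactly one index would be negated, against the parity condition of type D. *)
case: c e => // e; have /andP[_] := valP w^-1%g.
suff -> : negated (val w^-1%g) = [set j] by rewrite cards1.
apply/setP=> l; rewrite !inE; have [->|nlj] := eqVneq l j.
  by rewrite -[val w^-1%g _]/(w^-1%g _) e.
rewrite -[val w^-1%g _]/(w^-1%g _) fix_pos //=.
by apply: contra nlj => /eqP l0; apply/eqP/val_inj; rewrite /= l0 j0.
Qed.

End StandardChamber.

(** * Reflections and the simple roots of a chamber *)

Section Reflections.
Variable n : nat.
Local Notation S := ('I_n * bool)%type.
Local Notation W := (typeD n).

(** The reflection in e_x + e_y exchanges x with -y, so it changes signs exactly when x and y carry
    the same sign. *)
Definition refl_fun (p : S * S) (x : S) : S :=
  (tperm p.1.1 p.2.1 x.1,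
   x.2 (+) (((x.1 == p.1.1) || (x.1 == p.2.1)) && (p.1.2 (+) ~~ p.2.2))).

Lemma refl_funK p : involutive (refl_fun p).
Proof.
case: p => [[i b] [j b']] [l c]; rewrite /refl_fun /= tpermK; congr (_, _).
case: tpermP => [->|->|/eqP/negbTE -> /eqP/negbTE ->]; rewrite ?eqxx ?orbT ?addbF //=;
  by rewrite addbK.
Qed.

Definition refl (p : S * S) : W := insubd (1%g : W) (perm (can_inj (refl_funK p))).

Lemma reflE p x : p.1.1 != p.2.1 -> refl p x = refl_fun p x.
Proof.
move=> np; rewrite /refl val_insubd; case: ifP => [_|/negP[]]; first by rewrite permE.
apply/andP; split.
  by apply/signedP=> y; rewrite !permE /refl_fun /sopp /= addNb.
set e := p.1.2 (+) ~~ p.2.2; suff -> : negated (perm (can_inj (refl_funK p))) =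
    if e then [set p.1.1; p.2.1] else set0.
  by case: e; rewrite ?cards2 ?np ?cards0.
apply/setP=> i; rewrite inE permE /refl_fun /= -/e.
by case: e; rewrite ?andbT ?andbF !inE.
Qed.

(** The coordinate at [x] of the root vector of [p]. Roots have squared length 2, so it serves as
    the coroot in [refl_coord]. *)
Definition pairing (p : S * S) (x : S) : int :=
  (x == p.1)%:R + (x == p.2)%:R - (x == sopp p.1)%:R - (x == sopp p.2)%:R.

Lemma refl_coord (D : realDomainType) (v : 'I_n -> D) p x : p.1.1 != p.2.1 ->
  signed_coord v (refl p x) = signed_coord v x - (pairing p x)%:~R * rootval v p.
Proof.
move=> np; rewrite reflE // /pairing /rootval /refl_fun /signed_coord /sopp.
case: p np => [[i b] [j b']] /= nij; case: x => l c; rewrite !xpair_eqE /=.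
case: tpermP => [->|->|/eqP/negbTE nli /eqP/negbTE nlj].
- rewrite eqxx (negPf nij) /=.
  by case: b; case: b'; case: c => /=; rewrite ?mulr1n ?mulr0n; ring.
- rewrite eqxx [j == i]eq_sym (negPf nij) orbT /=.
  by case: b; case: b'; case: c => /=; rewrite ?mulr1n ?mulr0n; ring.
- rewrite nli nlj /= addbF; case: c => /=; ring.
Qed.

Lemma pairing_le1 p x : p.1.1 != p.2.1 -> pairing p x <= 1.
Proof.
case: p x => [[i b] [j b']] [l c] /= nij; rewrite /pairing /sopp !xpair_eqE /=.
have [->|nli] := eqVneq l i; last by case: (l == j) => /=; case: (c == b') => /=; lia.
by rewrite (negPf nij) /=; case: (c == b) => /=; lia.
Qed.

Lemma pairing1 p x : p.1.1 != p.2.1 -> 1 <= pairing p x -> x = p.1 \/ x = p.2.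
Proof.
move=> np; rewrite /pairing; have [->|_] := eqVneq x p.1; first by left.
by have [->|_] := eqVneq x p.2; [right | lia].
Qed.

Lemma rootval_refl (D : realDomainType) (v : 'I_n -> D) p q : p.1.1 != p.2.1 ->
  rootval v (root_act (refl p) q) =
  rootval v q - (pairing p q.1 + pairing p q.2)%:~R * rootval v p.
Proof. by move=> np; rewrite /rootval /= !refl_coord // /rootval; ring. Qed.

(** The sum runs over both signs of each index, so it is twice an inner product. *)
Lemma sum_pairing (D : realDomainType) (v : 'I_n -> D) p :
  \sum_x (pairing p x)%:~R * signed_coord v x = 2 * rootval v p.
Proof.
have e (y : S) : \sum_x (x == y)%:R * signed_coord v x = signed_coord v y.
  rewrite (bigD1 y) //= eqxx mul1r big1 ?addr0 // => x /negbTE ->.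
  by rewrite mul0r.
transitivity (\sum_x ((x == p.1)%:R * signed_coord v x + (x == p.2)%:R * signed_coord v x
   - (x == sopp p.1)%:R * signed_coord v x - (x == sopp p.2)%:R * signed_coord v x)).
  by apply: eq_bigr => x _; rewrite /pairing !natz !intrB intrD -!pmulrn; ring.
by rewrite !sumrB !big_split /= !e !signed_coord_sopp /rootval; ring.
Qed.

Lemma refl1 p : p.1.1 != p.2.1 -> refl p p.1 = sopp p.2.
Proof.
move=> np; rewrite reflE // /refl_fun eqxx tpermL /=.
by case: p np => [[i []] [j []]].
Qed.

Lemma refl2 p : p.1.1 != p.2.1 -> refl p p.2 = sopp p.1.
Proof.
move=> np; rewrite reflE // /refl_fun eqxx orbT tpermR /=.
by case: p np => [[i []] [j []]].
Qed.

Lemma refl_out p (x : S) : p.1.1 != p.2.1 -> x.1 != p.1.1 -> x.1 != p.2.1 -> refl p x = x.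
Proof.
move=> np n1 n2; rewrite reflE // /refl_fun (negPf n1) (negPf n2) addbF.
by rewrite tpermD 1?eq_sym // -surjective_pairing.
Qed.

Lemma refl_conj (w : W) p : p.1.1 != p.2.1 ->
  (w * refl p * w^-1)%g = refl (root_act w p).
Proof.
move=> np; have np' : (root_act w p).1.1 != (root_act w p).2.1 by rewrite root_act_fst.
apply: typeDP => x; rewrite -{2}[x](typeDKV w) 2!typeDM; set y := w^-1%g x.
have [e1|n1] := boolP (y.1 == p.1.1).
  move: e1; rewrite eq_fst => /orP[] /eqP ->.
    by rewrite refl1 // typeD_sopp (refl1 np').
  by rewrite !typeD_sopp refl1 // (refl1 np') typeD_sopp.
have [e2|n2] := boolP (y.1 == p.2.1).
  move: e2; rewrite eq_fst => /orP[] /eqP ->.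
    by rewrite refl2 // typeD_sopp (refl2 np').
  by rewrite !typeD_sopp refl2 // (refl2 np') typeD_sopp.
by rewrite refl_out // (refl_out np') // (typeD_fst w).
Qed.

Lemma refl_inv p : p.1.1 != p.2.1 -> (refl p * refl p)%g = 1%g.
Proof. by move=> np; apply: typeDP => x; rewrite typeDM !reflE // refl_funK typeD1. Qed.

Lemma refl_swap p : p.1.1 != p.2.1 -> refl (p.2, p.1) = refl p.
Proof.
move=> np; have np' : (p.2, p.1).1.1 != (p.2, p.1).2.1 by rewrite eq_sym.
apply: typeDP => x; rewrite (reflE _ np') reflE // /refl_fun /=.
by rewrite tpermC orbC; congr (_, _ (+) (_ && _)); case: p.1.2; case: p.2.2.
Qed.

Lemma refl_popp p : p.1.1 != p.2.1 -> refl (popp p) = refl p.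
Proof.
move=> np; apply: typeDP => x; rewrite !reflE // /refl_fun /=.
by congr (_, _ (+) (_ && _)); case: p.1.2; case: p.2.2.
Qed.

Lemma rootval_vec_actM (D : realDomainType) (w w' : W) (v : 'I_n -> D) :
  rootval (vec_act w (vec_act w' v)) =1 rootval (vec_act (w * w')%g v).
Proof. by move=> p; rewrite !rootval_vec_act invMg root_actM. Qed.

End Reflections.

(** * The translate of the standard chamber by [u] *)

Section Base.
Variables (n : nat) (u : typeD n).
Hypothesis n_gt1 : (1 < n)%N.
Local Notation S := ('I_n * bool)%type.
Local Notation W := (typeD n).

(** The parameter [u] lets any chamber of the arrangement play the role of the fundamental one. *)
Definition base_pt (D : realDomainType) : 'I_n -> D := vec_act u (rho D).
Definition base_face : {set S * S} := pattern (base_pt int).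
Definition base_root (i : 'I_n) : S * S := root_act u (std_root i).
Definition base_refl (i : 'I_n) : W := refl (base_root i).
Definition base_set : {set W} := [set base_refl i | i : 'I_n].

Lemma base_root_neq i : (base_root i).1.1 != (base_root i).2.1.
Proof. by rewrite root_act_fst std_root_neq. Qed.
Hint Resolve base_root_neq : core.

Lemma base_pt_root (D : realDomainType) i : rootval (base_pt D) (base_root i) = 1.
Proof. by rewrite rootval_vec_act root_actK rho_root. Qed.

Lemma in_base_face p : (p \in base_face) = (root_act u^-1%g p \in pattern (rho int)).
Proof. by rewrite /base_face pattern_vec_act inE. Qed.

Lemma base_root_in i : base_root i \in base_face.
Proof. by rewrite inE base_root_neq base_pt_root. Qed.

Lemma base_pos (D : realDomainType) (v : 'I_n -> D) :
  (forall i, 0 < rootval v (base_root i)) -> forall p, p \in base_face -> 0 < rootval v p.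
Proof.
move=> hv p; rewrite in_base_face => hp.
have := @std_pos _ n_gt1 _ (vec_act u^-1%g v) _ _ hp.
rewrite rootval_vec_act invgK root_actKV; apply=> i.
by rewrite rootval_vec_act invgK; exact: hv.
Qed.

Lemma base_ge0 (v : 'I_n -> int) :
  (forall i, 0 <= rootval v (base_root i)) -> forall p, p \in base_face -> 0 <= rootval v p.
Proof.
move=> hv p; rewrite in_base_face => hp.
have := @std_ge0 _ n_gt1 (vec_act u^-1%g v) _ _ hp.
rewrite rootval_vec_act invgK root_actKV; apply=> i.
by rewrite rootval_vec_act invgK; exact: hv.
Qed.

Lemma base_total (p : S * S) : p.1.1 != p.2.1 ->
  (p \in base_face) || (popp p \in base_face).
Proof.
move=> np; rewrite !in_base_face root_act_popp; apply: pattern_total => //.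
by rewrite root_act_fst.
Qed.

Lemma base_face_max F : face F -> base_face \subset F -> F = base_face.
Proof.
move=> [v ->] /subsetP sF; apply/eqP; rewrite eqEsubset; apply/andP; split; last exact/subsetP.
apply/subsetP=> p pv; have np : p.1.1 != p.2.1 by move: pv; rewrite inE => /andP[].
by case/orP: (base_total np) => // /sF /pattern_asym; rewrite poppK pv.
Qed.

Lemma face_act_base (w w' : W) :
  face_act w base_face = face_act w' base_face -> w = w'.
Proof.
move=> e; have e' : face_act (w'^-1 * w)%g base_face = base_face.
  by rewrite face_actM e face_actK.
move: e'; rewrite {1 2}/base_face pattern_vec_act -face_actM => e'.
have : (u^-1 * (w'^-1 * w * u))%g = 1%g.
  by apply: face_act_std => //; rewrite face_actM e' face_actK.
move/eqP; rewrite -eq_mulVg1 -{1}[u]mul1g => /eqP/mulIg/esym/eqP.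
by rewrite -eq_mulVg1 => /eqP.
Qed.

(** A simple reflection makes only its own root negative: at the base point the value of [p] must
    drop from at least 1 to at most -1, while it drops by a sum of two pairings, each at most 1. So
    both pairings are 1. *)
Lemma base_flip i (p : S * S) : p \in base_face -> root_act (base_refl i) p \notin base_face ->
  p = base_root i \/ p = ((base_root i).2, (base_root i).1).
Proof.
move=> pP tP; have np : p.1.1 != p.2.1 by move: pP; rewrite inE => /andP[].
set q := root_act _ p in tP; have nq : q.1.1 != q.2.1 by rewrite root_act_fst.
have hq : rootval (base_pt int) q < 0.
  have := base_total nq; rewrite (negPf tP) /= inE => /andP[_].
  by rewrite rootval_popp oppr_gt0.
have hp : 0 < rootval (base_pt int) p by move: pP; rewrite inE => /andP[].
move: hq; rewrite /q rootval_refl // base_pt_root mulr1 intz.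
have := pairing_le1 p.1 (base_root_neq i); have := pairing_le1 p.2 (base_root_neq i).
move=> h2 h1 hq; have [g1 g2] : 1 <= pairing (base_root i) p.1 /\ 1 <= pairing (base_root i) p.2.
  by move: (rootval _ p) hp hq => /= a; lia.
case: p {pP tP q nq hp h1 h2 hq} g1 g2 np => x y /=.
case/(pairing1 (base_root_neq i)) => -> /(pairing1 (base_root_neq i)) [] ->;
  rewrite ?eqxx // => _; by [left; case: (base_root i) | right].
Qed.

End Base.

(** * Minimal coset representatives and faces *)

Section Coxeter.
Variables (n : nat) (u : typeD n).
Hypothesis n_gt1 : (1 < n)%N.
Local Notation S := ('I_n * bool)%type.
Local Notation W := (typeD n).
Local Notation b_ := (base_root u).
Local Notation t_ := (base_refl u).
Local Notation P := (base_face u).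
Local Notation Sim := (base_set u).
Local Notation br_neq := (base_root_neq u n_gt1).

Lemma base_refl_set i : t_ i \in Sim. Proof. exact: imset_f. Qed.

(** Take [h] maximising the inner product of h v with the base point. As simple roots have value 1
    at that point, applying [t_ i] subtracts a positive multiple of the value of [b_ i] on h v,
    which is therefore nonnegative. *)
Lemma dominant (D : realDomainType) (H : {group W}) (v : 'I_n -> D) :
  (forall i, t_ i \in H) ->
  exists2 h, h \in H & forall i, 0 <= rootval (vec_act h v) (b_ i).
Proof.
move=> hH; pose f (h : W) : D :=
  \sum_x signed_coord (base_pt u D) x * signed_coord (vec_act h v) x.
case: (@arg_maxP _ _ _ 1%g (mem H) f (group1 H)) => h hin hmax.
exists h => // i; have : f (t_ i * h)%g <= f h := hmax _ (groupM (hH i) hin).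
rewrite {1}/f (reindex_inj (@typeD_inj n (t_ i))) /=.
under eq_bigr => x _.
  rewrite signed_coord_vec_act invMg typeDM typeDK -signed_coord_vec_act.
  rewrite refl_coord ?br_neq // base_pt_root // mulr1 mulrBl.
  over.
by rewrite sumrB sum_pairing gerBl pmulr_rge0 // ltr0n.
Qed.

Lemma dominant_pos (v : 'I_n -> int) :
  (forall i, 0 < rootval v (b_ i)) -> pattern v = P.
Proof.
move=> hv; apply: (base_face_max n_gt1); first by exists v.
apply/subsetP=> p pP; rewrite inE (base_pos n_gt1 hv pP) andbT.
by move: pP; rewrite inE => /andP[].
Qed.

Lemma base_generic (w : W) (p : S * S) : p.1.1 != p.2.1 ->
  rootval (vec_act w (base_pt u int)) p != 0.
Proof.
move=> np; rewrite rootval_vec_act; have np' : (root_act w^-1%g p).1.1 != (root_act w^-1%g p).2.1.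
  by rewrite root_act_fst.
case/orP: (base_total u n_gt1 np'); rewrite inE np' ?rootval_popp ?oppr_gt0.
  by move/andP=> [_ /gt_eqF ->].
by move/andP=> [_ /lt_eqF ->].
Qed.

(** The subgroup generated by the simple reflections moves the chamber w^-1 P back to P, and the
    group acts freely on chambers. *)
Lemma base_generated (w : W) : w \in <<Sim>>%g.
Proof.
have [h hH hpos] := @dominant int <<Sim>>%G (vec_act w^-1%g (base_pt u int))
  (fun i => mem_gen (base_refl_set i)).
suff : (h * w^-1)%g = 1%g by move/eqP; rewrite -eq_mulgV1 => /eqP <-.
apply: (face_act_base n_gt1 (u := u)); rewrite face_act1 {1}/base_face -pattern_vec_act.
apply: dominant_pos => i; rewrite lt_neqAle -rootval_vec_actM hpos andbT eq_sym.
by rewrite rootval_vec_actM base_generic // br_neq.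
Qed.

Lemma mem_expgs (w : W) : exists r, w \in (Sim ^+ r)%g.
Proof.
have /gen_prodgP[r [c hc ->]] := base_generated w; exists r.
elim: r c hc => [|r IH] c hc; first by rewrite big_ord0 expg0 inE.
by rewrite big_ord_recl expgS mem_mulg //; apply: IH.
Qed.

Lemma cox_lengthP (w : W) :
  w \in (Sim ^+ cox_length Sim w)%g /\ forall r, w \in (Sim ^+ r)%g -> (cox_length Sim w <= r)%N.
Proof.
rewrite /cox_length; case: pselect => [ex|no]; last by case: no; exact: mem_expgs.
by case: ex_minnP => r hr hmin.
Qed.

(** The exchange condition. Let [t_ j] be the letter at which the image of [b_ i] turns negative and
    [w'] the word to its right. By [base_flip], [w'] carries [b_ i] to [b_ j] up to order, so
    [t_ j * w' = w' * t_ i] and the letter cancels. *)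
Lemma exchange r (w : W) i : w \in (Sim ^+ r)%g -> root_act w (b_ i) \notin P ->
  (0 < r)%N /\ (w * t_ i)%g \in (Sim ^+ r.-1)%g.
Proof.
elim: r w => [|r IH] w.
  by rewrite expg0 => /set1P ->; rewrite root_act1 base_root_in.
rewrite expgS => /mulsgP[_ w' /imsetP[j _ ->] w'S ->].
rewrite root_actM => hn; split=> //=.
have [w'P|w'N] := boolP (root_act w' (b_ i) \in P); last first.
  have [r_gt0 h] := IH _ w'S w'N.
  by rewrite -mulgA -(prednK r_gt0) expgS mem_mulg // imset_f.
suff e : (w' * t_ i * w'^-1)%g = t_ j.
  have -> : (t_ j * w' * t_ i)%g = w'; last exact: w'S.
  by rewrite -e mulgKV -mulgA refl_inv ?mulg1 ?br_neq.
rewrite refl_conj ?br_neq //.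
by case: (base_flip n_gt1 w'P hn) => -> //; rewrite refl_swap // br_neq.
Qed.

Lemma reps_pos (J : {set W}) w i : w \in min_coset_reps Sim J -> t_ i \in J ->
  root_act w (b_ i) \in P.
Proof.
rewrite inE => /forallP/(_ (w * t_ i)%g) /implyP hm tJ; apply: contraT => hn.
have := hm; rewrite mem_lcoset mulKg mem_gen // => /(_ isT).
have [wS _] := cox_lengthP w; have [l_gt0 wtS] := exchange wS hn.
have := (cox_lengthP (w * t_ i)%g).2 _ wtS; lia.
Qed.

(** The solution of the linear system asking for the value 0 on the simple roots in [K] and 2 on the
    others; the factor 2 keeps it integral. *)
Definition fund_vec (K : {set 'I_n}) : 'I_n -> int := fun i =>
  let d l : int := (l \notin K)%:R in
  let z := Ordinal (ltnW n_gt1) in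
  d z - d (ordS z) + 2 * \sum_(l : 'I_n | (0 < l <= i)%N) d l.

Lemma fund_vec_root K i : rootval (fund_vec K) (std_root i) = 2 * (i \notin K)%:R.
Proof.
rewrite /std_root /rootval /signed_coord; set z := Ordinal (ltnW n_gt1).
case: (i =P 0%N :> nat) => [i0|/eqP i0] /=.
  have iz : i = z by apply: val_inj.
  rewrite iz /fund_vec -/z big1; last by move=> l /andP[h1 h2]; move: (leq_trans h1 h2).
  have z1 : ordS z = 1%N :> nat by rewrite ordS0.
  rewrite (bigD1 (ordS z)); last by rewrite z1.
  rewrite big1 /=; first ring.
  move=> l /andP[/andP[h1 h2] h3]; case/negP: h3; apply/eqP/val_inj.
  apply: etrans (esym z1); apply/eqP; rewrite eqn_leq h1 andbT.
  exact: leq_trans h2 (eq_leq z1).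
rewrite /fund_vec -/z [X in _ + (_ + 2 * X)](bigD1 i) /=; last by rewrite lt0n i0 leqnn.
rewrite [X in _ + (_ + 2 * (_ + X))](eq_bigl (fun l : 'I_n => (0 < l <= ord_pred i)%N)).
  ring.
move=> l; rewrite [X in (_ = (0 < _ <= X)%N)]ord_predE // -val_eqE /=.
by move: i0; rewrite -lt0n; lia.
Qed.

Definition fund_face (K : {set 'I_n}) : {set S * S} := pattern (vec_act u (fund_vec K)).

Lemma fund_face_face K : face (fund_face K). Proof. by eexists. Qed.

Lemma fund_root K i : rootval (vec_act u (fund_vec K)) (b_ i) = 2 * (i \notin K)%:R.
Proof. by rewrite rootval_vec_act root_actK fund_vec_root. Qed.

(** Translating by w^-1, the chamber w^-1 P must project to [P] on the face of [K]. The simple roots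
    outside [K] are positive on the face itself; those in [K] take their sign from w^-1 P. *)
Lemma tits_fund K w :
  tits (face_act w (fund_face K)) P = face_act w P <->
  (forall i, i \in K -> root_act w (b_ i) \in P).
Proof.
have [N N0 hN] := rootval_bound (vec_act w^-1%g (base_pt u int)).
have eP : face_act w^-1%g P = pattern (vec_act w^-1%g (base_pt u int)).
  by rewrite /base_face pattern_vec_act.
have in_w i : (root_act w (b_ i) \in P) = (b_ i \in face_act w^-1%g P).
  by rewrite [RHS]in_set invgK.
transitivity (tits (fund_face K) (face_act w^-1%g P) = P).
  split=> [e|e]; last by rewrite -{2}e face_act_tits face_actKV.
  by apply: (@face_act_inj n w); rewrite face_act_tits face_actKV.
rewrite eP (tits_pattern _ hN); split=> [e i iK|h].
  rewrite in_w eP; have := base_root_in u n_gt1 i; rewrite -e !inE.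
  by rewrite rootvalD rootvalZ fund_root iK /= !mulr0 add0r.
apply: dominant_pos => i; rewrite rootvalD rootvalZ fund_root.
have [iK|iK] := boolP (i \in K).
  by have := h i iK; rewrite in_w eP inE => /andP[_]; rewrite /= !mulr0 add0r.
have := hN (b_ i); rewrite /= mulr1; move: (rootval _ _) => /= a; lia.
Qed.

Lemma fund_stab (K : {set 'I_n}) w : w \in <<[set t_ i | i in K]>>%g ->
  face_act w (fund_face K) = fund_face K.
Proof.
pose H := [set w | face_act w (fund_face K) == fund_face K].
have gH : group_set H.
  apply/group_setP; split; first by rewrite inE face_act1.
  by move=> x y; rewrite !inE face_actM => /eqP hx /eqP ->; rewrite hx.
suff : <<[set t_ i | i in K]>>%g \subset Group gH.
  by move/subsetP => h /h; rewrite inE => /eqP.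
rewrite gen_subG; apply/subsetP=> _ /imsetP[i iK ->]; rewrite inE /fund_face -pattern_vec_act.
apply/eqP/setP=> p; rewrite !inE; congr (_ && (0 < _)).
rewrite rootval_vec_act; have -> : (t_ i)^-1%g = t_ i.
  by apply/eqP; rewrite eq_invg_mul refl_inv // br_neq.
by rewrite rootval_refl ?br_neq // fund_root iK /= !mulr0 subr0.
Qed.

(* A representative is minimal iff its chamber is the projection of P onto the  *)
(* face, so that minimal representatives correspond to faces.                   *)
Lemma repsP (K : {set 'I_n}) w :
  w \in min_coset_reps Sim [set t_ i | i in K] <->
  tits (face_act w (fund_face K)) P = face_act w P.
Proof.
set J := [set t_ i | i in K]; split.
  by move=> wX; apply/tits_fund => i iK; apply: (reps_pos wX); apply: imset_f.
move=> hw; case: (@arg_minnP _ w (mem (w *: <<J>>)%g) (cox_length Sim)).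
  exact: lcoset_refl.
move=> w0 w0in hmin.
have same : (w0 *: <<J>>)%g = (w *: <<J>>)%g.
  by apply/lcoset_eqP; exact: w0in.
suff -> : w = w0.
  by rewrite inE; apply/forallP=> x; apply/implyP; rewrite same; apply: hmin.
have w0X : w0 \in min_coset_reps Sim J.
  by rewrite inE; apply/forallP=> x; apply/implyP; rewrite same; apply: hmin.
apply: (face_act_base n_gt1 (u := u)); rewrite -hw.
have -> : face_act w (fund_face K) = face_act w0 (fund_face K).
  have /lcosetP[x xJ ->] : w0 \in (w *: <<J>>)%g by exact: w0in.
  by rewrite face_actM (fund_stab xJ).
by apply/tits_fund => i iK; apply: (reps_pos w0X); apply: imset_f.
Qed.

Lemma min_rep_exists (J : {set W}) w :
  exists2 w0, w0 \in min_coset_reps Sim J & w0 \in (w *: <<J>>)%g.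
Proof.
case: (@arg_minnP _ w (mem (w *: <<J>>)%g) (cox_length Sim)); first exact: lcoset_refl.
move=> w0 w0in hmin; exists w0 => //.
have same : (w0 *: <<J>>)%g = (w *: <<J>>)%g.
  by apply/lcoset_eqP; exact: w0in.
by rewrite inE; apply/forallP=> x; apply/implyP; rewrite same; apply: hmin.
Qed.

(** Make [v] dominant and let [K] be the set of its vanishing simple roots. Then suitable multiples
    of h v and of [fund_vec K] dominate each other on the simple roots, hence on all positive roots,
    so both vanish on the same ones. *)
Lemma face_conj_fund F : face F -> exists w K, F = face_act w (fund_face K).
Proof.
move=> [v ->].
have [h _ hpos] := @dominant int [set: W]%G v (fun=> in_setT _).
pose K := [set i | rootval (vec_act h v) (b_ i) == 0].
exists h^-1%g, K; apply: (@face_act_inj n h); rewrite face_actKV -pattern_vec_act.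
apply/setP=> p; rewrite !inE; case: (boolP (p.1.1 == p.2.1)) => //= np.
pose B := 2 * \sum_i `|rootval (vec_act h v) (b_ i)| + 2.
have key q : q \in P -> [/\ 0 <= rootval (vec_act h v) q,
    0 <= rootval (vec_act u (fund_vec K)) q &
    (0 < rootval (vec_act h v) q) = (0 < rootval (vec_act u (fund_vec K)) q)].
  move=> qP.
  have h0 : 0 <= rootval (vec_act h v) q by apply: (base_ge0 n_gt1 _ qP).
  have h0' : 0 <= rootval (vec_act u (fund_vec K)) q.
    by apply: (base_ge0 n_gt1 _ qP) => i; rewrite fund_root; case: (_ \in _).
  have h1 : 0 <= 2 * rootval (vec_act h v) q - rootval (vec_act u (fund_vec K)) q.
    rewrite -mulN1r -!rootvalZ -rootvalD; apply: (base_ge0 n_gt1 _ qP) => i.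
    rewrite rootvalD !rootvalZ fund_root inE; have := hpos i.
    by move: (rootval _ _) => /= a; case: eqP => [->|/eqP]; lia.
  have h2 : 0 <= B * rootval (vec_act u (fund_vec K)) q - rootval (vec_act h v) q.
    rewrite -mulN1r -!rootvalZ -rootvalD; apply: (base_ge0 n_gt1 _ qP) => i.
    rewrite rootvalD !rootvalZ fund_root inE.
    have : `|rootval (vec_act h v) (b_ i)| <= \sum_i `|rootval (vec_act h v) (b_ i)|.
      by rewrite [leRHS](bigD1 i) //= lerDl sumr_ge0.
    rewrite /B; move: (\sum_i _) => /= c; have := hpos i.
    by move: (rootval _ _) => /= a; case: eqP => [->|/eqP] /=; rewrite ?mulr0 ?mulr1; lia.
  split=> //; move: h0 h0' h1 h2; move: (rootval _ q) (rootval _ q) => /= a b h0 h0' h1 h2.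
  apply/idP/idP => [a0|].
    by rewrite lt_neqAle h0' andbT; apply/eqP=> b0; rewrite -b0 mulr0 in h2; lia.
  by move=> b0; rewrite lt_neqAle h0 andbT; apply/eqP=> a0; rewrite -a0 in h1; lia.
case/orP: (base_total u n_gt1 np) => /key[h1 h2 h3] //.
by move: h1 h2; rewrite !rootval_popp !oppr_ge0 !ltNge => -> ->.
Qed.

End Coxeter.

(** * From invariant combinations of faces to the descent algebra *)

Section Theta.
Variables (n : nat) (u : typeD n) (k : fieldType).
Hypothesis n_gt1 : (1 < n)%N.
Local Notation S := ('I_n * bool)%type.
Local Notation W := (typeD n).
Local Notation kF := {ffun {set S * S} -> k}.
Local Notation kW := (group_algebra k W).
Local Notation P := (base_face u).
Local Notation Sim := (base_set u).
Local Notation F_ := (fund_face u n_gt1).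
Local Notation gens K := [set base_refl u i | i in K : {set 'I_n}].
Implicit Types a b : kF.

(* The action of a on the base chamber, a chamber w P being identified with w.  *)
Definition theta a : kW := [ffun w : W => \sum_(G | tits G P == face_act w P) a G].

Lemma face_rep G : face G -> exists w K, G = face_act w (F_ K) /\
  w \in min_coset_reps Sim (gens K).
Proof.
move=> /(face_conj_fund u n_gt1)[w [K ->]].
have [w0 w0X w0in] := min_rep_exists u (gens K) w.
exists w0, K; split=> //; have /lcosetP[x xJ ->] := w0in.
by rewrite face_actM (fund_stab n_gt1 xJ).
Qed.

Lemma face_chamber G : face G -> exists w, tits G P = face_act w P.
Proof. by move=> /face_rep[w [K [-> /repsP e]]]; exists w; exact: e. Qed.

Lemma theta0 : theta 0 = 0.
Proof. by apply/ffunP=> w; rewrite !ffunE big1 // => G _; rewrite ffunE. Qed.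

Lemma theta_lin c a b : theta [ffun G => c * a G + b G] = c *: theta a + theta b.
Proof.
apply/ffunP=> w; rewrite !ffunE /= scaler_sumr -big_split /=.
by apply: eq_bigr => G _; rewrite ffunE.
Qed.

(** If H P = y P, then (F H) P = F (y P), and translating by y^-1 leaves the coefficients of [a]
    unchanged. The group element y of the inner face comes first, so products are reversed. *)
Lemma theta_mul a b : W_invariant a -> on_faces b -> theta b * theta a = theta (face_conv a b).
Proof.
move=> ia fb; apply/ffunP=> x; rewrite !ffunE.
under eq_bigr => y _.
  rewrite ffunE ffunE [X in _ * X](reindex_inj (@face_act_inj n y^-1%g)) /=.
  rewrite [X in _ * X](eq_bigl (fun F => tits F (face_act y P) == face_act x P)); last first.
    move=> F; rewrite /= face_actM -{1}[P](face_actK y) -face_act_tits.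
    by rewrite (inj_eq (@face_act_inj n y^-1%g)).
  rewrite [X in _ * X](eq_bigr a) => [|F _]; last exact: ia.
  rewrite mulr_suml.
  over.
under [RHS]eq_bigr => G _ do rewrite ffunE.
rewrite /= (exchange_big_dep xpredT) //=.
transitivity (\sum_H \sum_(F | tits (tits F H) P == face_act x P) b H * a F).
  apply: eq_bigr => H _; have [bH|/fb fH] := eqVneq (b H) 0.
    by rewrite !big1 // => [F _|y _]; rewrite bH ?mul0r.
  have [y ey] := face_chamber fH; rewrite (bigD1 y) /=; last exact/eqP.
  rewrite [X in _ + X]big1 ?addr0; last first.
    move=> y' /andP[/eqP ey' /negP[]]; apply/eqP/(face_act_base n_gt1 (u := u)).
    by rewrite -ey' -ey.
  by rewrite mulr_sumr; apply: eq_bigl => F; rewrite -ey titsA.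
rewrite (exchange_big_dep xpredT) //=.
rewrite [RHS](exchange_big_dep xpredT) //=; apply: eq_bigr => F _.
rewrite [RHS](exchange_big_dep xpredT) //= big_mkcond /=; apply: eq_bigr => H _.
case: ifP => c; last first.
  by rewrite big_pred0 // => G; case: (tits F H =P G) => [<-|]; rewrite ?c ?andbF.
rewrite (eq_bigl (pred1 (tits F H))) => [|G].
  by rewrite big_pred1_eq mulrC.
by rewrite /= [G == _]eq_sym; case: (tits F H =P G) => [<-|]; rewrite ?c ?andbF.
Qed.

Definition unit_elt : kF := [ffun G => (G == set0)%:R].

Lemma theta1 : theta unit_elt = 1.
Proof.
apply/ffunP=> w; rewrite !ffunE big_mkcond (bigD1 set0) //= big1 ?addr0 => [|G /negbTE nG].
  rewrite tits0F ffunE eqxx; have [->|nw] := eqVneq w 1%g; first by rewrite face_act1 eqxx.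
  case: eqP => // e; case/negP: nw; apply/eqP/(face_act_base n_gt1 (u := u)).
  by rewrite -e face_act1.
by rewrite ffunE nG if_same.
Qed.

Lemma W_invariant_unit : W_invariant unit_elt.
Proof.
move=> w G; have e : face_act w set0 = set0 by apply/setP=> p; rewrite !inE.
by rewrite !ffunE -{1}e (inj_eq (@face_act_inj n w)).
Qed.

Lemma on_faces_unit : on_faces unit_elt.
Proof.
move=> G; rewrite ffunE; have [->|_] := eqVneq G set0; last by rewrite eqxx.
by move=> _; exact: face0.
Qed.

Definition orbit_elt (K : {set 'I_n}) : kF :=
  [ffun G => [exists w, G == face_act w (F_ K)]%:R].

Lemma orbit_rep G K : [exists w, G == face_act w (F_ K)] ->
  exists2 w, G = face_act w (F_ K) & w \in min_coset_reps Sim (gens K).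
Proof.
move=> /existsP[w /eqP ->]; have [w0 w0X w0in] := min_rep_exists u (gens K) w.
exists w0 => //; have /lcosetP[x xJ ->] := w0in.
by rewrite face_actM (fund_stab n_gt1 xJ).
Qed.

(** By [repsP], each minimal representative w comes from exactly one face of the orbit, namely w
    F_K. *)
Lemma theta_orbit K : theta (orbit_elt K) = descent_elt k Sim (gens K).
Proof.
apply/ffunP=> w; rewrite ffunE /descent_elt sum_ffunE.
have [wX|wX] := boolP (w \in min_coset_reps Sim (gens K)); last first.
  rewrite !big1 // => [x xX|G /eqP GP].
    by rewrite ffunE; case: eqP xX => // <-; rewrite (negPf wX).
  rewrite ffunE; case: (boolP [exists _, _]) => // /orbit_rep[w0 eG w0X].
  case/negP: wX; suff -> : w = w0 by exact: w0X.
  apply: (face_act_base n_gt1 (u := u)); rewrite -GP eG; exact/repsP.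
rewrite (bigD1 (face_act w (F_ K))) /=; last by apply/eqP/repsP.
rewrite [RHS](bigD1 w) //= !ffunE eqxx.
have -> : [exists w0, face_act w (F_ K) == face_act w0 (F_ K)] by apply/existsP; exists w.
congr (_ + _); rewrite !big1 // => [x /andP[_ /negbTE nx]|G /andP[/eqP GP nG]].
  by rewrite ffunE eq_sym nx.
rewrite ffunE; case: (boolP [exists _, _]) => // /orbit_rep[w0 eG w0X].
case/negP: nG; suff -> : w = w0 by rewrite eG.
apply: (face_act_base n_gt1 (u := u)); rewrite -GP eG; exact/repsP.
Qed.

Lemma W_invariant_orbit K : W_invariant (orbit_elt K).
Proof.
move=> w G; rewrite !ffunE; congr (_ : bool)%:R.
apply/existsP/existsP => [[x /eqP e]|[x /eqP ->]]; last by exists (w * x)%g; rewrite face_actM.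
by exists (w^-1 * x)%g; rewrite face_actM -e face_actK.
Qed.

Lemma on_faces_orbit K : on_faces (orbit_elt K).
Proof.
move=> G; rewrite ffunE; case: existsP => [[w /eqP ->] _|_]; last by rewrite eqxx.
by apply: face_face_act; apply: fund_face_face.
Qed.

Lemma chamber_sum a w : on_faces a ->
  theta a w = \sum_(K | w \in min_coset_reps Sim (gens K)) a (face_act w (F_ K)) :> k.
Proof.
move=> fa; pose h K := face_act w (F_ K).
have hinj : injective h.
  move=> K L /face_act_inj e; apply/setP=> i.
  have : (base_root u i \in F_ K) = (base_root u i \in F_ L) by rewrite e.
  rewrite !inE !fund_root !base_root_neq //=.
  by case: (i \in K); case: (i \in L).
rewrite ffunE -(big_imset (fun G => a G) (h := h)) /=; last by move=> K L _ _; apply: hinj.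
rewrite big_mkcond [RHS]big_mkcond /=; apply: eq_bigr => G _.
case: imsetP => [[K wX ->]|no].
  by rewrite ifT //; apply/eqP/repsP; exact: wX.
case: ifP => // /eqP GP; apply/eqP; apply: contraT => /fa /face_rep[w0 [K [eG w0X]]].
case: no; exists K; last first.
  rewrite eG /h; congr face_act; apply: (face_act_base n_gt1 (u := u)).
  by rewrite -GP eG; apply/esym/repsP.
suff ew : w = w0 by rewrite -ew in w0X; exact: w0X.
by apply: (face_act_base n_gt1 (u := u)); rewrite -GP eG; apply/repsP.
Qed.

(** Project the chamber opposite to [P] onto the face where exactly the simple roots outside [K]
    vanish. On the result the simple roots in [K] are positive and the others negative; the inverse
    of the element reaching this chamber is the witness. *)
Lemma descent_set_exists (K : {set 'I_n}) : exists w,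
  forall L, (w \in min_coset_reps Sim (gens L)) = (L \subset K).
Proof.
pose G := tits (F_ (~: K)) (pattern (fun i => -1 * base_pt u int i)).
have fG : face G by apply: face_tits; [exact: fund_face_face | eexists].
have inG p : p.1.1 != p.2.1 -> (p \in G) || (popp p \in G).
  move=> np; rewrite /G !inE poppK /= np !rootvalZ !mulN1r !oppr_gt0 !rootval_popp !oppr_lt0.
  have := base_generic u n_gt1 1%g np; rewrite rootval_vec_act invg1 root_act1.
  case: (ltgtP (rootval (base_pt u int) p) 0) => //= _ _; rewrite ?orbT ?andbT //=;
  by rewrite oppr_gt0; case: ltgtP.
have [w ew] := face_chamber fG.
have eG : G = face_act w P.
  rewrite -ew; apply/setP=> p; rewrite [RHS]in_set; case: (boolP (p \in G)) => //= pG.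
  apply/esym/negbTE/negP => /andP[pP pG'].
  have np : p.1.1 != p.2.1 by move: pP; rewrite in_set => /andP[].
  by have := inG p np; rewrite (negPf pG) (negPf pG').
have hb i : (root_act w^-1%g (base_root u i) \in P) = (i \in K).
  rewrite -(in_face_act w) root_actKV -eG /G !in_set /= rootval_popp fund_root !rootvalZ.
  rewrite !base_pt_root ?base_root_neq //= in_setC negbK.
  by rewrite orbF pmulr_rgt0 // ltr0n; case: (i \in K).
exists w^-1%g => L; apply/idP/subsetP => [wX i iL|sLK].
  by rewrite -hb; apply: (tits_fund u n_gt1 L w^-1%g).1 iL; apply/repsP.
by apply/repsP/tits_fund => i iL; rewrite hb; apply: sLK.
Qed.

(** At the elements of [descent_set_exists], the values of [theta a] are the sums of [a (F_ L)] over
    the subsets L of K. This system is triangular, so all [a (F_ K)] vanish, and invariance does the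
    rest. *)
Lemma theta_inj a : W_invariant a -> on_faces a -> theta a = 0 -> a = 0.
Proof.
move=> ia fa a0.
have sum0 (K : {set 'I_n}) : \sum_(L : {set 'I_n} | L \subset K) a (F_ L) = 0.
  have [w hw] := descent_set_exists K.
  apply: (@etrans _ _ (theta a w : k)); last by rewrite a0 ffunE.
  by rewrite (chamber_sum _ fa); apply: eq_big => [L|L _]; rewrite ?hw ?ia.
have zero m : forall K : {set 'I_n}, (#|K| <= m)%N -> a (F_ K) = 0.
  elim: m => [|m IH] K hK; have := sum0 K; rewrite (bigD1 K) //= big1 ?addr0 //.
    move=> L /andP[sLK nLK]; case/negP: nLK; rewrite eqEcard sLK /=.
    by apply: leq_trans hK _.
  move=> L /andP[sLK nLK]; apply: IH; rewrite -ltnS; apply: leq_trans hK.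
  by rewrite proper_card // properEneq nLK.
apply/ffunP=> G; rewrite ffunE; apply/eqP; apply: contraT => aG.
have [w [K [eG _]]] := face_rep (fa G aG).
by move: aG; rewrite eG ia (zero #|K|) ?eqxx.
Qed.

End Theta.

(** * The radical and the upper bound *)

(** In finite dimension a subspace of maximal dimension inside [Q] already contains every element
    satisfying [Q]. *)
Lemma subspace_of (k : fieldType) (V : vectType k) (Q : V -> Prop) :
  Q 0 -> (forall c x y, Q x -> Q y -> Q (c *: x + y)) ->
  exists U : {vspace V}, forall x, x \in U <-> Q x.
Proof.
move=> Q0 QD; pose good (U : {vspace V}) := forall x, x \in U -> Q x.
have ex : exists d, `[< exists2 U, good U & \dim U = d >].
  exists 0%N; apply/asboolP; exists 0%VS; rewrite ?dimv0 // => x.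
  by rewrite memv0 => /eqP ->.
have ub d : `[< exists2 U, good U & \dim U = d >] -> (d <= \dim {:V})%N.
  by move=> /asboolP[U _ <-]; rewrite dimvS ?subvf.
case: (ex_maxnP ex ub) => d /asboolP[U gU dU] maxd.
exists U => x; split=> [/gU //|Qx].
suff /eqP -> : U == (U + <[x]>)%VS by rewrite memvE addvSr.
rewrite eqEdim addvSl /= dU; apply: maxd; apply/asboolP; exists (U + <[x]>)%VS => //.
move=> y /memv_addP[z /gU Qz [_ /vlineP[c ->] ->]].
by rewrite addrC; apply: QD.
Qed.

Section Radical.
Variables (n : nat) (u : typeD n) (k : fieldType).
Hypothesis n_gt1 : (1 < n)%N.
Hypothesis unitW : forall d, (d %| #|{: typeD n}|)%N -> d%:R != 0 :> k.
Local Notation S := ('I_n * bool)%type.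
Local Notation W := (typeD n).
Local Notation kF := {ffun {set S * S} -> k}.
Local Notation kW := (group_algebra k W).
Local Notation Sim := (base_set u).
Local Notation Sigma := (descent_algebra k Sim).
Local Notation theta := (theta u).
Local Notation gens K := [set base_refl u i | i in K : {set 'I_n}].
Implicit Types a b : kF.

Definition theta_image (R : kF -> Prop) (x : kW) :=
  exists a, [/\ W_invariant a, on_faces a, R a & x = theta a].

Lemma W_invariant_lin c a b : W_invariant a -> W_invariant b ->
  W_invariant [ffun G => c * a G + b G].
Proof. by move=> ia ib w G; rewrite !ffunE ia ib. Qed.

Lemma on_faces_lin c a b : on_faces a -> on_faces b ->
  on_faces [ffun G => c * a G + b G].
Proof.
move=> fa fb G; rewrite ffunE; have [aG|/fa //] := eqVneq (a G) 0.
have [bG|/fb //] := eqVneq (b G) 0.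
by rewrite aG bG mulr0 addr0 eqxx.
Qed.

Lemma W_invariant0 : W_invariant (0 : kF).
Proof. by move=> w G; rewrite !ffunE. Qed.

Lemma on_faces0 : on_faces (0 : kF).
Proof. by move=> G; rewrite ffunE eqxx. Qed.

Lemma theta_image_space (R : kF -> Prop) : R 0 ->
  (forall c a b, R a -> R b -> R [ffun G => c * a G + b G]) ->
  exists U : {vspace kW}, forall x, x \in U <-> theta_image R x.
Proof.
move=> R0 RD; apply: subspace_of.
  by exists 0; split=> //; [exact: W_invariant0 | exact: on_faces0 | rewrite theta0].
move=> c _ _ [a [ia fa Ra ->]] [b [ib fb Rb ->]].
exists [ffun G => c * a G + b G]; split; last by rewrite theta_lin.
- exact: W_invariant_lin.
- exact: on_faces_lin.
- exact: RD.
Qed.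

Lemma descent_theta K : theta (orbit_elt u k n_gt1 K) \in Sigma.
Proof.
rewrite theta_orbit; apply/memv_span/map_f; rewrite mem_enum powersetE.
by apply/subsetP=> _ /imsetP[i _ ->]; apply: base_refl_set.
Qed.

(** Subtracting a multiple of an orbit sum removes a whole orbit from the faces carrying [a]; the
    induction is on their number. *)
Lemma theta_in_descent m : forall a, (#|[set G | a G != 0%R]| <= m)%N ->
  W_invariant a -> on_faces a -> theta a \in Sigma.
Proof.
elim: m => [|m IH] a ha ia fa.
  suff -> : a = 0 by rewrite theta0 mem0v.
  apply/ffunP=> G; rewrite ffunE; apply/eqP; move: ha.
  rewrite leqn0 cards_eq0 => /eqP/setP/(_ G); rewrite !inE => /negbT.
  by rewrite negbK.
have [a0|[G]] := set_0Vmem [set G | a G != 0].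
  by apply: IH => //; rewrite a0 cards0.
rewrite inE => aG; have [w [K [eG _]]] := face_rep u n_gt1 (fa G aG).
pose o := orbit_elt u k n_gt1 K.
pose a' : kF := [ffun H => - a G * o H + a H].
have a'E H : a' H = if [exists w, H == face_act w (fund_face u n_gt1 K)] then 0 else a H.
  rewrite /a' /o !ffunE; case: existsP => [[x /eqP ->]|_]; last by rewrite mulr0 add0r.
  by rewrite ia eG ia mulr1 addNr.
have -> : a = [ffun H => a G * o H + a' H].
  by apply/ffunP=> H; rewrite !ffunE mulNr addNKr.
rewrite theta_lin memvD ?memvZ ?descent_theta //; apply: IH.
- rewrite -ltnS; apply: leq_trans ha; apply: proper_card.
  apply/properP; split; last first.
    exists G; rewrite inE //= negbK a'E ifT //.
    by apply/existsP; exists w; rewrite eG.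
  by apply/subsetP=> H; rewrite !inE a'E; case: ifP => //; rewrite eqxx.
- by apply: W_invariant_lin => //; apply: W_invariant_orbit.
- by apply: on_faces_lin => //; apply: on_faces_orbit.
Qed.

Lemma descentP x : x \in Sigma <-> theta_image (fun=> True) x.
Proof.
split=> [|[a [ia fa _ ->]]]; last exact: theta_in_descent (leqnn _) ia fa.
have [//|//|U hU] := @theta_image_space (fun=> True); rewrite -hU.
apply/subvP/span_subvP => _ /mapP[J + ->].
rewrite mem_enum powersetE => /subsetP sJ.
have -> : J = gens [set i | base_refl u i \in J].
  apply/setP=> w; apply/idP/imsetP => [wJ|[i + ->]]; last by rewrite inE.
  by have /imsetP[i _ e] := sJ w wJ; exists i; rewrite // inE -e.
rewrite -(theta_orbit u k n_gt1); apply/hU.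
exists (orbit_elt u k n_gt1 [set i | base_refl u i \in J]).
by split=> //; [exact: W_invariant_orbit | exact: on_faces_orbit].
Qed.

Lemma W_invariant_conv a b : W_invariant a -> W_invariant b -> W_invariant (face_conv a b).
Proof.
move=> ia ib w G; rewrite !ffunE (reindex_inj (@face_act_inj n w)) /=.
apply: eq_bigr => F _; rewrite (reindex_inj (@face_act_inj n w)) /=.
apply: eq_big => [H|H _]; last by rewrite ia ib.
by rewrite -face_act_tits (inj_eq (@face_act_inj n w)).
Qed.

Lemma face_convE a b G :
  face_conv a b G = \sum_F a F * \sum_(H | tits F H == G) b H.
Proof. by rewrite ffunE; apply: eq_bigr => F _; rewrite mulr_sumr. Qed.

Lemma sum_neq0 (I : finType) (Q : pred I) (f : I -> k) :
  \sum_(i | Q i) f i != 0 -> exists2 i, Q i & f i != 0.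
Proof.
move=> h; have [/existsP[i /andP[Qi fi]]|/existsPn no] := boolP [exists i, Q i && (f i != 0)].
  by exists i.
case/negP: h; apply/eqP/big1 => i Qi; apply/eqP.
by have := no i; rewrite Qi /= negbK.
Qed.

Lemma face_conv_neq0 a b G : face_conv a b G != 0 ->
  exists F, [/\ a F != 0, \sum_(H | tits F H == G) b H != 0 &
    exists2 H, tits F H = G & b H != 0].
Proof.
rewrite face_convE => /sum_neq0[F _]; rewrite mulf_eq0 negb_or => /andP[aF bF].
by exists F; split=> //; have [H /eqP] := sum_neq0 bF; exists H.
Qed.

Lemma on_faces_conv a b : on_faces a -> on_faces b -> on_faces (face_conv a b).
Proof.
move=> fa fb G /face_conv_neq0[F [/fa fF _ [H <- /fb fH]]].
exact: face_tits.
Qed.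

(* The characters of the algebra of faces, indexed by the supports.             *)
Definition phi (Z : {set S * S}) a := \sum_(F | Z \subset zeros F) a F.

Lemma phi_conv Z a b : phi Z (face_conv a b) = phi Z a * phi Z b.
Proof.
rewrite /phi; under eq_bigr => G _ do rewrite ffunE.
rewrite (exchange_big_dep xpredT) //= big_distrlr /= [RHS]big_mkcond /=.
apply: eq_bigr => F _; rewrite (exchange_big_dep xpredT) //=.
transitivity (\sum_H (if (Z \subset zeros F) && (Z \subset zeros H) then a F * b H else 0)).
  apply: eq_bigr => H _; rewrite -subsetI -zeros_tits; case: ifP => c.
    rewrite (eq_bigl (pred1 (tits F H))) ?big_pred1_eq // => G.
    by rewrite /= [G == _]eq_sym; case: (tits F H =P G) => [<-|]; rewrite ?c ?andbF.
  by rewrite big_pred0 // => G; case: (tits F H =P G) => [<-|]; rewrite ?c ?andbF.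
by case: (Z \subset zeros F) => /=; [rewrite -big_mkcond | rewrite big1].
Qed.

Lemma phi_lin Z c a b : phi Z [ffun G => c * a G + b G] = c * phi Z a + phi Z b.
Proof.
by rewrite /phi mulr_sumr -big_split; apply: eq_bigr => F _; rewrite ffunE.
Qed.

Lemma null_phi a : null a -> forall Z, phi Z a = 0.
Proof. by move=> na Z; apply: (@null_sub n k a (fun Z' => Z \subset Z')). Qed.

(** Moebius inversion over the inclusion of supports, starting from the largest sets of vanishing
    roots. *)
Lemma phi_null a : (forall Z, phi Z a = 0) -> null a.
Proof.
move=> h; suff main m : forall Z, (#|~: Z| <= m)%N -> \sum_(F | zeros F == Z) a F = 0.
  by move=> Z; apply: (main #|~: Z|).
elim: m => [|m IH] Z hZ.
  have := h Z; rewrite /phi; apply: etrans; apply: eq_bigl => F.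
  rewrite eqEsubset andbC; case: (boolP (Z \subset _)) => //= _.
  apply/subsetP=> p _; move: hZ; rewrite leqn0 cards_eq0 => /eqP/setP/(_ p).
  by rewrite !inE => /negbFE.
have := h Z; rewrite /phi (bigID (fun F => zeros F == Z)) /=.
rewrite [X in _ + X](partition_big (@zeros n) (fun Z' => Z \proper Z')) /=; last first.
  by move=> F /andP[s ne]; rewrite properEneq eq_sym ne.
rewrite [X in _ + X]big1 ?addr0.
  apply: etrans; apply: eq_bigl => F; case: eqP => [->|]; rewrite ?subxx ?andbF //.
move=> Z' pZ; rewrite -[RHS](IH Z') => [|]; last first.
  by rewrite -ltnS; apply: leq_trans hZ; rewrite proper_card // properC.
apply: eq_bigl => F; case: (zeros F =P Z') => [->|_]; rewrite ?andbF // andbT.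
by rewrite (proper_sub pZ) eq_sym (proper_neq pZ).
Qed.

Definition lev (j : nat) a := forall G, a G != 0 ->
  exists v, [/\ good v, G = pattern v & (level v < j)%N].

Lemma lev_lin j c a b : lev j a -> lev j b -> lev j [ffun G => c * a G + b G].
Proof.
move=> ha hb G; rewrite ffunE; have [aG|/ha //] := eqVneq (a G) 0.
have [bG|/hb //] := eqVneq (b G) 0.
by rewrite aG bG mulr0 addr0 eqxx.
Qed.

Lemma lev_zero j : lev j (0 : kF).
Proof. by move=> G; rewrite ffunE eqxx. Qed.

Lemma lev_0 a : lev 0 a -> a = 0.
Proof.
move=> ha; apply/ffunP=> G; rewrite ffunE; apply/eqP; apply: contraT => /ha[v []].
by rewrite ltn0.
Qed.

(** A nonzero coefficient of the product needs a face of [a] whose contribution is nonzero; by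
    [null_coef] the resulting face has smaller level than that face. *)
Lemma lev_conv j a b : lev j.+1 a -> W_invariant b -> on_faces b -> null b ->
  lev j (face_conv a b).
Proof.
move=> ha ib fb nb G /face_conv_neq0[F [/ha[v [gv -> lv]] sb [H eH /fb fH]]].
have fG : face G by rewrite -eH; apply: face_tits => //; exists v.
have [v' gv' eG] := good_rep fG; exists v'; split=> //.
rewrite ltnNge; apply: contra sb => le_jv.
rewrite eG (null_coef unitW ib fb nb gv') //.
  by rewrite -eG -eH sub_tits.
by apply: leq_trans le_jv; rewrite -ltnS.
Qed.

(** The unit is the face at the origin, a single zero block of size n; the bound in [lev] is strict,
    whence the successor. *)
Lemma lev_unit : lev (uphalf n).+1 (unit_elt n k).
Proof.
move=> G; rewrite ffunE; have [->|_] := eqVneq G set0; last by rewrite eqxx.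
have all0 : block (fun=> 0 : int) 0%N = [set: 'I_n] by apply/setP=> i; rewrite !inE.
move=> _; exists (fun=> 0); split; last 1 first.
- rewrite (@levelE n (fun=> 0) 1) // big_ord1 all0 cardsT card_ord.
  by rewrite /block_weight /= ltnSn.
- by rewrite /good all0 cardsT card_ord; case: n n_gt1 => [|[]].
- by rewrite pattern0.
Qed.

Lemma theta_image_mul (R1 R2 R3 : kF -> Prop) x y :
  (forall a b, W_invariant a -> on_faces a -> R1 a ->
     W_invariant b -> on_faces b -> R2 b -> R3 (face_conv b a)) ->
  theta_image R1 x -> theta_image R2 y -> theta_image R3 (x * y).
Proof.
move=> hR [a [ia fa Ra ->]] [b [ib fb Rb ->]].
exists (face_conv b a); split; last by rewrite theta_mul.
- exact: W_invariant_conv.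
- exact: on_faces_conv.
- exact: hR.
Qed.

Lemma theta_lev_mul j x y : theta_image (@null n k) x -> theta_image (lev j.+1) y ->
  theta_image (lev j) (x * y).
Proof. by apply: theta_image_mul => a b ia fa na ib fb lb; apply: lev_conv. Qed.

Lemma theta_null_mul x y : theta_image (fun=> True) x -> theta_image (@null n k) y ->
  theta_image (@null n k) (x * y).
Proof.
apply: theta_image_mul => a b ia fa _ ib fb nb; apply: phi_null => Z.
by rewrite phi_conv (null_phi nb) mul0r.
Qed.

Lemma descent_mul x y : x \in Sigma -> y \in Sigma -> x * y \in Sigma.
Proof.
by move=> /descentP hx /descentP hy; apply/descentP; move: hx hy; apply: theta_image_mul.
Qed.

Lemma theta_image_one (R : kF -> Prop) : R (unit_elt n k) -> theta_image R 1.
Proof.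
move=> R1; exists (unit_elt n k); split=> //.
- exact: W_invariant_unit.
- exact: on_faces_unit.
- by rewrite theta1.
Qed.

Lemma descent_one : 1 \in Sigma.
Proof. by apply/descentP/theta_image_one. Qed.

Lemma theta_pow x j : theta_image (@null n k) x -> (j <= (uphalf n).+1)%N ->
  theta_image (lev ((uphalf n).+1 - j)) (x ^+ j).
Proof.
move=> nx; elim: j => [|j IH] hj.
  by rewrite expr0 subn0; apply: theta_image_one; exact: lev_unit.
rewrite exprS; apply: theta_lev_mul nx _.
by rewrite -subSn // subSS; apply: IH; apply: ltnW.
Qed.

Lemma theta_null_nilp x : theta_image (@null n k) x -> x ^+ (uphalf n).+1 = 0.
Proof.
move=> nx; have [a [_ _ + ->]] := theta_pow nx (leqnn _).
by rewrite subnn => /lev_0 ->; rewrite theta0.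
Qed.

Lemma phi_unit Z : phi Z (unit_elt n k) = 1.
Proof.
rewrite /phi (bigD1 set0) /=; last by apply/subsetP=> p; rewrite !inE.
by rewrite ffunE eqxx big1 ?addr0 // => G /andP[_ /negbTE nG]; rewrite ffunE nG.
Qed.

Lemma theta_eq a b : W_invariant a -> on_faces a -> W_invariant b -> on_faces b ->
  theta a = theta b -> a = b.
Proof.
move=> ia fa ib fb e; pose d : kF := [ffun G => -1 * b G + a G].
have d0 : d = 0.
  apply: (theta_inj (u := u) n_gt1); first exact: W_invariant_lin.
    exact: on_faces_lin.
  by rewrite theta_lin e scaleN1r addNr.
apply/ffunP=> G; have /ffunP/(_ G) := d0; rewrite !ffunE mulN1r addrC.
by move/eqP; rewrite subr_eq0 => /eqP.
Qed.

(** The kernel of a character [phi Z] is a left ideal not containing 1, and it is maximal because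
    its codimension is 1. So the radical is killed by all characters, and [phi_null] applies. *)
Lemma radical_null x : x \in radical Sigma -> theta_image (@null n k) x.
Proof.
move/radicalP=> [/descentP[a [ia fa _ ex]] hM].
exists a; split=> //; apply: phi_null => Z.
have [||M hMQ] := @theta_image_space (fun b => phi Z b = 0).
- by rewrite /phi big1 // => F _; rewrite ffunE.
- by move=> c b b' h h'; rewrite phi_lin h h' mulr0 addr0.
have sub y : y \in M -> y \in Sigma.
  by move=> /hMQ[b [ib fb _ ->]]; apply/descentP; exists b.
have one_notin : 1 \notin M.
  apply/negP => /hMQ[b [ib fb b0]]; rewrite -(theta1 u k n_gt1).
  move/theta_eq => /(_ (@W_invariant_unit n k) (@on_faces_unit n k) ib fb) e.
  by move: b0; rewrite -e phi_unit => /eqP; rewrite oner_eq0.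
have maxM : maximal_left_ideal Sigma M.
  split.
  - split; first by apply/subvP.
    apply/prodvP => y z /descentP hy /hMQ hz; apply/hMQ; move: hy hz.
    by apply: theta_image_mul => b b' _ _ _ _ _ b'0; rewrite phi_conv b'0 mul0r.
  - by move=> e; case/negP: one_notin; rewrite e descent_one.
  move=> I [sI AI] sMI; have [sIM|/subvPn[y yI yM]] := boolP (I <= M)%VS.
    by left; apply/eqP; rewrite eqEsubv sIM.
  right; apply/eqP; rewrite eqEsubv sI /=.
  suff I1 : 1 \in I.
    by apply/subvP=> z zA; rewrite -[z]mulr1; apply: (subvP AI); apply: memv_mul.
  have /descentP[b [ib fb _ ey]] := subvP sI _ yI.
  have phib : phi Z b != 0.
    by apply: contra yM => /eqP b0; apply/hMQ; exists b.
  have : theta [ffun G => - phi Z b * unit_elt n k G + b G] \in I.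
    apply: (subvP sMI); apply/hMQ; eexists; split; last reflexivity.
    - by apply: W_invariant_lin => //; apply: W_invariant_unit.
    - by apply: on_faces_lin => //; apply: on_faces_unit.
    - by rewrite phi_lin phi_unit mulr1 addNr.
  rewrite theta_lin (theta1 u k n_gt1) -ey => h.
  have : - (phi Z b *: 1) \in I by rewrite -scaleNr -[X in X \in I](addrK y) memvB.
  by rewrite memvN => /(memvZ (phi Z b)^-1); rewrite scalerA mulVf // scale1r.
have /hMQ[b [ib fb b0 eb]] := hM _ maxM.
by rewrite (theta_eq ia fa ib fb) // -ex.
Qed.

(** If a maximal left ideal [M] missed [x], the left ideal of all m + y x would be everything, so 1
    = m + y x. But y x is again null, hence nilpotent. *)
Lemma null_radical x : theta_image (@null n k) x -> x \in radical Sigma.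
Proof.
move=> nx; apply/radicalP; split.
  by case: nx => a [ia fa _ ->]; apply/descentP; exists a.
move=> M [[sM AM] nM maxM].
have xA : x \in Sigma by case: nx => a [ia fa _ ->]; apply/descentP; exists a.
have absM y z : y \in Sigma -> z \in M -> y * z \in M.
  by move=> yA zM; apply: (subvP AM); apply: memv_mul.
have [||I hI] := @subspace_of k kW
    (fun z => exists m y, [/\ m \in M, y \in Sigma & z = m + y * x]).
- by exists 0, 0; rewrite !mem0v mul0r addr0.
- move=> c _ _ [m [y [mM yA ->]]] [m' [y' [mM' yA' ->]]].
  exists (c *: m + m'), (c *: y + y'); rewrite !memvD ?memvZ //; split=> //.
  by rewrite scalerDr scalerAl mulrDl addrACA.
have xI : x \in I by apply/hI; exists 0, 1; rewrite mem0v descent_one mul1r add0r.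
have sMI : (M <= I)%VS.
  by apply/subvP => m mM; apply/hI; exists m, 0; rewrite mem0v mM mul0r addr0.
have idI : left_ideal Sigma I.
  split.
    apply/subvP => _ /hI[m [y [mM yA ->]]].
    by apply: memvD; [exact: (subvP sM) | exact: descent_mul].
  apply/prodvP => y z yA /hI[m [y' [mM yA' ->]]]; apply/hI.
  exists (y * m), (y * y'); rewrite absM // descent_mul //; split=> //.
  by rewrite mulrDr mulrA.
case: (maxM I idI sMI) => eI; first by rewrite -eI.
have /hI[m [y [mM yA e1]]] : 1 \in I by rewrite eI descent_one.
have nz : theta_image (@null n k) (y * x) by apply: theta_null_mul nx; apply/descentP.
have zA i : (y * x) ^+ i \in Sigma.
  elim: i => [|i IH]; first by rewrite expr0 descent_one.
  by rewrite exprS !descent_mul.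
(* Multiplying 1 = m + y x by a power of y x shows that each power is congruent to the next modulo
   [M]; this descends from the vanishing power to 1. *)
have zM j : (j <= (uphalf n).+1)%N -> (y * x) ^+ ((uphalf n).+1 - j) \in M.
  elim: j => [|j IH] hj; first by rewrite subn0 theta_null_nilp ?mem0v.
  have -> : (y * x) ^+ ((uphalf n).+1 - j.+1) = (y * x) ^+ ((uphalf n).+1 - j.+1) * m +
      (y * x) ^+ ((uphalf n).+1 - j) by rewrite -[LHS]mulr1 e1 mulrDr -exprSr -subSn // subSS.
  by apply: memvD; [apply: absM | apply: IH; apply: ltnW].
case: nM; apply/eqP; rewrite eqEsubv sM /=.
apply/subvP => z zS; rewrite -[z]mulr1; apply: absM => //.
by have := zM _ (leqnn _); rewrite subnn expr0.
Qed.

Lemma radicalE x : x \in radical Sigma <-> theta_image (@null n k) x.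
Proof. by split; [apply: radical_null | apply: null_radical]. Qed.

Lemma radical_pow_lev j x : (j <= (uphalf n).+1)%N -> x \in (radical Sigma ^+ j)%VS ->
  theta_image (lev ((uphalf n).+1 - j)) x.
Proof.
have space i := @theta_image_space (lev i) (@lev_zero i) (@lev_lin i).
elim: j x => [|j IH] x hj.
  rewrite expv0 subn0 => /vlineP[c ->]; have [U hU] := space (uphalf n).+1.
  by apply/hU/memvZ/hU/theta_image_one; exact: lev_unit.
have [U hU] := space ((uphalf n).+1 - j.+1)%N.
rewrite expvSl => xr; apply/hU; apply: subvP x xr; apply/prodvP => y z /radicalE ny zr.
apply/hU; apply: theta_lev_mul ny _.
by rewrite -subSn // subSS; apply: IH => //; apply: ltnW.
Qed.

Lemma radical_pow0 : (radical Sigma ^+ (uphalf n).+1 = 0)%VS.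
Proof.
apply/eqP; rewrite -subv0; apply/subvP => x /(radical_pow_lev (leqnn _))[a [_ _ + ->]].
by rewrite subnn => /lev_0 ->; rewrite theta0 mem0v.
Qed.

Lemma radical_pow_neq0 x j : theta_image (@null n k) x -> x ^+ j != 0 ->
  forall l, (radical Sigma ^+ l = 0)%VS -> (j < l)%N.
Proof.
move=> /radicalE xr xj l hl; rewrite ltnNge; apply: contra xj => le_lj.
have mem i : x ^+ i \in (radical Sigma ^+ i)%VS.
  elim: i => [|i IH]; first by rewrite expr0 expv0 memv_line.
  by rewrite exprS expvSl memv_mul.
have := mem l; rewrite hl memv0 => /eqP x0.
by rewrite -(subnK le_lj) exprD x0 mulr0.
Qed.

End Radical.

(** * A Thue-Morse sum *)

Section ThueMorse.
Variable k : fieldType.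

(** The Thue-Morse sign: the parity of the number of ones among the last [j] binary digits of
    [q]. *)
Definition tm (j q : nat) : k := \prod_(l < j) (-1) ^+ odd (q %/ 2 ^ l).

Lemma tm_double j q (s : bool) : tm j.+1 (2 * q + s) = (-1) ^+ s * tm j q.
Proof.
rewrite /tm big_ord_recl expn0 divn1; congr (_ * _).
  by rewrite oddD mul2n odd_double; case: s.
apply: eq_bigr => l _; congr (_ ^+ odd _).
rewrite /= /bump /= add1n expnS divnMA [(2 * q)%N]mulnC divnMDl //.
by have -> : (s %/ 2 = 0)%N; [case: s | rewrite addn0].
Qed.

Lemma tm_low j q : (q < 2 ^ j)%N -> tm j.+1 q = tm j q.
Proof. by move=> hq; rewrite /tm big_ord_recr /= divn_small // expr0 mulr1. Qed.

Lemma tm_high j q : (q < 2 ^ j)%N -> tm j.+1 (q + 2 ^ j) = - tm j q.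
Proof.
move=> hq; rewrite /tm big_ord_recr /= divnDr ?dvdnn // divnn expn_gt0 /=.
rewrite divn_small // expr1 mulrN1; congr (- _); apply: eq_bigr => l _; congr (_ ^+ _).
have -> : (2 ^ j = 2 ^ (j - l).-1 * 2 * 2 ^ l)%N.
  by rewrite -expnSr prednK ?subn_gt0 // -expnD subnK // ltnW.
by rewrite addnC divnMDl ?expn_gt0 // oddD oddM /= andbF.
Qed.

Lemma tm_sqr j q : tm j q * tm j q = 1.
Proof.
by rewrite /tm -big_split big1 // => l _; rewrite /= -signr_addb addbb.
Qed.

(** Prouhet's argument: pairing q with q + 2^j takes a finite difference of step 2^j, which lowers
    the degree by one and multiplies the leading coefficient by -(j+1) 2^j when d = j + 1. *)
Lemma tm_sum j d (x : k) : (d <= j)%N ->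
  \sum_(0 <= q < 2 ^ j) tm j q * (x + q%:R) ^+ d =
  if d == j then \prod_(l < j) (- (l.+1)%:R * 2 ^+ l) else 0.
Proof.
elim: j d x => [|j IH] d x.
  by rewrite leqn0 => /eqP ->; rewrite expn0 big_nat1 /tm !big_ord0 mul1r expr0.
move=> hd; rewrite expnS mul2n -addnn.
rewrite (@big_cat_nat _ _ _ (2 ^ j)) ?leq_addr //=.
rewrite -{2}[(2 ^ j)%N]add0n big_addn addnK.
rewrite [X in _ + X](eq_big_nat _ _ (F2 := fun q =>
    - \sum_(i < d.+1) tm j q * (x + q%:R) ^+ i * ((2 ^+ j) ^+ (d - i) *+ 'C(d, i)))); last first.
  move=> q /andP[_ hq]; rewrite tm_high // mulNr natrD natrX addrA [_ + 2 ^+ j]addrC.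
  rewrite exprDn mulr_sumr; congr (- _); apply: eq_bigr => i _.
  move: (_ ^+ i) (_ ^+ (d - i)) (tm j q) => y z t.
  by rewrite -mulrA [y * _]mulrnAr [y * z]mulrC.
rewrite (eq_big_nat _ _ (F2 := fun q => tm j q * (x + q%:R) ^+ d)); last first.
  by move=> q /andP[_ hq]; rewrite tm_low.
rewrite sumrN exchange_big /= big_ord_recr /= subnn expr0 binn mulr1n.
under [X in _ - (X + _)]eq_bigr => i _ do rewrite -mulr_suml.
rewrite -mulr_suml mulr1 opprD addrCA addrN addr0.
under eq_bigr => i _.
  rewrite IH; last by rewrite -ltnS (leq_trans _ hd).
  over.
have [->|nd] := eqVneq d j.+1; last first.
  rewrite big1 ?oppr0 // => i _; rewrite ifN ?mul0r //.
  by apply: contra nd => /eqP ei; rewrite eqn_leq hd -ei /=.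
rewrite big_ord_recr /= big1 ?add0r ?eqxx; last first.
  by move=> i _; rewrite ifN ?mul0r // neq_ltn ltn_ord.
rewrite subSnn expr1 binSn big_ord_recr /=.
by rewrite mulNr mulr_natl mulrN.
Qed.

End ThueMorse.

(** * Powers of a radical element *)

Section SignVectors.
Variables (n : nat) (k : fieldType).
Local Notation S := ('I_n * bool)%type.
Local Notation W := (typeD n).
Local Notation kF := {ffun {set S * S} -> k}.

Definition sign_vec (s : {ffun 'I_n -> bool}) : 'I_n -> int :=
  fun i => if s i then 1 else -1.

Definition sign_elt : kF :=
  [ffun G => \sum_(s | pattern (sign_vec s) == G) \prod_i (-1) ^+ s i].

Definition sign_act (w : W) (s : {ffun 'I_n -> bool}) : {ffun 'I_n -> bool} :=
  [ffun i => let x := w^-1%g (i, false) in s x.1 (+) x.2].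

Lemma sign_vec_act w s : vec_act w (sign_vec s) =1 sign_vec (sign_act w s).
Proof.
by move=> i; rewrite /vec_act /sign_vec ffunE /signed_coord; case: (s _); case: _.2.
Qed.

Lemma typeD_fst_inj (w : W) : injective (fun i => (w (i, false)).1).
Proof. by apply: signed_fst_inj; have /andP[] := valP w. Qed.

Lemma sign_act_inj w : injective (sign_act w).
Proof.
move=> s s' e; apply/ffunP=> i.
have [g _ gK] := injF_bij (@typeD_fst_inj w^-1%g); rewrite -[i]gK.
by have /ffunP/(_ (g i)) := e; rewrite !ffunE => /addIb.
Qed.

Lemma prod_signr (I : finType) (f : I -> bool) :
  \prod_i (-1) ^+ f i = (-1) ^+ (\big[addb/false]_i f i) :> k.
Proof.
apply/esym; exact: (big_morph (fun b : bool => (-1 : k) ^+ b) (@signr_addb k) (erefl _)).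
Qed.

Lemma sign_act_prod w s : \prod_i (-1) ^+ sign_act w s i = \prod_i (-1) ^+ s i :> k.
Proof.
rewrite [RHS](reindex_inj (@typeD_fst_inj w^-1%g)) /=.
under eq_bigr => i _ do rewrite ffunE signr_addb.
rewrite big_split /= [X in _ * X](_ : _ = 1) ?mulr1 //.
have /andP[_ h] := valP w^-1%g; move: h; rewrite odd_negated.
by rewrite prod_signr => /negbTE ->.
Qed.

Lemma W_invariant_sign : W_invariant sign_elt.
Proof.
move=> w G; rewrite !ffunE (reindex_inj (@sign_act_inj w)) /=.
apply: eq_big => [s|s _]; last exact: sign_act_prod.
by rewrite -(pattern_ext (sign_vec_act w s)) pattern_vec_act (inj_eq (@face_act_inj n w)).
Qed.

Lemma on_faces_sign : on_faces sign_elt.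
Proof.
by move=> G; rewrite ffunE => /sum_neq0[s /eqP <- _]; exists (sign_vec s).
Qed.

(** Negating a sign vector keeps its support and multiplies its coefficient by (-1)^n = -1. *)
Lemma null_sign : odd n -> 2 != 0 :> k -> null sign_elt.
Proof.
move=> on two Z.
transitivity (\sum_(s | zeros (pattern (sign_vec s)) == Z) \prod_i (-1) ^+ s i : k).
  rewrite [RHS](partition_big (fun s => pattern (sign_vec s)) (fun F => zeros F == Z)) //=.
  apply: eq_bigr => F ZF; rewrite ffunE; apply: eq_bigl => s.
  by case: eqP => [->|]; rewrite ?ZF ?andbF.
set t := \sum_(s | _) _; suff : t = - t.
  by move/eqP; rewrite -addr_eq0 -mulr2n -mulr_natl mulf_eq0 (negPf two) => /eqP.
have neg_inj : injective (fun s : {ffun 'I_n -> bool} => [ffun i => ~~ s i] : {ffun 'I_n -> bool}).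
  by move=> s s' /ffunP e; apply/ffunP=> i; have := e i; rewrite !ffunE => /negb_inj.
rewrite {1}/t (reindex_inj neg_inj) /= /t -sumrN; apply: eq_big => [s|s _].
  congr (_ == _); apply/setP=> p; rewrite !in_zeros; congr (_ || _).
  rewrite -[RHS]oppr_eq0 -mulN1r -rootvalZ; congr (_ == _).
  by apply: rootval_ext => i; rewrite /sign_vec ffunE; case: (s i).
under eq_bigr => i _ do rewrite ffunE signrN.
by rewrite prodrN card_ord -signr_odd on expr1 mulN1r.
Qed.

(** The binary word e_i is read with digits -1 and 1 instead of 0 and 1, so appending a sign amounts
    to v -> 2 v + s. *)
Definition word_vec (j : nat) (e : {ffun 'I_n -> 'I_(2 ^ j)}) : 'I_n -> int :=
  fun i => 2 * (e i : nat)%:Z + 1 - (2 ^ j)%:Z.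

(* The j-th power of sign_elt: the j signs of a coordinate, read as the binary *)
(* digits of a number below 2 ^ j, are compared lexicographically.             *)
Definition word_elt (j : nat) : kF :=
  [ffun G => \sum_(e | pattern (@word_vec j e) == G) \prod_i tm k j (e i)].

Lemma word_elt0 : word_elt 0 = unit_elt n k.
Proof.
apply/ffunP=> G; rewrite !ffunE.
have pat0 e : pattern (@word_vec 0 e) = set0.
  rewrite -(pattern0 n); apply: pattern_ext => i.
  by rewrite /word_vec; case: (e i) => -[|q] //; rewrite expn0.
have [->|nG] := eqVneq G set0; last first.
  by rewrite big_pred0 // => e; rewrite pat0 eq_sym (negPf nG).
pose e0 : {ffun 'I_n -> 'I_(2 ^ 0)} := [ffun=> ord0].
rewrite (big_pred1 e0) => [|e]; first by rewrite big1 // => i _; rewrite /tm big_ord0.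
rewrite pat0 eqxx; apply/esym/eqP/ffunP=> i; apply/val_inj.
by case: (e i) (e0 i) => -[|q] // h [[|q'] h'].
Qed.

Fact word_cons_lt j (q : 'I_(2 ^ j)) (s : bool) : (2 * q + s < 2 ^ j.+1)%N.
Proof. by have := ltn_ord q; rewrite expnS; case: s => /=; lia. Qed.

(** The factor 2 suffices in [tits_pattern_dom]: root values of word vectors are even, and those of
    sign vectors are at most 2 in absolute value. *)
Lemma tits_word j e s :
  tits (pattern (@word_vec j e)) (pattern (sign_vec s)) =
  pattern (@word_vec j.+1 [ffun i => Ordinal (word_cons_lt (e i) (s i))]).
Proof.
rewrite (@tits_pattern_dom _ _ _ 2) => [|p].
  apply: pattern_ext => i; rewrite /word_vec /sign_vec ffunE /= expnS.
  by case: (s i) => /=; lia.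
rewrite /rootval /signed_coord /word_vec /sign_vec.
by case: p => [[i [] ] [j' []]] /=; case: (s i); case: (s j'); lia.
Qed.

Lemma word_eltS j : word_elt j.+1 = face_conv (word_elt j) sign_elt.
Proof.
apply/ffunP=> G; rewrite face_convE ffunE.
pose cons (es : {ffun 'I_n -> 'I_(2 ^ j)} * {ffun 'I_n -> bool}) : {ffun 'I_n -> 'I_(2 ^ j.+1)} :=
  [ffun i => Ordinal (word_cons_lt (es.1 i) (es.2 i))].
have half_lt (q : 'I_(2 ^ j.+1)) : (q./2 < 2 ^ j)%N.
  by have := ltn_ord q; have := expnS 2 j; lia.
pose uncons (e : {ffun 'I_n -> 'I_(2 ^ j.+1)}) :
    {ffun 'I_n -> 'I_(2 ^ j)} * {ffun 'I_n -> bool} :=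
  ([ffun i => Ordinal (half_lt (e i))], [ffun i => odd (e i)]).
rewrite (reindex cons) /=; last first.
  exists uncons => [[e s] _|e _]; last first.
    apply/ffunP=> i; apply/val_inj; rewrite !ffunE /=.
    by have := odd_double_half (e i); lia.
  congr (_, _); apply/ffunP=> i; rewrite !ffunE /=; last by case: (s i); lia.
  by apply/val_inj => /=; case: (s i); lia.
transitivity (\sum_e \sum_s (if tits (pattern (@word_vec j e)) (pattern (sign_vec s)) == G then
   (\prod_i tm k j (e i)) * \prod_i (-1) ^+ s i else 0)).
  rewrite pair_big /= big_mkcond /=; apply: eq_bigr => [[e s] _] /=.
  rewrite tits_word; case: ifP => // _; rewrite -big_split; apply: eq_bigr => i _.
  by rewrite ffunE /= tm_double mulrC.
under [RHS]eq_bigr => F _.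
  rewrite ffunE mulr_suml; over.
rewrite /= [RHS](exchange_big_dep xpredT) //=; apply: eq_bigr => e _.
rewrite [RHS](eq_bigl (pred1 (pattern (@word_vec j e)))) => [|F]; last by rewrite eq_sym.
rewrite big_pred1_eq mulr_sumr; under [RHS]eq_bigr => H _.
  rewrite ffunE mulr_sumr; over.
rewrite /= [RHS](exchange_big_dep xpredT) //=; apply: eq_bigr => s _.
case: ifP => c; last first.
  by rewrite big_pred0 // => H; case: (pattern (sign_vec s) =P H) => [<-|]; rewrite ?c ?andbF.
rewrite (eq_bigl (pred1 (pattern (sign_vec s)))) ?big_pred1_eq // => H.
by rewrite /= [H == _]eq_sym; case: (pattern (sign_vec s) =P H) => [<-|]; rewrite ?c ?andbF.
Qed.

Lemma theta_sign_pow (u : typeD n) j : (1 < n)%N ->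
  theta u sign_elt ^+ j = theta u (word_elt j).
Proof.
move=> n_gt1; elim: j => [|j IH]; first by rewrite expr0 word_elt0 theta1.
rewrite exprS IH theta_mul // ?word_eltS //; last exact: on_faces_sign.
elim: j {IH} => [|j IH]; first by rewrite word_elt0; apply: W_invariant_unit.
by rewrite word_eltS; apply: W_invariant_conv => //; apply: W_invariant_sign.
Qed.

End SignVectors.

(** * Nonvanishing of the (m+1)-st power in dimension 2m+1 *)

Section WordNonzero.
Variables (m : nat) (k : fieldType).
Hypothesis m_gt0 : (0 < m)%N.
Local Notation n := (2 * m).+1.

Definition left_idx (i : 'I_m) : 'I_n := inord (2 * i).
Definition right_idx (i : 'I_m) : 'I_n := inord (2 * i).+1.

Lemma left_idxE i : left_idx i = (2 * i)%N :> nat.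
Proof. by rewrite inordK //; have := ltn_ord i; lia. Qed.

Lemma right_idxE i : right_idx i = (2 * i).+1 :> nat.
Proof. by rewrite inordK //; have := ltn_ord i; lia. Qed.

Lemma prod_pairs (F : 'I_n -> k) :
  \prod_i F i = F ord_max * \prod_(i < m) (F (left_idx i) * F (right_idx i)).
Proof.
rewrite big_ord_recr /= mulrC; congr (_ * _).
pose G l := F (inord l).
transitivity (\prod_(l < 2 * m) G l).
  by apply: eq_bigr => l _; congr F; apply: val_inj; rewrite /= inordK // ltnS ltnW.
rewrite -[RHS]/(\prod_(i < m) (G (2 * i)%N * G (2 * i).+1)).
elim: (m) => [|q IH]; first by rewrite muln0 !big_ord0.
by rewrite mulnS !big_ord_recr /= IH mulrA.
Qed.

(** The bound 2^m is the threshold from which [word_vec] is positive. *)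
Definition word_ok (e : {ffun 'I_n -> 'I_(2 ^ m.+1)}) :=
  [forall i, [&& e (left_idx i) == e (right_idx i), (2 ^ m <= e (left_idx i))%N &
    (e (left_idx i) < e ord_max)%N]].

Definition pair_face : {set {set ('I_n * bool) * ('I_n * bool)}} :=
  [set G : {set ('I_n * bool) * ('I_n * bool)} | [forall i,
    [&& ((left_idx i, false), (right_idx i, false)) \in G,
    ((left_idx i, false), (right_idx i, true)) \notin G,
    ((right_idx i, false), (left_idx i, true)) \notin G &
    ((ord_max, false), (left_idx i, true)) \in G]]].

Lemma pair_face_word e : (pattern (word_vec e) \in pair_face) = word_ok e.
Proof.
rewrite inE; apply: eq_forallb => i; rewrite !inE /rootval /signed_coord /word_vec /=.
have -> : left_idx i != right_idx i by rewrite -val_eqE /= left_idxE right_idxE; lia.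
have -> : right_idx i != left_idx i by rewrite -val_eqE /= left_idxE right_idxE; lia.
have -> : ord_max != left_idx i.
  by rewrite -val_eqE /= left_idxE; have := ltn_ord i; lia.
rewrite -val_eqE /=; have := expnS 2 m.
move: (e (left_idx i) : nat) (e (right_idx i) : nat) (e ord_max : nat) => a b c.
by move: (2 ^ m.+1)%N (2 ^ m)%N => x y; lia.
Qed.

(** The two equal entries of a pair contribute the square of a sign, so only the sign of the last
    entry r survives. Each of the m pairs independently takes a value between 2^m and r, excluding
    r. *)
Lemma word_sum :
  \sum_(e | word_ok e) \prod_i tm k m.+1 (e i) =
  \sum_(r < 2 ^ m.+1) tm k m.+1 r * (r - 2 ^ m)%N%:R ^+ m.
Proof.
rewrite (eq_bigr (fun e : {ffun 'I_n -> 'I_(2 ^ m.+1)} => tm k m.+1 (e ord_max))); last first.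
  move=> e /forallP ok; rewrite prod_pairs big1 ?mulr1 // => i _.
  by have /and3P[/eqP <- _ _] := ok i; rewrite tm_sqr.
(* Halving an index gives the number of its pair; for the last index it gives m, so [insub] fails
   and the default [rf.1] is used. *)
pose h (rf : 'I_(2 ^ m.+1) * {ffun 'I_m -> 'I_(2 ^ m.+1)}) : {ffun 'I_n -> 'I_(2 ^ m.+1)} :=
  [ffun i : 'I_n => oapp rf.2 rf.1 (insub (i./2))].
pose h' (e : {ffun 'I_n -> 'I_(2 ^ m.+1)}) := (e ord_max, [ffun i => e (left_idx i)]).
have hmax rf : h rf ord_max = rf.1.
  by rewrite ffunE insubN //= mul2n doubleK ltnn.
have hL rf i : h rf (left_idx i) = rf.2 i.
  by rewrite ffunE left_idxE mul2n doubleK insubT //= => hi; congr (rf.2 _); apply: val_inj.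
have hR rf i : h rf (right_idx i) = rf.2 i.
  rewrite ffunE right_idxE mul2n -uphalfE uphalf_double insubT //= => hi.
  by congr (rf.2 _); apply: val_inj.
rewrite (reindex_onto h h') /=; last first.
  move=> e /forallP ok; apply/ffunP=> i; rewrite ffunE /=.
  case: insubP => [l hl el|hn] /=; last first.
    congr (e _); apply: val_inj => /=; have := ltn_ord i; move: hn; rewrite -leqNgt; lia.
  rewrite ffunE; have /and3P[/eqP eLR _ _] := ok l.
  have [ei|ei] : i = left_idx l \/ i = right_idx l.
  - case: (boolP (odd i)) => oi; [right | left];
      apply: val_inj; rewrite /= ?left_idxE ?right_idxE el;
      by have := odd_double_half i; lia.
  - by rewrite ei.
  by rewrite ei eLR.
have h'h rf : h' (h rf) == rf.
  case: rf => r f; apply/eqP; rewrite /h' hmax; congr (_, _).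
  by apply/ffunP=> i; rewrite ffunE hL.
under eq_bigl => rf do rewrite h'h andbT.
rewrite -(pair_big_dep xpredT (fun r f => word_ok (h (r, f)))
   (fun r f => tm k m.+1 (h (r, f) ord_max))) /=.
apply: eq_bigr => r _; rewrite (eq_bigr (fun=> tm k m.+1 r)) => [|f _]; last by rewrite hmax.
rewrite sumr_const -[LHS]mulr_natr; congr (_ * _).
pose A := [pred q : 'I_(2 ^ m.+1) | 2 ^ m <= q < r]%N.
rewrite -natrX; congr _%:R.
transitivity #|(ffun_on A : {pred {ffun 'I_m -> 'I_(2 ^ m.+1)}})|.
  apply: eq_card => f; rewrite inE; apply/forallP/ffun_onP => hf i; have := hf i;
    by rewrite hL ?hR ?hmax ?eqxx inE.
rewrite card_ffun_on card_ord; congr (_ ^ _)%N.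
rewrite -sum1_card -(big_mkord (fun q => 2 ^ m <= q < r)%N (fun=> 1%N)).
rewrite -[RHS]muln1 -sum_nat_const_nat [RHS](big_nat_widen _ _ _ _ _ (ltnW (ltn_ord r))).
by rewrite [RHS](big_nat_widenl _ 0) //; apply: eq_bigl => q; rewrite /= andbC.
Qed.

Lemma word_elt_neq0 : 2 != 0 :> k -> (forall l, (l < m)%N -> l.+1%:R != 0 :> k) ->
  word_elt n k m.+1 != 0.
Proof.
move=> two hl; apply/eqP=> w0.
have : \sum_(r < 2 ^ m.+1) tm k m.+1 r * (r - 2 ^ m)%N%:R ^+ m = 0.
  rewrite -word_sum; transitivity (\sum_(G in pair_face) word_elt n k m.+1 G); last first.
    by rewrite w0 big1 // => G _; rewrite ffunE.
  rewrite (partition_big (fun e => pattern (word_vec e)) (mem pair_face)) /=; last first.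
    by move=> e; rewrite pair_face_word.
  apply: eq_bigr => G GP; rewrite ffunE; apply: eq_bigl => e; rewrite -pair_face_word.
  by case: eqP => [->|]; rewrite ?andbF // andbT; apply/idP.
rewrite -(big_mkord xpredT (fun r => tm k m.+1 r * (r - 2 ^ m)%N%:R ^+ m)) expnS mul2n -addnn.
rewrite (@big_cat_nat _ _ _ (2 ^ m)) ?leq_addr //= big_nat_cond big1 ?add0r; last first.
  (* For r < 2^m the truncated subtraction gives 0, and its m-th power vanishes since m > 0. *)
  move=> r /andP[/andP[_ hr] _]; rewrite (eqnP (ltnW hr)) expr0n.
  by rewrite (gtn_eqF m_gt0) mulr0.
rewrite -{1}[(2 ^ m)%N]add0n big_addn addnK.
rewrite (eq_big_nat _ _ (F2 := fun q => - (tm k m q * (0 + q%:R) ^+ m))); last first.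
  by move=> q /andP[_ hq]; rewrite tm_high // addnK add0r mulNr.
rewrite sumrN tm_sum // eqxx => /eqP; rewrite oppr_eq0; apply/negP/prodf_neq0 => l _.
by apply: mulf_neq0; rewrite ?oppr_eq0 ?hl ?expf_neq0.
Qed.
End WordNonzero.

(** * The Loewy length *)

Section Units.
Variable n : nat.
Local Notation S := ('I_n * bool)%type.
Local Notation W := (typeD n).

Definition perm_fun (s : {perm 'I_n}) (x : S) : S := (s x.1, x.2).

Lemma perm_fun_inj s : injective (perm_fun s).
Proof. by move=> [i b] [j b'] [/perm_inj -> ->]. Qed.

Definition perm_typeD (s : {perm 'I_n}) : W := insubd (1%g : W) (perm (@perm_fun_inj s)).

Lemma perm_typeDE s x : perm_typeD s x = (s x.1, x.2).
Proof.
rewrite /perm_typeD val_insubd; case: ifP => [_|/negP[]]; first by rewrite permE.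
apply/andP; split; first by apply/signedP=> y; rewrite !permE.
suff -> : negated (perm (@perm_fun_inj s)) = set0 by rewrite cards0.
by apply/setP=> i; rewrite !inE permE.
Qed.

(** The permutations without sign changes form a subgroup isomorphic to the symmetric group. *)
Lemma fact_dvd_typeD : (n`! %| #|{: W}|)%N.
Proof.
pose H := [set perm_typeD s | s in [set: {perm 'I_n}]].
have gH : group_set H.
  apply/group_setP; split.
    by apply/imsetP; exists 1%g => //; apply: typeDP => -[i b]; rewrite perm_typeDE typeD1 perm1.
  move=> _ _ /imsetP[s _ ->] /imsetP[t _ ->]; apply/imsetP; exists (t * s)%g => //.
  by apply: typeDP => x; rewrite typeDM !perm_typeDE permM.
have <- : #|H| = n`!.
  rewrite card_imset ?cardsT ?card_Sn // => s t e; apply/permP => i.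
  by have := congr1 (fun w : W => w (i, false)) e; rewrite !perm_typeDE => -[].
by rewrite -cardsT; exact: (cardSg (subsetT (Group gH))).
Qed.

Variable k : fieldType.
Hypothesis hk : [pchar k] =i pred0 \/
  exists2 p : nat, p \in [pchar k] & ~~ (p %| #|{: W}|)%N.

Lemma typeD_unit d : (d %| #|{: W}|)%N -> d%:R != 0 :> k.
Proof.
move=> hd; apply/negP => d0; have W_gt0 : (0 < #|{: W}|)%N by apply/card_gt0P; exists 1%g.
case: hk => [h|[p pk /negP[]]].
  have [p] := natf0_pchar (dvdn_gt0 W_gt0 hd) d0.
  by rewrite h.
by rewrite (dvdn_trans _ hd) // (dvdn_pcharf pk).
Qed.

Lemma natr_unit l : (l < n)%N -> l.+1%:R != 0 :> k.
Proof.
move=> hl; apply: typeD_unit; apply: dvdn_trans fact_dvd_typeD.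
exact: dvdn_fact.
Qed.

End Units.

Lemma W_invariant_word n (k : fieldType) j : W_invariant (word_elt n k j).
Proof.
elim: j => [|j IH]; first by rewrite word_elt0; apply: W_invariant_unit.
by rewrite word_eltS; apply: W_invariant_conv => //; apply: W_invariant_sign.
Qed.

Lemma on_faces_word n (k : fieldType) j : on_faces (word_elt n k j).
Proof. by move=> G; rewrite ffunE => /sum_neq0[e /eqP <- _]; exists (word_vec e). Qed.

Lemma loewy_base (m n : nat) (k : fieldType) (u : typeD n) : (0 < m)%N -> n = (2 * m).+1 ->
  [pchar k] =i pred0 \/
    (exists2 p : nat, p \in [pchar k] & ~~ (p %| #|{: typeD n}|)%N) ->
  is_loewy_length (descent_algebra k (base_set u)) (m + 2).
Proof.
move=> m_gt0 en; subst n => hk; have n_gt1 : (1 < (2 * m).+1)%N by lia.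
have unitW d := @typeD_unit _ k hk d.
have two : 2 != 0 :> k by exact: (natr_unit hk n_gt1).
have -> : (m + 2 = (uphalf (2 * m).+1).+1)%N by lia.
split; first exact: radical_pow0.
apply: (radical_pow_neq0 n_gt1 unitW (x := theta u (sign_elt _ k)) (j := uphalf (2 * m).+1)).
  exists (sign_elt _ k); split=> //.
  - exact: W_invariant_sign.
  - exact: on_faces_sign.
  - by apply: null_sign => //=; lia.
rewrite theta_sign_pow //; have -> : uphalf (2 * m).+1 = m.+1 by lia.
apply: contra_neq (@word_elt_neq0 m k m_gt0 two _) => [w0|l hl].
  apply: theta_inj w0 => //; [exact: W_invariant_word | exact: on_faces_word].
by apply: (natr_unit hk); lia.
Qed.

(** * Chambers, walls and simple reflections *)

Section Geometry.
Variables (R : realType) (n : nat).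
Hypothesis n_gt1 : (1 < n)%N.
Local Open Scope classical_set_scope.
Local Notation S := ('I_n * bool)%type.
Local Notation W := (typeD n).
Implicit Types v : 'rV[R]_n.

Definition vec_fun v : 'I_n -> R := fun i => v ord0 i.
Definition root_of v (p : S * S) : R := rootval (vec_fun v) p.
Definition root_vec (p : S * S) : 'rV[R]_n :=
  \row_i ((i == p.1.1)%:R * (-1) ^+ p.1.2 + (i == p.2.1)%:R * (-1) ^+ p.2.2).
Definition root_ker (p : S * S) : {vspace 'rV[R]_n} :=
  lker (linfun (mulmxr (root_vec p)^T : 'rV[R]_n -> 'M[R]_1)).
Definition cone (u : W) : set 'rV[R]_n :=
  [set v | forall p, p \in base_face u -> 0 < root_of v p].

Lemma vec_fun_act w v : vec_fun (typeD_act w v) =1 vec_act w (vec_fun v).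
Proof. by move=> i; rewrite /vec_fun mxE. Qed.

Lemma root_ofD v v' p : root_of (v + v') p = root_of v p + root_of v' p.
Proof.
rewrite /root_of -rootvalD; apply: rootval_ext => i.
by rewrite /vec_fun mxE.
Qed.

Lemma root_ofZ a v p : root_of (a *: v) p = a * root_of v p.
Proof.
rewrite /root_of -rootvalZ; apply: rootval_ext => i.
by rewrite /vec_fun mxE.
Qed.

Lemma dot_root v p : (v *m (root_vec p)^T) ord0 ord0 = root_of v p.
Proof.
rewrite mxE (eq_bigr (fun i => v ord0 i * ((i == p.1.1)%:R * (-1) ^+ p.1.2) +
  v ord0 i * ((i == p.2.1)%:R * (-1) ^+ p.2.2))) => [|i _]; last by rewrite !mxE mulrDr.
rewrite big_split /=.
have e (j : 'I_n) (b : bool) : \sum_i v ord0 i * ((i == j)%:R * (-1) ^+ b) =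
    signed_coord (vec_fun v) (j, b).
  rewrite (bigD1 j) //= eqxx mul1r big1 ?addr0 => [|i /negbTE ->]; last by rewrite mul0r mulr0.
  by rewrite /signed_coord /vec_fun; case: b; rewrite ?expr1 ?expr0 ?mulrN1 ?mulr1.
by rewrite !e -!surjective_pairing.
Qed.

Lemma mem_root_ker v p : (v \in root_ker p) = (root_of v p == 0).
Proof.
rewrite memv_ker lfunE /= -dot_root; apply/eqP/eqP => [->|h]; first by rewrite mxE.
by apply/matrixP=> i j; rewrite !ord1 h mxE.
Qed.

Lemma root_vec_coord p x : signed_coord (vec_fun (root_vec p)) x = (pairing p x)%:~R.
Proof.
rewrite /pairing /signed_coord /vec_fun !mxE /signed_coord /sopp.
case: p x => [[i b] [j b']] [l c] /=; rewrite !xpair_eqE !natz !intrB intrD -!pmulrn /=.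
case: (l == i); case: (l == j); case: b; case: b'; case: c => /=;
  rewrite ?mulr1n ?mulr0n ?expr0 ?expr1; ring.
Qed.

Lemma root_of_root p : p.1.1 != p.2.1 -> root_of (root_vec p) p = 2.
Proof.
move=> np; rewrite /root_of /rootval !root_vec_coord -intrD.
suff -> : pairing p p.1 + pairing p p.2 = 2 by [].
case: p np => [[i b] [j b']] /= nij; rewrite /pairing /sopp !xpair_eqE /=.
by rewrite !eqxx (negPf nij) [j == i]eq_sym (negPf nij) /=; case: b; case: b'.
Qed.

Lemma vec_fun_inj v v' : (forall x, signed_coord (vec_fun v) x = signed_coord (vec_fun v') x) ->
  v = v'.
Proof. by move=> h; apply/matrixP=> i j; rewrite ord1; have := h (j, false). Qed.

Lemma coord_act w v x :
  signed_coord (vec_fun (typeD_act w v)) x = signed_coord (vec_fun v) (w^-1%g x).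
Proof.
rewrite -signed_coord_vec_act /signed_coord; case: x.2; by rewrite vec_fun_act.
Qed.

Lemma refl_act p v : p.1.1 != p.2.1 ->
  typeD_act (refl p) v = v - root_of v p *: root_vec p.
Proof.
move=> np; apply: vec_fun_inj => x; rewrite coord_act.
have -> : (refl p)^-1%g = refl p by apply/eqP; rewrite eq_invg_mul refl_inv.
rewrite refl_coord // -root_vec_coord mulrC /signed_coord /vec_fun !mxE.
by case: x.2; rewrite ?mulrN ?opprD ?opprK.
Qed.

(** A vector orthogonal to the hyperplane, minus its component along the root, lies in the
    hyperplane and is orthogonal to itself; so it is 0 and the vector is a multiple of the root. *)
Lemma refl_orthogonal p : p.1.1 != p.2.1 ->
  orthogonal_reflection [set` root_ker p] (typeD_act (refl p)).
Proof.
move=> np; split=> v.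
  by rewrite /= mem_root_ker refl_act // => /eqP ->; rewrite scale0r subr0.
move=> hv; rewrite refl_act //; pose c := root_of v p / 2.
pose h := v - c *: root_vec p.
have hH : root_of h p = 0.
  by rewrite root_ofD -scaleNr root_ofZ root_of_root // /c; field.
have h0 : h = 0.
  have hh : h *m h^T = 0.
    rewrite {2}/h linearB linearZ /= mulmxBr hv; last by rewrite /= mem_root_ker hH.
    have hr : h *m (root_vec p)^T = 0 by apply/matrixP=> i j; rewrite !ord1 dot_root hH mxE.
    by rewrite -scalemxAr hr scaler0 subr0.
  have s0 : \sum_i h ord0 i ^+ 2 = 0.
    have /matrixP/(_ ord0 ord0) := hh; rewrite !mxE => e; rewrite -[RHS]e.
    by apply: eq_bigr => i _; rewrite [h^T _ _]mxE expr2.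
  apply/matrixP=> i j; rewrite ord1 [RHS]mxE; apply/eqP; rewrite -sqrf_eq0; apply/eqP.
  move/eqP: s0; rewrite psumr_eq0 => [/allP/(_ j)|l _]; last exact: sqr_ge0.
  by rewrite mem_index_enum => /(_ isT)/eqP.
have ev : v = c *: root_vec p by apply/eqP; rewrite -subr_eq0; apply/eqP.
rewrite {1 3}ev -scalerBl -scaleNr; congr (_ *: _).
by rewrite /c; field.
Qed.

(** A vector with entries 1, ..., n has pairwise distinct signed coordinates, so it detects the
    whole signed permutation. *)
Lemma typeD_act_eq (w w' : W) : (forall v, typeD_act w v = typeD_act w' v) -> w = w'.
Proof.
move=> h; pose v : 'rV[R]_n := \row_i (i.+1)%:R.
have vinj (x y : S) : signed_coord (vec_fun v) x = signed_coord (vec_fun v) y -> x = y.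
  case: x y => [i b] [j b']; rewrite /signed_coord /vec_fun /= !mxE.
  have pos (l : 'I_n) : 0 < l.+1%:R :> R by rewrite ltr0n.
  have := pos i; have := pos j.
  case: b; case: b' => hi hj e.
  - by move: e => /oppr_inj/eqP; rewrite eqr_nat eqSS => /eqP/val_inj ->.
  - by exfalso; move: e hi hj; lra.
  - by exfalso; move: e hi hj; lra.
  - by move: e => /eqP; rewrite eqr_nat eqSS => /eqP/val_inj ->.
suff e : w^-1%g = w'^-1%g by rewrite -[w]invgK e invgK.
by apply: typeDP => x; apply: vinj; rewrite -!coord_act h.
Qed.

Lemma reflection_unique (w : W) p : p.1.1 != p.2.1 ->
  orthogonal_reflection [set` root_ker p] (typeD_act w) -> w = refl p.
Proof.
move=> np [h1 h2]; apply: typeD_act_eq => v.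
have actE (w' : W) a b x y : typeD_act w' (a *: x + b *: y) =
    a *: typeD_act w' x + b *: typeD_act w' y.
  apply/matrixP=> i j; rewrite !mxE /scoord !mxE.
  by case: (_.2) => //; rewrite opprD !mulrN.
have n2 : typeD_act w (root_vec p) = - root_vec p.
  apply: h2 => x; rewrite /= mem_root_ker => /eqP xp.
  by apply/matrixP=> i j; rewrite !ord1 dot_root xp mxE.
pose c := root_of v p / 2; pose h := v - c *: root_vec p.
have hH : root_of h p = 0.
  by rewrite root_ofD -scaleNr root_ofZ root_of_root // /c; field.
have -> : v = 1 *: h + c *: root_vec p by rewrite scale1r subrK.
have [h1' h2'] := refl_orthogonal np.
have hk : [set` root_ker p] h by rewrite /= mem_root_ker hH.
rewrite !actE n2 (h1 _ hk) (h1' _ hk) refl_act // root_of_root //; congr (_ + _ *: _).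
by rewrite scaler_nat mulr2n opprD addrA addrN sub0r.
Qed.

(** Basis vectors away from the two indices of [p] lie in its kernel, so [q] uses the same indices.
    The vector e_(p.1) - e_(p.2), also in the kernel, then fixes the signs, leaving [q] equal to [p]
    up to order and negation. *)
Lemma root_ker_sub p q : p.1.1 != p.2.1 -> q.1.1 != q.2.1 ->
  (root_ker p <= root_ker q)%VS -> refl p = refl q.
Proof.
move=> np nq /subvP sub.
have pairq v : root_of v p = 0 -> root_of v q = 0.
  by move=> vp; apply/eqP; rewrite -mem_root_ker sub // mem_root_ker vp.
suff [->|[->|[->|->]]] : q = p \/ q = (p.2, p.1) \/ q = popp p \/ q = popp (p.2, p.1).
- by [].
- by rewrite refl_swap.
- by rewrite refl_popp.
- by rewrite refl_popp /= 1?eq_sym // refl_swap.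
have delta (l : 'I_n) : l != p.1.1 -> l != p.2.1 -> l != q.1.1 /\ l != q.2.1.
  move=> l1 l2; pose v : 'rV[R]_n := \row_i (i == l)%:R.
  have c0 (x : S) : x.1 != l -> signed_coord (vec_fun v) x = 0.
    by move=> /negbTE h; rewrite /signed_coord /vec_fun !mxE h oppr0 if_same.
  have c1 (x : S) : x.1 = l -> signed_coord (vec_fun v) x != 0.
    by move=> h; rewrite /signed_coord /vec_fun !mxE h eqxx; case: x.2; rewrite ?oppr_eq0 oner_eq0.
  have p1 : p.1.1 != l by rewrite eq_sym.
  have p2 : p.2.1 != l by rewrite eq_sym.
  have := pairq v; rewrite /root_of /rootval (c0 _ p1) (c0 _ p2) addr0 => /(_ erefl) q0.
  split; apply/eqP=> e.
    have nl : q.2.1 != l by rewrite e eq_sym.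
    by have := c1 q.1 (esym e); move: q0; rewrite (c0 _ nl) addr0 => ->; rewrite eqxx.
  have nl : q.1.1 != l by rewrite e.
  by have := c1 q.2 (esym e); move: q0; rewrite (c0 _ nl) add0r => ->; rewrite eqxx.
pose v : 'rV[R]_n :=
  \row_i ((i == p.1.1)%:R * (-1) ^+ p.1.2 - (i == p.2.1)%:R * (-1) ^+ p.2.2).
have vE x : signed_coord (vec_fun v) x =
   ((x == p.1)%:R - (x == p.2)%:R - (x == sopp p.1)%:R + (x == sopp p.2)%:R : int)%:~R.
  rewrite /signed_coord /vec_fun !mxE /signed_coord /sopp.
  case: p x {np sub pairq delta v} => [[i b] [j b']] [l c] /=.
  rewrite !xpair_eqE !natz intrD !intrB -!pmulrn /=.
  case: (l == i); case: (l == j); case: b; case: b'; case: c => /=;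
    rewrite ?mulr1n ?mulr0n ?expr0 ?expr1; ring.
have vp : root_of v p = 0.
  rewrite /root_of /rootval !vE -intrD.
  case: p np {sub pairq delta v vE} => [[i b] [j b']] /= nij; rewrite /sopp !xpair_eqE /=.
  by rewrite !eqxx (negPf nij) [j == i]eq_sym (negPf nij) /=; case: b; case: b'.
have := pairq v vp; rewrite /root_of /rootval !vE -intrD => /eqP; rewrite intr_eq0.
have q1 : (q.1.1 == p.1.1) || (q.1.1 == p.2.1).
  by apply: contraT; rewrite negb_or => /andP[/delta h /h []]; rewrite eqxx.
have q2 : (q.2.1 == p.1.1) || (q.2.1 == p.2.1).
  by apply: contraT; rewrite negb_or => /andP[/delta h /h []]; rewrite eqxx.
case: p q np nq q1 q2 {sub pairq delta v vE vp} => [[i b] [j b']] [[i' d] [j' d']] /=.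
move=> nij nij' /orP[] /eqP ei /orP[] /eqP ej; subst; rewrite ?eqxx // in nij' *;
  rewrite /sopp /popp /sopp !xpair_eqE /= !eqxx [j == i]eq_sym (negPf nij) /=;
  case: b; case: b'; case: d; case: d' => //= _;
  first [by left | by right; left | by right; right; left | by right; right; right].
Qed.

Lemma arrangementP (H : set 'rV[R]_n) :
  typeD_arrangement H <-> exists2 p, p.1.1 != p.2.1 & H = [set` root_ker p].
Proof.
have hyp (x y : S) : typeD_hyperplane (R := R) x y = [set` root_ker (x, sopp y)].
  apply/seteqP; split=> v /=; rewrite mem_root_ker /root_of /rootval /= signed_coord_sopp subr_eq0.
    by move=> e; apply/eqP.
  by move/eqP.
split=> [[x [y [nxy nxy' ->]]]|[[x y] np ->]].
  exists (x, sopp y); last exact: hyp.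
  by rewrite /= eq_fst negb_or; apply/andP; split; apply/eqP.
exists x, (sopp y); split; last by rewrite hyp soppK'.
  by move=> e; case/negP: np; rewrite /= e.
by rewrite soppK' => e; case/negP: np; rewrite /= e.
Qed.

Lemma complementP v : arrangement_complement v <-> forall p, p.1.1 != p.2.1 -> root_of v p != 0.
Proof.
split=> [hv p np|hv [H /arrangementP[p np ->]]]; last first.
  by rewrite /= mem_root_ker; apply/negP/hv.
apply/negP => vp; apply: hv; exists [set` root_ker p]; last by rewrite /= mem_root_ker.
by apply/arrangementP; exists p.
Qed.

Lemma root_of_popp v p : root_of v (popp p) = - root_of v p.
Proof. exact: rootval_popp. Qed.

Lemma base_neq (u : W) p : p \in base_face u -> p.1.1 != p.2.1.
Proof. by rewrite inE => /andP[]. Qed.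

Lemma cone_complement (u : W) : cone u `<=` @arrangement_complement R n.
Proof.
move=> v hv; apply/complementP => p np.
case/orP: (base_total u n_gt1 np) => /hv; first by move/gt_eqF ->.
by rewrite root_of_popp oppr_gt0 => /lt_eqF ->.
Qed.

Lemma root_of_continuous p : continuous (fun v => root_of v p).
Proof.
have c x : continuous (fun v => signed_coord (vec_fun v) x).
  move=> v; have h := @coord_continuous R _ _ ord0 x.1 v.
  by rewrite /signed_coord; case: x.2; [exact: (continuousN h) | exact: h].
by move=> v; exact: (continuousD (c p.1 v) (c p.2 v)).
Qed.

(** The cone is convex, and a segment is connected. *)
Lemma cone_connected (u : W) v : cone u v ->
  cone u `<=` connected_component (@arrangement_complement R n) v.
Proof.
move=> hv y hy; pose f (t : R) : 'rV[R]_n := v + t *: (y - v).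
have fE t p : root_of (f t) p = (1 - t) * root_of v p + t * root_of y p.
  by rewrite /f root_ofD root_ofZ root_ofD -scaleN1r root_ofZ; ring.
exists (f @` `[0, 1]).
  split.
  - by exists 0; rewrite /f /= ?scale0r ?addr0 // in_itv /= lexx ler01.
  - move=> _ [t + <-]; rewrite /= in_itv /= => /andP[t0 t1].
    apply: (@cone_complement u) => p pP; rewrite fE.
    have [->|t_neq0] := eqVneq t 0; first by rewrite subr0 mul1r mul0r addr0; exact: hv.
    have t_gt0 : 0 < t by rewrite lt_neqAle eq_sym t_neq0.
    apply: ltr_wpDl; last by apply: mulr_gt0 => //; exact: hy.
    by apply: mulr_ge0; [rewrite subr_ge0 | exact/ltW/hv].
  - apply: connected_continuous_connected; first exact: segment_connected.
    apply: continuous_subspaceT => t; apply: cvgD; first exact: cvg_cst.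
    by apply: cvgZr_tmp; exact: cvg_id.
by exists 1; rewrite /f /= ?scale1r ?subrKC // ?in_itv /= ?ler01 ?lexx // addrC subrK.
Qed.

(** If a root changed its weak sign on a connected set, its image, an interval, would contain 0, and
    the set would meet a hyperplane. *)
Lemma component_cone (u : W) v : cone u v ->
  connected_component (@arrangement_complement R n) v `<=` cone u.
Proof.
move=> hv y [C [Cv sC cC] Cy] p pP; rewrite ltNge; apply/negP => yp.
have cI : connected ((fun v => root_of v p) @` C).
  apply: connected_continuous_connected => //.
  by apply: continuous_subspaceT; exact: root_of_continuous.
move/connected_intervalP: cI => /(_ (root_of y p) (root_of v p)) cI.
have /cI/(_ _ 0) : ((fun v => root_of v p) @` C) (root_of y p) by exists y.
have vC : ((fun v => root_of v p) @` C) (root_of v p) by exists v.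
move=> /(_ vC); rewrite yp (ltW (hv p pP)) => /(_ isT)[x Cx x0].
by have /complementP/(_ _ (base_neq pP)) := sC x Cx; rewrite x0 eqxx.
Qed.

Lemma chamber_cone (c : set 'rV[R]_n) : chamber c -> exists u, c = cone u.
Proof.
move=> [v vA ->].
have [h _ hpos] := @dominant n 1%g n_gt1 R [set: W]%G (vec_fun v) (fun=> finset.in_setT _).
exists h^-1%g; suff hv : cone h^-1%g v.
  by apply/seteqP; split; [exact: component_cone | exact: cone_connected].
move=> p pP; apply: (base_pos n_gt1 _ pP) => i.
have e : rootval (vec_fun v) (base_root h^-1%g i) =
    rootval (vec_act h (vec_fun v)) (base_root 1%g i).
  by rewrite rootval_vec_act /base_root root_act1.
rewrite lt_neqAle eq_sym {2}e hpos andbT.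
by move/complementP: vA; apply; exact: base_root_neq.
Qed.

Lemma closure_cone (u : W) v : closure (cone u) v -> forall p, p \in base_face u -> 0 <= root_of v p.
Proof.
move=> cv p pP.
have cl : closed ((fun v => root_of v p) @^-1` [set x | 0 <= x]).
  by apply: preimage_closed => [x _|]; [exact: root_of_continuous | exact: closed_ge].
apply: cl; apply: closureS cv => x hx /=; exact/ltW/hx.
Qed.

(** A small multiple of the base point, added to [v], makes all simple root values positive. *)
Lemma in_closure_cone (u : W) v : (forall i, 0 <= root_of v (base_root u i)) -> closure (cone u) v.
Proof.
move=> hv B /nbhs_ballP[e /= e_gt0 sB]; pose r : 'rV[R]_n := \row_i base_pt u R i.
have rE i : root_of r (base_root u i) = 1.
  rewrite -(base_pt_root u n_gt1 R i); apply: rootval_ext => l.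
  by rewrite /vec_fun mxE.
pose d := e / (2 * (1 + `|r|)); have r0 : 0 < 1 + `|r| by rewrite ltr_pwDl.
have d0 : 0 < d by rewrite divr_gt0 // mulr_gt0.
exists (v + d *: r); split.
  move=> p pP; apply: (base_pos n_gt1 _ pP) => i.
  by rewrite -/(root_of _ _) root_ofD root_ofZ rE mulr1 ltr_wpDl.
apply: sB; rewrite -ball_normE /= opprD addrA subrr sub0r normrN normrZ gtr0_norm //.
rewrite /d mulrAC ltr_pdivrMr ?mulr_gt0 // ltr_pM2l //.
by have := normr_ge0 r; move: `|r| => x; lra.
Qed.

(** If no simple hyperplane contained the spanning vectors of [H], then for each i one of them would
    be positive on the i-th simple root. Their sum would lie in the open cone and also on [H], which
    is impossible. *)
Lemma wall_base (u : W) H : wall (cone u) H ->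
  exists p i, [/\ p.1.1 != p.2.1, H = [set` root_ker p] &
    (root_ker p <= root_ker (base_root u i))%VS].
Proof.
move=> [/arrangementP[p np ->] [X [XH spanX]]].
have XK x : x \in X -> root_of x p = 0 /\ closure (cone u) x.
  move=> xX; have [h1 h2] := XH x xX; split=> //.
  by move: h1; rewrite /= mem_root_ker => /eqP.
have [/existsP[i /allP hi]|/existsPn no] :=
    boolP [exists i, all (fun x => root_of x (base_root u i) == 0) X].
  exists p, i; split=> //; apply/subvP => v vp.
  have : [set` <<X>>%VS] v by rewrite spanX.
  move=> /= vX; apply: subvP vX; apply/span_subvP => x /hi.
  by rewrite mem_root_ker.
have ch i : {x | x \in X & root_of x (base_root u i) != 0}.
  by apply/cid2; have /allPn[x xX hx] := no i; exists x.
pose s : 'rV[R]_n := \sum_i s2val (ch i).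
have root_sum q : root_of s q = \sum_i root_of (s2val (ch i)) q.
  apply: (big_morph (fun v => root_of v q)) => [x y|]; first exact: root_ofD.
  by rewrite -(scale0r (0 : 'rV[R]_n)) root_ofZ mul0r.
have sX i : s2val (ch i) \in X by case: (ch i).
have spos i : 0 < root_of s (base_root u i).
  rewrite root_sum (bigD1 i) //= ltr_wpDr //.
    apply: sumr_ge0 => j _; apply: (closure_cone (u := u)); first exact: (XK _ (sX j)).2.
    exact: base_root_in.
  rewrite lt_neqAle eq_sym; apply/andP; split; first by case: (ch i).
  apply: (closure_cone (u := u)); first exact: (XK _ (sX i)).2.
  exact: base_root_in.
have sp : root_of s p = 0 by rewrite root_sum big1 // => i _; exact: (XK _ (sX i)).1.
case/orP: (base_total u n_gt1 np) => /(base_pos n_gt1 spos).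
  by rewrite -/(root_of _ _) sp ltxx.
by rewrite -/(root_of _ _) root_of_popp sp oppr0 ltxx.
Qed.

Lemma base_wall (u : W) i : wall (cone u) [set` root_ker (base_root u i)].
Proof.
split; first by apply/arrangementP; exists (base_root u i) => //; exact: base_root_neq.
pose v0 : 'rV[R]_n := \row_l (vec_act u (fund_vec n_gt1 [set i]%SET) l)%:~R.
have rv0 j : root_of v0 (base_root u j) = 2 * (j != i)%:R.
  have := fund_root u n_gt1 [set i]%SET j; rewrite in_set1 => e.
  transitivity ((rootval (vec_act u (fund_vec n_gt1 [set i]%SET)) (base_root u j))%:~R : R).
    rewrite /root_of /rootval intrD; congr (_ + _); rewrite /signed_coord /vec_fun !mxE;
    by case: (_.2); rewrite ?intrN.
  by rewrite e intrM; case: (j == i).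
pose B := vbasis (root_ker (base_root u i)).
(* With this factor, adding a basis vector of the hyperplane changes each simple root value by at
   most 1, while [v0] has the value 2 on all simple roots but the i-th; so the sum stays in the
   closed cone. *)
pose eps (x : 'rV[R]_n) : R := (1 + \sum_j `|root_of x (base_root u j)|)^-1.
have eps_gt0 x : 0 < eps x by rewrite invr_gt0 ltr_pwDl // sumr_ge0.
have B0 x : x \in (B : seq _) -> root_of x (base_root u i) = 0.
  by move=> /vbasis_mem; rewrite mem_root_ker => /eqP.
have v0K : root_of v0 (base_root u i) = 0 by rewrite rv0 eqxx mulr0.
pose X := v0 :: [seq v0 + eps x *: x | x <- B].
have spanX : <<X>>%VS = root_ker (base_root u i).
  apply/eqP; rewrite eqEsubv; apply/andP; split.
    apply/span_subvP => x; rewrite inE => /orP[/eqP ->|/mapP[y yB ->]]; rewrite mem_root_ker.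
      by rewrite v0K.
    by rewrite root_ofD root_ofZ v0K B0 // mulr0 addr0.
  rewrite -(span_basis (vbasisP (root_ker (base_root u i)))); apply/span_subvP => x xB.
  have -> : x = (eps x)^-1 *: ((v0 + eps x *: x) - v0).
    by rewrite addrC addKr scalerA mulVf ?scale1r // gt_eqF.
  apply/memvZ/memvB; apply: memv_span; rewrite inE ?eqxx //.
  by apply/orP; right; apply/mapP; exists x.
exists X; split; last by rewrite spanX.
move=> x xX; split; first by rewrite /= -spanX; exact: memv_span.
apply: in_closure_cone => j; move: xX; rewrite /= inE => /orP[/eqP ->|/mapP[y yB ->]].
  by rewrite rv0 mulr_ge0.
rewrite root_ofD root_ofZ rv0; have [->|_] := eqVneq j i; first by rewrite B0 // !mulr0 addr0.
have h : `|eps y * root_of y (base_root u j)| <= 1.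
  rewrite normrM gtr0_norm // /eps mulrC ler_pdivrMr ?ltr_pwDl ?sumr_ge0 // mul1r.
  by rewrite (bigD1 j) //= addrCA lerDl addr_ge0 ?sumr_ge0.
by rewrite mulr1; move: h; rewrite ler_norml => /andP[+ _]; move: (eps y * _) => z; lra.
Qed.

Lemma simple_reflections_cone (u : W) : simple_reflections (cone u) = base_set u.
Proof.
apply/setP=> w; rewrite in_set; apply/asboolP/imsetP => [[H wH oH]|[i _ ->]].
  have [p [i [np eH sub]]] := wall_base wH; exists i => //.
  rewrite /base_refl -(root_ker_sub np _ sub) ?base_root_neq //.
  by apply: reflection_unique => //; rewrite -eH.
exists [set` root_ker (base_root u i)]; first exact: base_wall.
by apply: refl_orthogonal; exact: base_root_neq.
Qed.

End Geometry.

Local Close Scope ring_scope.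

Theorem theorem6p5 (m : nat) (k : fieldType) (R : realType)
    (c : set 'rV[R]_(2 * m + 1)) (hm : (2 <= m)%N)
    (hk : [pchar k]%R =i pred0 \/
          exists2 p : nat, p \in [pchar k]%R & ~~ (p %| #|{: typeD (2 * m + 1)}|)%N)
    (hc : chamber c) :
  is_loewy_length (descent_algebra k (simple_reflections c)) (m + 2).
Proof.
have n_gt1 : (1 < 2 * m + 1)%N by lia.
have [u ->] := chamber_cone n_gt1 hc; rewrite simple_reflections_cone //.
by apply: loewy_base hk; [lia | rewrite addn1].
Qed.
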